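(* Let $A$ be a finite dimensional hereditary algebra over an algebraically closed field $k$, let $A^{(1)}$ be its duplicated algebra, let $T$ be a basic tilting $A$-module, and let $\overline{T}=T\oplus\overline{P}$, where $\overline{P}$ is the direct sum of all non-isomorphic indecomposable projective-injective $A^{(1)}$-modules (so that $\overline{T}$ is a tilting $A^{(1)}$-module). Let $\mathcal{C}$ be the full subcategory of $\mathrm{mod}\,A$ consisting of the finite direct sums of indecomposable modules each of which lies in $\tau^{-1}\mathscr{F}(T_A)$ or in $\mathrm{add}\,A$. Then $\mathrm{End}_{A^{(1)}}(\overline{T})$ is representation-finite if and only if the full subcategory $$\{(X,Y,f)\mid X\in\mathrm{mod}\,A,\ Y\in\mathcal{C}\}$$ of $\mathrm{mod}\,T_2(A)$ is of finite type.
   Context: Modules are finitely generated right modules, and $D=\mathrm{Hom}_k(-,k)$. A $\Lambda$-module $T$ is tilting if $\mathrm{pd}\,T\le1$, $\mathrm{Ext}^1_\Lambda(T,T)=0$, and there is an exact sequence $0\to\Lambda\to T_0\to T_1\to0$ with $T_0,T_1\in\mathrm{add}\,T$; it is basic if its indecomposable direct summands are pairwise non-isomorphic. Here $\mathscr{F}(T_A)=\{X\in\mathrm{mod}\,A\mid \mathrm{Hom}_A(T,X)=0\}$ is the torsion-free class associated with $T$; $\tau$ is the Auslander-Reiten translation of $A$, and $\tau^{-1}\mathscr{F}(T_A)$ is the full subcategory of modules obtained by applying $\tau^{-1}$ to the objects of $\mathscr{F}(T_A)$. $\mathrm{add}\,A$ is the category of finitely generated projective $A$-modules. The duplicated algebra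 is the triangular matrix algebra $A^{(1)}=\begin{pmatrix} A & 0 \\ DA & A \end{pmatrix}$. Right $A^{(1)}$-modules are identified with triples $(X,Y,f)$ with $X,Y\in\mathrm{mod}\,A$ and $f:X\otimes_A DA\to Y$ an $A$-linear map; an $A$-module $T$ is viewed as the $A^{(1)}$-module $(0,T,0)$. $T_2(A)=\begin{pmatrix} A & 0 \\ A & A \end{pmatrix}$, and $\mathrm{mod}\,T_2(A)$ is identified with the category of triples $(X,Y,f)$ with $X,Y\in\mathrm{mod}\,A$ and $f:X\to Y$ an $A$-linear map; a morphism $(X_1,Y_1,f_1)\to(X_2,Y_2,f_2)$ is a pair of $A$-linear maps $x:X_1\to X_2$, $y:Y_1\to Y_2$ with $y f_1=f_2x$. A subcategory is of finite type if it has only finitely many isomorphism classes of indecomposable objects. *)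

(* Defs.v *)
From HB Require Import structures.
From mathcomp Require Import all_boot all_order all_algebra all_field.

Set Implicit Arguments.
Unset Strict Implicit.
Unset Printing Implicit Defensive.

Import GRing.Theory.
Local Open Scope ring_scope.

(* The opposite algebra, on the carrier A^c of the converse ring.             *)
HB.instance Definition _ (k : fieldType) (A : falgType k) :=
  Vector.copy A^c A.

Section ConverseAlgebra.
Variables (k : fieldType) (A : falgType k).

Fact converse_scaleAl (c : k) (a b : A^c) : c *: (a * b) = (c *: a : A^c) * b.
Proof. exact: (@scalerAr k A c (b : A) (a : A)). Qed.
HB.instance Definition _ := GRing.Lmodule_isLalgebra.Build k A^c converse_scaleAl.

Fact converse_scaleAr (c : k) (a b : A^c) : c *: (a * b) = a * (c *: b : A^c).
Proof. exact: (@scalerAl k A c (b : A) (a : A)). Qed.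
HB.instance Definition _ := GRing.Lalgebra_isAlgebra.Build k A^c converse_scaleAr.
End ConverseAlgebra.

(* Finitely generated right modules: over a finite dimensional algebra these  *)
(* are the right modules on a finite dimensional space.  Linearity of act in  *)
(* both arguments makes the k-structure the one induced by A.                 *)
Record rmod (k : fieldType) (A : falgType k) := Rmod {
  carrier :> vectType k;
  act : carrier -> A -> carrier;
  act_linearl : forall a, linear (act^~ a);
  act_linearr : forall x, linear (act x);
  act1 : forall x, act x 1 = x;
  actA : forall x a b, act x (a * b) = act (act x a) b
}.

Section Modules.
Variables (k : fieldType) (A : falgType k).
Implicit Types (M N X Y P E T : rmod A) (a b : A).

Definition ract_fun M a (x : M) : M := act x a.
HB.instance Definition _ M a := GRing.isLinear.Build k M M *:%R
  (@ract_fun M a) (@act_linearl _ _ M a).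

Definition ract M a : 'End(M) := linfun (@ract_fun M a).

Lemma ractE M a x : ract M a x = act x a. Proof. by rewrite lfunE. Qed.

Definition is_hom M N (f : 'Hom(M, N)) : Prop :=
  forall x a, f (act x a) = act (f x) a.

Definition hom_defect M N a (f : 'Hom(M, N)) : 'Hom(M, N) :=
  (f \o ract M a)%VF - (ract N a \o f)%VF.

Lemma hom_defectE M N a (f : 'Hom(M, N)) x :
  hom_defect a f x = f (act x a) - act (f x) a.
Proof. by rewrite add_lfunE opp_lfunE !comp_lfunE !ractE. Qed.

Fact hom_defect_linear M N a : linear (@hom_defect M N a).
Proof.
move=> c f g; rewrite /hom_defect comp_lfunDl comp_lfunDr.
by rewrite -comp_lfunZl -comp_lfunZr opprD addrACA scalerBr.
Qed.
HB.instance Definition _ M N a := GRing.isLinear.Build k 'Hom(M, N) 'Hom(M, N)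
  *:%R (@hom_defect M N a) (hom_defect_linear a).

(* The space Hom_A(M, N); see homvP.                                          *)
Definition homv M N : {vspace 'Hom(M, N)} :=
  (\bigcap_(i < \dim {:A}) lker (linfun (@hom_defect M N (vbasis {:A})`_i)))%VS.

Lemma homvP M N (f : 'Hom(M, N)) : reflect (is_hom f) (f \in homv M N).
Proof.
apply: (iffP idP) => [fH x a | fH].
  have fb i : (i < \dim {:A})%N ->
    f (act x (vbasis {:A})`_i) = act (f x) (vbasis {:A})`_i.
    move=> lti; have := subvP (bigcapv_inf (Ordinal lti) isT (subvv _)) f fH.
    rewrite memv_ker lfunE /= => /eqP/lfunP/(_ x)/eqP.
    by rewrite hom_defectE zero_lfunE subr_eq0 => /eqP.
  have lin N' (y : N') : act y a = \sum_(i < \dim {:A})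
      coord (vbasis {:A}) i a *: act y (vbasis {:A})`_i.
    rewrite {1}(coord_vbasis (memvf a)).
    pose L := GRing.isLinear.Build k A N' *:%R (act y) (act_linearr y).
    pose F : {linear A -> N'} := HB.pack (act y) L.
    rewrite -[LHS]/(F _) linear_sum; apply: eq_bigr => i _.
    exact: (linearZ_LR F).
  by rewrite !lin linear_sum; apply: eq_bigr => i _; rewrite linearZ /= fb.
rewrite memvE; apply/subv_bigcapP => i _; rewrite -memvE memv_ker lfunE /=.
by apply/eqP/lfunP => x; rewrite hom_defectE zero_lfunE fH subrr.
Qed.

Definition isom M N : Prop := exists f : 'Hom(M, N), is_hom f /\ bijective f.

Definition is_zero M : Prop := forall x : M, x = 0.

Fact zero_act_linearl a : linear (fun x : 'rV[k]_0 => x).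
Proof. by []. Qed.
Fact zero_act_linearr (x : 'rV[k]_0) : linear (fun _ : A => x).
Proof. by move=> c a b; rewrite !(thinmx0 x) scaler0 addr0. Qed.

Definition zero_mod : rmod A :=
  @Rmod _ A 'rV[k]_0 (fun x _ => x) zero_act_linearl zero_act_linearr
    (fun=> erefl) (fun _ _ _ => erefl).

Definition dsum_act M N (u : M * N) a : M * N := (act u.1 a, act u.2 a).
Fact dsum_act_linearl M N a : linear ((@dsum_act M N)^~ a).
Proof. by move=> c u v; rewrite /dsum_act /= !act_linearl. Qed.
Fact dsum_act_linearr M N (u : M * N) : linear (dsum_act u).
Proof. by move=> c a b; rewrite /dsum_act /= !act_linearr. Qed.
Fact dsum_act1 M N (u : M * N) : dsum_act u 1 = u.
Proof. by case: u => x y; rewrite /dsum_act /= !act1. Qed.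
Fact dsum_actA M N (u : M * N) a b :
  dsum_act u (a * b) = dsum_act (dsum_act u a) b.
Proof. by rewrite /dsum_act /= !actA. Qed.

Definition dsum M N : rmod A :=
  @Rmod _ A (M * N)%type (@dsum_act M N) (@dsum_act_linearl M N)
    (@dsum_act_linearr M N) (@dsum_act1 M N) (@dsum_actA M N).

Definition dsums n (S : 'I_n -> rmod A) : rmod A :=
  \big[dsum/zero_mod]_(i < n) S i.

Fact reg_act_linearl a : linear (fun x : A => x * a).
Proof. by move=> c x y; rewrite mulrDl scalerAl. Qed.
Fact reg_act_linearr (x : A) : linear (fun a : A => x * a).
Proof. by move=> c a b; rewrite mulrDr scalerAr. Qed.

Definition regular : rmod A :=
  @Rmod _ A A (fun x a => x * a) reg_act_linearl reg_act_linearr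
    (@mulr1 A) (@mulrA A).

Definition indecomposable M : Prop :=
  ~ is_zero M /\ forall X Y, isom M (dsum X Y) -> is_zero X \/ is_zero Y.

Definition in_add T X : Prop :=
  exists n Y, isom (dsum X Y) (dsums (fun _ : 'I_n => T)).

Definition injhom M N (f : 'Hom(M, N)) : Prop := is_hom f /\ lker f = 0%VS.
Definition surjhom M N (f : 'Hom(M, N)) : Prop := is_hom f /\ limg f = fullv.

Definition short_exact M N P (i : 'Hom(M, N)) (p : 'Hom(N, P)) : Prop :=
  [/\ injhom i, surjhom p & limg i = lker p].

Definition projective P : Prop :=
  forall M N (g : 'Hom(M, N)) (f : 'Hom(P, N)), surjhom g -> is_hom f ->
  exists h : 'Hom(P, M), is_hom h /\ f = (g \o h)%VF.

Definition injective_mod E : Prop :=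
  forall M N (g : 'Hom(M, N)) (f : 'Hom(M, E)), injhom g -> is_hom f ->
  exists h : 'Hom(N, E), is_hom h /\ f = (h \o g)%VF.

Definition pd_le1 M : Prop :=
  exists P1 P0 (d : 'Hom(P1, P0)) (p : 'Hom(P0, M)),
  [/\ projective P1, projective P0 & short_exact d p].

(* Ext^1(M, N) = 0, for Ext^1 as the group of extensions: every extension     *)
(* 0 -> N -> E -> M -> 0 is equivalent to the trivial one.                    *)
Definition ext1_eq0 M N : Prop :=
  forall E (i : 'Hom(N, E)) (p : 'Hom(E, M)), short_exact i p ->
  exists e : 'Hom(E, dsum N M), [/\ is_hom e, bijective e,
    forall y, e (i y) = (y, 0) & forall x, (e x).2 = p x].

Definition tilting T : Prop :=
  [/\ pd_le1 T, ext1_eq0 T T &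
      exists T0 T1 (i : 'Hom(regular, T0)) (p : 'Hom(T0, T1)),
        [/\ in_add T T0, in_add T T1 & short_exact i p]].

Definition pairwise_nonisom n (S : 'I_n -> rmod A) : Prop :=
  forall i j, i != j -> ~ isom (S i) (S j).

Definition basic T : Prop :=
  exists n (S : 'I_n -> rmod A), [/\ forall i, indecomposable (S i),
    pairwise_nonisom S & isom T (dsums S)].

Definition projinj_indec P : Prop :=
  [/\ indecomposable P, projective P & injective_mod P].

(* P is the direct sum of one representative of each isomorphism class of     *)
(* indecomposable projective-injective modules.                               *)
Definition sum_all_projinj P : Prop :=
  exists n (S : 'I_n -> rmod A), [/\ forall i, projinj_indec (S i),
    pairwise_nonisom S, forall X, projinj_indec X -> exists i, isom X (S i) &
    isom P (dsums S)].

Definition torsion_free T X : Prop := homv T X = 0%VS.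

Definition submod M (U : {vspace M}) : Prop :=
  forall x a, x \in U -> act x a \in U.

Definition superfluous M (K : {vspace M}) : Prop :=
  forall U, submod U -> (U + K)%VS = fullv -> U = fullv.

(* P1 -d-> P0 -p-> M -> 0 is exact, and P0 -> M and P1 -> Ker p are           *)
(* projective covers.                                                         *)
Definition min_proj_pres M P1 P0 (d : 'Hom(P1, P0)) (p : 'Hom(P0, M)) : Prop :=
  [/\ projective P1, projective P0, is_hom d, surjhom p &
      [/\ limg d = lker p, superfluous (lker p) & superfluous (lker d)]].

End Modules.

Definition hereditary (k : fieldType) (A : falgType k) : Prop :=
  forall (P M : rmod A) (i : 'Hom(M, P)),
  projective P -> injhom i -> projective M.

Definition representation_finite (k : fieldType) (B : falgType k) : Prop :=
  exists n (S : 'I_n -> rmod B),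
  forall M : rmod B, indecomposable M -> exists i, isom M (S i).

Section Translation.
Variables (k : fieldType) (A : falgType k).

(* D M is a left A-module, i.e. a right A^c-module: (a phi)(x) = phi (x a).   *)
Section Dual.
Variable M : rmod A.
Definition dual_act (phi : 'Hom(M, k^o)) (a : A^c) : 'Hom(M, k^o) :=
  (phi \o ract M a)%VF.
Fact dual_act_linearl a : linear (dual_act^~ a).
Proof. by move=> c f g; rewrite /dual_act comp_lfunDl -comp_lfunZl. Qed.
Fact dual_act_linearr phi : linear (dual_act phi).
Proof.
move=> c a b; apply/lfunP => x.
rewrite add_lfunE scale_lfunE !comp_lfunE !ractE -linearP.
by congr (phi _); exact: act_linearr.
Qed.
Fact dual_act1 phi : dual_act phi 1 = phi.
Proof. by apply/lfunP => x; rewrite comp_lfunE ractE act1. Qed.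
Fact dual_actA phi a b : dual_act phi (a * b) = dual_act (dual_act phi a) b.
Proof. by apply/lfunP => x; rewrite !comp_lfunE !ractE -actA. Qed.

Definition dual : rmod A^c :=
  @Rmod _ A^c 'Hom(M, k^o) dual_act dual_act_linearl dual_act_linearr
    dual_act1 dual_actA.
End Dual.

(* For a left A-module P, the right A-module Hom_A(P, A) with                 *)
(* (g a)(x) = g(x) a, the product being that of A.                            *)
Section RegularDual.
Variable P : rmod A^c.
Let H := homv P (regular A^c).

(* Right multiplication by a in A (and not in A^c).                           *)
Definition rmulA (a : A) : 'Hom(A^c, A^c) := @amulr k A a.
Lemma rmulAE (a x : A) : rmulA a x = @GRing.mul A x a.
Proof. exact: (@lfunE k A A (a \o* @idfun A) x). Qed.

Fact star_subproof (g : subvs_of H) (a : A) : (rmulA a \o vsval g)%VF \in H.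
Proof.
apply/homvP => x b; rewrite !comp_lfunE (homvP _ (subvsP g)) !rmulAE.
by rewrite -[LHS]/((b : A) * (vsval g x : A) * a) -mulrA.
Qed.
Definition star_act (g : subvs_of H) (a : A) : subvs_of H :=
  Subvs (star_subproof g a).
Fact star_act_linearl a : linear (star_act^~ a).
Proof.
move=> c f g; apply/val_inj; rewrite /= /star_act.
by rewrite comp_lfunDr -comp_lfunZr.
Qed.
Fact star_act_linearr g : linear (star_act g).
Proof.
move=> c a b; apply/val_inj/lfunP => x /=.
rewrite add_lfunE scale_lfunE !comp_lfunE !rmulAE.
exact: (reg_act_linearr (vsval g x : A) c a b).
Qed.
Fact star_act1 g : star_act g 1 = g.
Proof. by apply/val_inj/lfunP => x /=; rewrite comp_lfunE rmulAE mulr1. Qed.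
Fact star_actA g a b : star_act g (a * b) = star_act (star_act g a) b.
Proof.
by apply/val_inj/lfunP => x /=; rewrite !comp_lfunE !rmulAE mulrA.
Qed.

Definition star : rmod A :=
  @Rmod _ A (subvs_of H) star_act star_act_linearl star_act_linearr
    star_act1 star_actA.
End RegularDual.

(* X is a transpose of the left A-module N: the cokernel of                   *)
(* Hom(d, A) :  Hom(P0, A) -> Hom(P1, A) for a minimal projective             *)
(* presentation P1 -d-> P0 -> N -> 0.                                        *)
Definition is_transpose (N : rmod A^c) (X : rmod A) : Prop :=
  exists (P1 P0 : rmod A^c) (d : 'Hom(P1, P0)) (p : 'Hom(P0, N)),
  min_proj_pres d p /\
  exists q : 'Hom(star P1, X), surjhom q /\
    forall g : star P1,
      q g = 0 <-> exists h : star P0, vsval g = (vsval h \o d)%VF.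

(* tau^-1 = Tr D, determined up to isomorphism.                               *)
Definition is_tauinv (M X : rmod A) : Prop := is_transpose (dual M) X.

Definition in_tauinv_torsion_free (T X : rmod A) : Prop :=
  exists F, torsion_free T F /\ is_tauinv F X.

Definition in_C (T Y : rmod A) : Prop :=
  exists n (S : 'I_n -> rmod A),
    (forall i, indecomposable (S i) /\
       (in_tauinv_torsion_free T (S i) \/ in_add (regular A) (S i))) /\
    isom Y (dsums S).
End Translation.

(* Elements of the duplicated algebra: (a, phi, b) is the lower triangular    *)
(* matrix with rows (a, 0) and (phi, b).                                      *)
Definition dup (k : fieldType) (A : falgType k) : Type :=
  (A * 'Hom(A, k^o) * A)%type.

HB.instance Definition _ (k : fieldType) (A : falgType k) :=
  Vector.copy (dup A) (A * 'Hom(A, k^o) * A)%type.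

Section Duplicated.
Variables (k : fieldType) (A : falgType k).

(* In the A-A-bimodule DA, (phi a)(x) = phi (a x) and (b phi)(x) = phi (x b). *)
Definition DA_mulr (phi : 'Hom(A, k^o)) (a : A) : 'Hom(A, k^o) :=
  (phi \o amull a)%VF.
Definition DA_mull (b : A) (phi : 'Hom(A, k^o)) : 'Hom(A, k^o) :=
  (phi \o amulr b)%VF.

Lemma DA_mulrE phi a x : DA_mulr phi a x = phi (a * x).
Proof. by rewrite comp_lfunE lfunE. Qed.
Lemma DA_mullE b phi x : DA_mull b phi x = phi (x * b).
Proof. by rewrite comp_lfunE lfunE. Qed.

Definition dup_mul (u v : dup A) : dup A :=
  (u.1.1 * v.1.1, DA_mulr u.1.2 v.1.1 + DA_mull u.2 v.1.2, u.2 * v.2).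
Definition dup_one : dup A := (1, 0, 1).

Fact dup_mulA : associative dup_mul.
Proof.
move=> [[a f] b] [[a1 f1] b1] [[a2 f2] b2]; rewrite /dup_mul /= !mulrA.
congr (_, _, _); apply/lfunP => x.
by rewrite !(add_lfunE, DA_mulrE, DA_mullE) !mulrA addrA.
Qed.
Fact dup_mul1l : left_id dup_one dup_mul.
Proof.
move=> [[a f] b]; rewrite /dup_mul /= !mul1r; congr (_, _, _).
by apply/lfunP => x; rewrite add_lfunE DA_mulrE DA_mullE zero_lfunE add0r mulr1.
Qed.
Fact dup_mul1r : right_id dup_one dup_mul.
Proof.
move=> [[a f] b]; rewrite /dup_mul /= !mulr1; congr (_, _, _).
by apply/lfunP => x; rewrite add_lfunE DA_mulrE DA_mullE zero_lfunE addr0 mul1r.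
Qed.
Fact dup_mulDl : left_distributive dup_mul +%R.
Proof.
move=> [[a f] b] [[a1 f1] b1] [[a2 f2] b2]; rewrite /dup_mul /= !mulrDl.
congr (_, _, _); apply/lfunP => x.
by rewrite !(add_lfunE, DA_mulrE, DA_mullE) mulrDr linearD addrACA.
Qed.
Fact dup_mulDr : right_distributive dup_mul +%R.
Proof.
move=> [[a f] b] [[a1 f1] b1] [[a2 f2] b2]; rewrite /dup_mul /= !mulrDr.
congr (_, _, _); apply/lfunP => x.
by rewrite !(add_lfunE, DA_mulrE, DA_mullE) mulrDl linearD addrACA.
Qed.
Fact dup_one_neq0 : dup_one != 0.
Proof. by apply/eqP => -[/eqP]; rewrite oner_eq0. Qed.

HB.instance Definition _ := GRing.Zmodule_isNzRing.Build (dup A)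
  dup_mulA dup_mul1l dup_mul1r dup_mulDl dup_mulDr dup_one_neq0.

Fact dup_scaleAl (c : k) (u v : dup A) : c *: (u * v) = (c *: u : dup A) * v.
Proof.
case: u v => [[a f] b] [[a1 f1] b1]; congr (_, _, _); rewrite /= ?scalerAl //.
apply/lfunP => x; rewrite !(scale_lfunE, add_lfunE, DA_mulrE, DA_mullE).
by rewrite -scalerAr linearZ /= scalerDr.
Qed.
HB.instance Definition _ := GRing.Lmodule_isLalgebra.Build k (dup A) dup_scaleAl.

Fact dup_scaleAr (c : k) (u v : dup A) : c *: (u * v) = u * (c *: v : dup A).
Proof.
case: u v => [[a f] b] [[a1 f1] b1]; congr (_, _, _); rewrite /= ?scalerAr //.
apply/lfunP => x; rewrite !(scale_lfunE, add_lfunE, DA_mulrE, DA_mullE).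
by rewrite -scalerAl linearZ /= scalerDr.
Qed.
HB.instance Definition _ := GRing.Lalgebra_isAlgebra.Build k (dup A) dup_scaleAr.
HB.instance Definition _ := Algebra_isFalgebra.Build k (dup A).

(* T as the triple (0, T, 0).  In a right module M over the duplicated        *)
(* algebra, the triple (X, Y, f) has X = M e2, Y = M e1, and f given by the   *)
(* action of the elements (0, phi, 0) = e2 (0, phi, 0) e1; so here e1 acts as *)
(* the identity and e2 and DA act as 0.                                       *)
Section Inflation.
Variable T : rmod A.
Definition infl_act (x : T) (u : dup A) : T := act x u.1.1.
Fact infl_act_linearl u : linear (infl_act^~ u).
Proof. exact: act_linearl. Qed.
Fact infl_act_linearr x : linear (infl_act x).
Proof. by move=> c u v; rewrite /infl_act act_linearr. Qed.
Fact infl_act1 x : infl_act x 1 = x.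
Proof. exact: act1. Qed.
Fact infl_actA x u v : infl_act x (u * v) = infl_act (infl_act x u) v.
Proof. exact: actA. Qed.
Definition infl : rmod (dup A) :=
  @Rmod _ (dup A) T infl_act infl_act_linearl infl_act_linearr
    infl_act1 infl_actA.
End Inflation.
End Duplicated.

(* The algebra End_A(M), with (f * g) x = f (g x).  It is an algebra in the   *)
(* sense of the library only if M is nonzero (1 != 0), whence the hypothesis. *)
Section Endomorphisms.
Variables (k : fieldType) (A : falgType k) (M : rmod A).
Hypothesis nzM : ~ is_zero M.

Local Notation E := (subvs_of (homv M M)).

Fact endo_mul_subproof (f g : E) : (vsval f \o vsval g)%VF \in homv M M.
Proof.
apply/homvP => x a; rewrite !lfunE /= (homvP _ (subvsP g)).
by rewrite (homvP _ (subvsP f)).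
Qed.
Definition endo_mul (f g : E) : E := Subvs (endo_mul_subproof f g).

Fact endo_one_subproof : (\1%VF : 'End(M)) \in homv M M.
Proof. by apply/homvP => x a; rewrite !lfunE. Qed.
Definition endo_one : E := Subvs endo_one_subproof.

Fact endo_mulA : associative endo_mul.
Proof. by move=> f g h; apply/val_inj; rewrite /= comp_lfunA. Qed.
Fact endo_mul1l : left_id endo_one endo_mul.
Proof. by move=> f; apply/val_inj; rewrite /= comp_lfun1l. Qed.
Fact endo_mul1r : right_id endo_one endo_mul.
Proof. by move=> f; apply/val_inj; rewrite /= comp_lfun1r. Qed.
Fact endo_mulDl : left_distributive endo_mul +%R.
Proof. by move=> f g h; apply/val_inj; rewrite /= comp_lfunDl. Qed.
Fact endo_mulDr : right_distributive endo_mul +%R.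
Proof. by move=> f g h; apply/val_inj; rewrite /= comp_lfunDr. Qed.
Fact endo_one_neq0 : endo_one != 0.
Proof.
apply/eqP => /(congr1 val) /= /lfunP e; apply: nzM => x.
by have := e x; rewrite !lfunE.
Qed.

Definition endo_nzRing : nzRingType := HB.pack E
  (GRing.Zmodule_isNzRing.Build E endo_mulA endo_mul1l endo_mul1r
     endo_mulDl endo_mulDr endo_one_neq0).

Fact endo_scaleAl (c : k) (f g : endo_nzRing) :
  c *: (f * g : E) = endo_mul (c *: (f : E)) g.
Proof. by apply/val_inj; rewrite /= comp_lfunZl. Qed.
Fact endo_scaleAr (c : k) (f g : endo_nzRing) :
  c *: (f * g : E) = endo_mul f (c *: (g : E)).
Proof. by apply/val_inj; rewrite /= comp_lfunZr. Qed.

Definition endo_lalg : lalgType k := HB.pack E endo_nzRing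
  (GRing.Lmodule_isLalgebra.Build k endo_nzRing endo_scaleAl).
Definition endo_alg : algType k := HB.pack E endo_lalg
  (GRing.Lalgebra_isAlgebra.Build k endo_lalg endo_scaleAr).
Definition endo_falg : falgType k := HB.pack E endo_alg
  (Algebra_isFalgebra.Build k endo_alg).
End Endomorphisms.

Section Nonzero.
Variables (k : fieldType) (A : falgType k).

Lemma tilting_nonzero (T : rmod A) : tilting T -> ~ is_zero T.
Proof.
case=> _ _ [T0 [T1 [i [p [[n [Y [f [_ fbij]]]] _ [[_ ker_i] _ _]]]]]] T_0.
have S_0 : is_zero (dsums (fun _ : 'I_n => T)).
  rewrite /dsums; elim/big_rec: _ => [x | j M _ IH [x y]]; first exact: thinmx0.
  by rewrite (T_0 x) (IH y).
have i1 : i (1 : A) = 0.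
  have /(bij_inj fbij) : f (i (1 : A), 0) = f (0, 0) by rewrite !(S_0 (f _)).
  by case.
by move/eqP: i1; rewrite -memv_ker ker_i memv0 oner_eq0.
Qed.

Lemma Tbar_nonzero (T : rmod A) (P : rmod (dup A)) :
  tilting T -> ~ is_zero (dsum (infl T) P).
Proof.
by move=> /tilting_nonzero nzT z; apply: nzT => x; case: (z (x, 0)).
Qed.
End Nonzero.

(* mod T_2(A) as the category of triples (X, Y, f).                           *)
Record triple (k : fieldType) (A : falgType k) := Triple {
  tsrc : rmod A;
  ttgt : rmod A;
  tmap : 'Hom(tsrc, ttgt);
  tmap_hom : is_hom tmap
}.

Section Triples.
Variables (k : fieldType) (A : falgType k).
Implicit Types s t u : triple A.

Definition tmorph s t (x : 'Hom(tsrc s, tsrc t)) (y : 'Hom(ttgt s, ttgt t)) :=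
  [/\ is_hom x, is_hom y & (y \o tmap s = tmap t \o x)%VF].

Definition tisom s t : Prop :=
  exists x y, [/\ @tmorph s t x y, bijective x & bijective y].

Section Sum.
Variables s t : triple A.
Definition tsum_fun (u : dsum (tsrc s) (tsrc t)) : dsum (ttgt s) (ttgt t) :=
  (tmap s u.1, tmap t u.2).
Fact tsum_fun_linear : linear tsum_fun.
Proof. by move=> c u v; rewrite /tsum_fun /= !linearP. Qed.
HB.instance Definition _ := GRing.isLinear.Build k _ _ *:%R
  tsum_fun tsum_fun_linear.
Fact tsum_hom : is_hom (linfun tsum_fun).
Proof. by move=> u a; rewrite !lfunE /= /tsum_fun /= !tmap_hom. Qed.
Definition tsum : triple A := Triple tsum_hom.
End Sum.

Definition tzero t : Prop := is_zero (tsrc t) /\ is_zero (ttgt t).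

Definition tindecomposable t : Prop :=
  ~ tzero t /\ forall s u, tisom t (tsum s u) -> tzero s \/ tzero u.

(* C stands for a full subcategory closed under isomorphism and direct        *)
(* summands; its indecomposable objects are then the objects of C that are    *)
(* indecomposable among all triples.                                          *)
Definition finite_type (C : triple A -> Prop) : Prop :=
  exists n (S : 'I_n -> triple A),
  forall t, C t -> tindecomposable t -> exists i, tisom t (S i).
End Triples.

(* Main.v *)
From HB Require Import structures.
Require Import Defs.
From mathcomp Require Import all_boot all_order all_algebra all_field.
From Stdlib Require Import Classical ClassicalEpsilon.

Set Implicit Arguments.
Unset Strict Implicit.
Unset Printing Implicit Defensive.

Import GRing.Theory.
Local Open Scope ring_scope.

(** Write e1 for the idempotent of the duplicated algebra that acts as the identity on
    the modules (0, T, 0), and I for the A-module Pbar e1.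

    There is no nonzero map from Pbar to T, and restriction to Pbar e1 identifies
    End (Pbar) with End (I) and Hom (T, Pbar) with Hom (T, I): injectivity of Pbar
    makes Pbar e1 generated by the action of D A, and projectivity makes this action
    separate the rest of Pbar. Hence End (T + Pbar) is the algebra B of the
    endomorphisms of T + I that preserve I (endo_pair_ex). Moreover I is injective and
    cogenerates mod A, since the summands of the projective-injective module
    (A, D A, 1) occur in Pbar, and D A is the corner of that module.

    The category C is the left orthogonal of T, formed by the Y with Ext^1 (Y, T) = 0
    (in_C_vanish). Indeed Ext^1 (Y, T) = D Hom (T, tau Y), so that for an
    indecomposable nonprojective Y it vanishes exactly when Y = tau^-1 F with F
    torsion-free.

    By duality, left B-modules may be used in place of right ones. Two contravariant
    functors relate them to triples,
      M |-> (Hom_B (M, T + I) -> Hom_B (M, T)),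
      (X, Y, f) |-> Hom_A (Y, T) + Hom_A (X, I).
    When Y is in C, it is cogenerated by T (tilting_cogenerates), and so is the cokernel
    of its approximation Y -> T^n, which is in C again. This makes the canonical map
    from Y to the double dual with respect to T bijective (cogenerated_reflexive); the
    same holds for X and I, because I cogenerates everything. Hence a triple with Y in
    C is recovered from its B-module (to_triple_to_module), and if B is
    representation-finite there are finitely many indecomposable triples of this kind.

    Conversely, let M be an indecomposable left B-module, and W its corner belonging to
    T, a module over E = End (T). A presentation of W exhibits Y = Hom_E (W, T) as the
    kernel of a map T^a -> T^b, and thus Y is in C. As in the theory of tilted
    algebras, the canonical map from W to its double dual is onto, and splits because A
    is hereditary (presented_splitting). Hence either M is recovered from its triple, or
    M is exceptional: the action of B factors through E and Hom_E (M, T) = 0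
    (to_module_to_triple). An exceptional module is Ext^1_A (C, T) for a cokernel C of
    an injective map T^a -> T^b (exceptional_ext), and C can be taken indecomposable.
    If there are finitely many indecomposable triples with Y in C, then A is
    representation-finite, by considering the triples (X, 0, 0), and there are finitely
    many exceptional modules (ext_finite). *)

(** * Linear maps *)

Notation homs M N := (subvs_of (homv M N)).

Lemma choice_fun (I T : Type) (R : I -> T -> Prop) :
  (forall i, exists t, R i t) -> exists f, forall i, R i (f i).
Proof.
move=> exR; exists (fun i => proj1_sig (constructive_indefinite_description _ (exR i))).
by move=> i; case: constructive_indefinite_description.
Qed.

Section LinearMaps.
Variable k : fieldType.
Implicit Types V W Z : vectType k.

Lemma lfun_exists V W (f : V -> W) : linear f -> exists g : 'Hom(V, W), g =1 f.
Proof.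
move=> f_lin; pose L := GRing.isLinear.Build k V W *:%R f f_lin.
by pose F : {linear V -> W} := HB.pack f L; exists (linfun F) => x; rewrite lfunE.
Qed.

Lemma lfunDZ V W c (f g : 'Hom(V, W)) x : (c *: f + g) x = c *: f x + g x.
Proof. by rewrite add_lfunE scale_lfunE. Qed.

Lemma sub_lfunE V W (f g : 'Hom(V, W)) x : (f - g) x = f x - g x.
Proof. by rewrite add_lfunE opp_lfunE. Qed.

Lemma homs_eq V W (U : {vspace 'Hom(V, W)}) (f g : subvs_of U) :
  (forall x, val f x = val g x) -> f = g.
Proof. by move=> fg; apply: val_inj; apply/lfunP. Qed.

Lemma bilinear_lfun V W Z (f : V -> W -> Z) :
    (forall w, linear (f^~ w)) -> (forall v, linear (f v)) ->
  exists F : 'Hom(V, 'Hom(W, Z)), forall v w, F v w = f v w.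
Proof.
move=> linl linr; have [g gE] := choice_fun (fun v => lfun_exists (linr v)).
have [F FE] : exists F : 'Hom(V, 'Hom(W, Z)), forall v, F v = g v.
  by apply: lfun_exists => c x y; apply/lfunP => w; rewrite lfunDZ !gE linl.
by exists F => v w; rewrite FE gE.
Qed.

Lemma vspace_eq0 V (U : {vspace V}) : (forall x, x \in U -> x = 0) -> U = 0%VS.
Proof.
by move=> U0; apply/eqP; rewrite -subv0; apply/subvP => x /U0 ->; rewrite mem0v.
Qed.

Lemma vspace_full V (U : {vspace V}) : (forall x, x \in U) -> U = fullv.
Proof. by move=> UT; apply/vspaceP => x; rewrite UT memvf. Qed.

Lemma lker_eq0 V W (f : 'Hom(V, W)) : (forall x, f x = 0 -> x = 0) -> lker f = 0%VS.
Proof. by move=> f0; apply: vspace_eq0 => x; rewrite memv_ker => /eqP/f0. Qed.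

Lemma exact_comp V W Z (i : 'Hom(V, W)) (p : 'Hom(W, Z)) :
  limg i = lker p -> forall x, p (i x) = 0.
Proof. by move=> ip x; apply/eqP; rewrite -memv_ker -ip memv_img ?memvf. Qed.

Lemma exact_lift V W Z (i : 'Hom(V, W)) (p : 'Hom(W, Z)) :
  limg i = lker p -> forall y, p y = 0 -> exists x, y = i x.
Proof.
by move=> ip y /eqP; rewrite -memv_ker -ip => /memv_imgP[x _ ->]; exists x.
Qed.

Lemma comp_inv_lfun V W Z (p : 'Hom(V, W)) (g : 'Hom(V, Z)) :
  (forall x, p x = 0 -> g x = 0) -> forall x, g (p^-1%VF (p x)) = g x.
Proof.
move=> ker_pg x; apply/eqP; rewrite -subr_eq0 -linearB; apply/eqP/ker_pg.
by rewrite linearB /= limg_lfunVK ?subrr // memv_img ?memvf.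
Qed.

Lemma limg_full V W (p : 'Hom(V, W)) y : limg p = fullv -> exists x, y = p x.
Proof.
by move=> p_onto; have := memvf y; rewrite -p_onto => /memv_imgP[x _ ->]; exists x.
Qed.

Lemma onto_limg V W (p : 'Hom(V, W)) : (forall y, exists x, y = p x) -> limg p = fullv.
Proof.
move=> p_onto; apply: vspace_full => y.
by have [x ->] := p_onto y; rewrite memv_img ?memvf.
Qed.

Lemma limgP V W (f : 'Hom(V, W)) y : y \in limg f <-> exists x, y = f x.
Proof. by split=> [/memv_imgP[x _ ->]|[x ->]]; [exists x | rewrite memv_img ?memvf]. Qed.

Lemma lker0_inj V W (f : 'Hom(V, W)) : lker f = 0%VS <-> injective f.
Proof. by split=> [/eqP/lker0P | /lker0P/eqP]. Qed.

Lemma bij_lfunP V W (f : 'Hom(V, W)) :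
  bijective f <-> injective f /\ limg f = fullv.
Proof.
split=> [f_bij | [f_inj f_onto]].
  split; first exact: bij_inj.
  by case: f_bij => g _ gK; apply: onto_limg => y; exists (g y).
have ker_f : lker f == 0%VS by apply/lker0P.
exists f^-1%VF; first exact: lker0_lfunK.
by move=> y; rewrite limg_lfunVK // f_onto memvf.
Qed.

Lemma lker_1Bproj V (U : {vspace V}) : lker (\1 - projv U)%VF = U.
Proof.
apply/vspaceP => x; rewrite memv_ker sub_lfunE id_lfunE subr_eq0.
apply/eqP/idP => [-> | xU]; first exact: memv_proj.
by rewrite projv_id.
Qed.

Lemma functional_sep V (U : {vspace V}) x : x \notin U ->
  exists phi : 'Hom(V, k^o), (forall u, u \in U -> phi u = 0) /\ phi x <> 0.
Proof.
move=> xU; pose p := (\1 - projv U)%VF : 'End(V).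
have px : p x != 0 by rewrite -memv_ker lker_1Bproj.
have [i ci] : exists i, coord (vbasis {:V}) i (p x) <> 0.
  apply: NNPP => no_i; case/eqP: px; rewrite (coord_vbasis (memvf (p x))).
  rewrite big1 // => i _; suff -> : coord (vbasis {:V}) i (p x) = 0 by rewrite scale0r.
  by apply: NNPP => ci; apply: no_i; exists i.
have [c cE] : exists c : 'Hom(V, k^o), c =1 coord (vbasis {:V}) i.
  by apply: lfun_exists => a u v; rewrite linearP.
exists (c \o p)%VF; split=> [u uU|]; rewrite comp_lfunE cE //.
by move: uU; rewrite -{1}(lker_1Bproj U) memv_ker => /eqP ->; rewrite linear0.
Qed.

Lemma functional_sep0 V (x : V) : x <> 0 -> exists phi : 'Hom(V, k^o), phi x <> 0.
Proof.
move=> /eqP x0; have [|phi [_ phix]] := @functional_sep V 0%VS x.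
  by rewrite memv0.
by exists phi.
Qed.

Lemma functional_eq V (x y : V) : (forall phi : 'Hom(V, k^o), phi x = phi y) -> x = y.
Proof.
move=> xy; apply/eqP; rewrite -subr_eq0; apply/eqP; apply: NNPP => /functional_sep0[phi].
by rewrite linearB /= xy subrr.
Qed.

End LinearMaps.

(** * Modules and their homomorphisms *)

Section Homs.
Variables (k : fieldType) (A : falgType k).
Implicit Types (M N X Y P Q T : rmod A) (a b : A).

Lemma actDl M (x y : M) a : act (x + y) a = act x a + act y a.
Proof. by rewrite -!ractE linearD. Qed.
Lemma actBl M (x y : M) a : act (x - y) a = act x a - act y a.
Proof. by rewrite -!ractE linearB. Qed.
Lemma actNl M (x : M) a : act (- x) a = - act x a.
Proof. by rewrite -!ractE linearN. Qed.
Lemma act0l M a : act (0 : M) a = 0.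
Proof. by rewrite -ractE linear0. Qed.
Lemma actZl M c (x : M) a : act (c *: x) a = c *: act x a.
Proof. by rewrite -!ractE linearZ. Qed.
Lemma act_suml M (I : Type) (r : seq I) (F : I -> M) a :
  act (\sum_(i <- r) F i) a = \sum_(i <- r) act (F i) a.
Proof. by rewrite -ractE linear_sum; apply: eq_bigr => i _; exact: ractE. Qed.

Lemma act_lfun M (x : M) : exists f : 'Hom(A, M), forall a, f a = act x a.
Proof. by apply: lfun_exists; exact: act_linearr. Qed.
Lemma actDr M (x : M) a b : act x (a + b) = act x a + act x b.
Proof. by have [f fE] := act_lfun x; rewrite -!fE linearD. Qed.
Lemma act0r M (x : M) : act x 0 = 0.
Proof. by have [f fE] := act_lfun x; rewrite -!fE linear0. Qed.
Lemma hom_id M : is_hom (\1%VF : 'End(M)).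
Proof. by move=> x a; rewrite !id_lfunE. Qed.

Lemma hom_comp M N P (g : 'Hom(N, P)) (f : 'Hom(M, N)) :
  is_hom g -> is_hom f -> is_hom (g \o f)%VF.
Proof. by move=> g_hom f_hom x a; rewrite !comp_lfunE f_hom g_hom. Qed.

Lemma hom_add M N (f g : 'Hom(M, N)) : is_hom f -> is_hom g -> is_hom (f + g).
Proof. by move=> f_hom g_hom x a; rewrite !add_lfunE f_hom g_hom actDl. Qed.

Lemma hom_opp M N (f : 'Hom(M, N)) : is_hom f -> is_hom (- f).
Proof. by move=> f_hom x a; rewrite !opp_lfunE f_hom actNl. Qed.

Lemma hom_sub M N (f g : 'Hom(M, N)) : is_hom f -> is_hom g -> is_hom (f - g).
Proof. by move=> f_hom g_hom; apply: hom_add => //; apply: hom_opp. Qed.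

Lemma hom_zero M N : is_hom (0 : 'Hom(M, N)).
Proof. by move=> x a; rewrite !zero_lfunE act0l. Qed.

Lemma hom_exists M N (f : M -> N) : linear f ->
    (forall x a, f (act x a) = act (f x) a) ->
  exists g : 'Hom(M, N), is_hom g /\ forall x, g x = f x.
Proof.
by move=> /lfun_exists[g gE] f_act; exists g; split=> // x a; rewrite !gE f_act.
Qed.

Lemma hom_inv M N (f : 'Hom(M, N)) : is_hom f -> bijective f ->
  [/\ is_hom (f^-1)%VF, cancel f (f^-1)%VF & cancel (f^-1)%VF f].
Proof.
move=> f_hom /bij_lfunP[f_inj f_onto].
have ker_f : lker f == 0%VS by apply/lker0P.
have f'K : cancel (f^-1)%VF f by move=> y; rewrite limg_lfunVK // f_onto memvf.
split=> //; last exact: lker0_lfunK.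
by move=> y a; apply: f_inj; rewrite f'K f_hom f'K.
Qed.

Lemma isomP M N : isom M N -> exists (f : 'Hom(M, N)) (g : 'Hom(N, M)),
  [/\ is_hom f, is_hom g, cancel f g & cancel g f].
Proof.
by case=> f [f_hom f_bij]; exists f, (f^-1)%VF; have [] := hom_inv f_hom f_bij.
Qed.

Lemma isom_refl M : isom M M.
Proof. by exists \1%VF; split; [exact: hom_id | exists \1%VF => x; rewrite !id_lfunE]. Qed.

Lemma isom_sym M N : isom M N -> isom N M.
Proof. by case/isomP => f [g [f_hom g_hom fK gK]]; exists g; split=> //; exists f. Qed.

Lemma isom_trans N M P : isom M N -> isom N P -> isom M P.
Proof.
case=> f [f_hom f_bij] [g [g_hom g_bij]]; exists (g \o f)%VF; split; first exact: hom_comp.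
by apply: (eq_bij (bij_comp g_bij f_bij)) => x; rewrite comp_lfunE.
Qed.

Lemma isom_zero M N : isom M N -> is_zero M -> is_zero N.
Proof. by case=> f [_ [g _ gK]] M0 y; rewrite -(gK y) (M0 (g y)) linear0. Qed.

Lemma isom_can M N (f : M -> N) (g : N -> M) : linear f ->
  (forall x a, f (act x a) = act (f x) a) -> cancel f g -> cancel g f -> isom M N.
Proof.
move=> /lfun_exists[h hE] f_act fK gK; exists h; split=> [x a|].
  by rewrite !hE f_act.
by exists g => x; rewrite hE ?fK ?gK.
Qed.

Lemma hom_factor M N P (p : 'Hom(M, N)) (g : 'Hom(M, P)) :
    surjhom p -> is_hom g -> (forall x, p x = 0 -> g x = 0) ->
  exists h : 'Hom(N, P), is_hom h /\ forall x, h (p x) = g x.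
Proof.
move=> [p_hom p_onto] g_hom ker_pg; exists (g \o p^-1)%VF.
have hE x : (g \o p^-1)%VF (p x) = g x by rewrite comp_lfunE comp_inv_lfun.
split=> // y a; have [x ->] := limg_full y p_onto.
by rewrite -p_hom !hE g_hom.
Qed.

Lemma hom_corestrict M N P (i : 'Hom(N, P)) (g : 'Hom(M, P)) :
    injhom i -> is_hom g -> (forall x, exists y, g x = i y) ->
  exists h : 'Hom(M, N), is_hom h /\ forall x, i (h x) = g x.
Proof.
move=> [i_hom /lker0_inj i_inj] g_hom img_gi; exists (i^-1 \o g)%VF.
have hE x : i ((i^-1 \o g)%VF x) = g x.
  by rewrite comp_lfunE limg_lfunVK //; have [y ->] := img_gi x; rewrite memv_img ?memvf.
by split=> // x a; apply: i_inj; rewrite hE g_hom i_hom hE.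
Qed.

Lemma lker_submod M N (f : 'Hom(M, N)) : is_hom f -> submod (lker f).
Proof.
by move=> f_hom x a; rewrite !memv_ker f_hom => /eqP ->; rewrite act0l.
Qed.

Lemma limg_submod M N (f : 'Hom(M, N)) : is_hom f -> submod (limg f).
Proof.
move=> f_hom x a /memv_imgP[y _ ->]; rewrite -f_hom; exact: memv_img (memvf _).
Qed.

Lemma mem_homv M N (f : 'Hom(M, N)) : is_hom f -> exists h : homs M N, val h = f.
Proof. by move/homvP => fH; exists (Subvs fH). Qed.

Lemma subvs_hom M N (h : homs M N) : is_hom (val h).
Proof. exact/homvP/subvsP. Qed.

Lemma homv_precomp M N P (f : 'Hom(M, N)) : is_hom f ->
  exists F : 'Hom(homs N P, homs M P),
    forall h x, val (F h) x = val h (f x).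
Proof.
move=> f_hom.
have [F0 F0E] := choice_fun (fun h : homs N P => mem_homv (hom_comp (subvs_hom h) f_hom)).
have [F FE] : exists F : 'Hom(homs N P, homs M P), forall h, F h = F0 h.
  apply: lfun_exists => c h h'; apply: val_inj; rewrite linearP /= !F0E.
  by rewrite linearP /= comp_lfunDl comp_lfunZl.
by exists F => h x; rewrite FE F0E comp_lfunE.
Qed.

Lemma homv_postcomp M N P (g : 'Hom(N, P)) : is_hom g ->
  exists F : 'Hom(homs M N, homs M P),
    forall h x, val (F h) x = g (val h x).
Proof.
move=> g_hom.
have [F0 F0E] := choice_fun (fun h : homs M N => mem_homv (hom_comp g_hom (subvs_hom h))).
have [F FE] : exists F : 'Hom(homs M N, homs M P), forall h, F h = F0 h.
  apply: lfun_exists => c h h'; apply: val_inj; rewrite linearP /= !F0E.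
  by rewrite linearP /= comp_lfunDr comp_lfunZr.
by exists F => h x; rewrite FE F0E comp_lfunE.
Qed.

Section Submodule.
Variables (M : rmod A) (U : {vspace M}).

Lemma submodule_ex : submod U ->
  exists (S : rmod A) (i : 'Hom(S, M)), injhom i /\ limg i = U.
Proof.
move=> U_sub.
have [f fE] : exists f : A -> 'End(subvs_of U), forall a (x : subvs_of U),
    f a x = vsproj U (act (val x) a).
  by exists (fun a => linfun (vsproj U) \o ract M a \o linfun vsval)%VF => a x;
    rewrite !comp_lfunE lfunE ractE lfunE.
have valf a x : val (f a x) = act (val x) a.
  by rewrite fE; apply: vsprojK; apply: U_sub; apply: subvsP.
have lin1 a : linear (fun x => f a x) by move=> c x y; rewrite linearP.
have lin2 x : linear (fun a => f a x).
  by move=> c a b; apply: val_inj; rewrite /= !valf act_linearr.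
have un x : f 1 x = x by apply: val_inj; rewrite valf act1.
have as_ x a b : f (a * b) x = f b (f a x) by apply: val_inj; rewrite !valf actA.
exists (@Rmod k A (subvs_of U) (fun x a => f a x) lin1 lin2 un as_).
exists (linfun vsval); split; first split.
- by move=> x a; rewrite !lfunE; apply: valf.
- by apply/lker0_inj => x y; rewrite !lfunE; apply: val_inj.
apply/vspaceP => x; apply/memv_imgP/idP => [[y _ ->]|xU].
  by rewrite lfunE subvsP.
by exists (Subvs xU); rewrite ?memvf // lfunE.
Qed.

(** The quotient by U is carried by the image of a projection with kernel U. *)
Lemma quotient_ex : submod U ->
  exists (Q : rmod A) (p : 'Hom(M, Q)), surjhom p /\ lker p = U.
Proof.
move=> U_sub; pose p0 := (\1 - projv U)%VF : 'End(M).
pose p := (linfun (vsproj (limg p0)) \o p0)%VF : 'Hom(M, subvs_of (limg p0)).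
have valp x : val (p x) = p0 x.
  by rewrite comp_lfunE lfunE; apply: vsprojK; rewrite memv_img ?memvf.
have ker_p : lker p = U.
  rewrite -[RHS](lker_1Bproj U); apply/vspaceP => x.
  by rewrite !memv_ker -valp -(inj_eq val_inj).
have p_onto : limg p = fullv.
  apply: onto_limg => y; have /memv_imgP[x _ yE] := subvsP y.
  by exists x; apply: val_inj; rewrite valp.
pose f a : 'End(subvs_of (limg p0)) := (p \o ract M a \o p^-1)%VF.
have fp a x : f a (p x) = p (act x a).
  rewrite !comp_lfunE ractE.
  have := @comp_inv_lfun _ _ _ _ p (p \o ract M a)%VF _ x; rewrite !comp_lfunE !ractE; apply.
  move=> y /eqP; rewrite -memv_ker ker_p => yU.
  by apply/eqP; rewrite comp_lfunE ractE -memv_ker ker_p U_sub.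
have pP y : exists x, y = p x by apply: limg_full.
have lin1 a : linear (fun x => f a x) by move=> c x y; rewrite linearP.
have lin2 y : linear (fun a => f a y).
  by have [x ->] := pP y; move=> c a b; rewrite !fp act_linearr linearP.
have un y : f 1 y = y by have [x ->] := pP y; rewrite fp act1.
have as_ y a b : f (a * b) y = f b (f a y).
  by have [x ->] := pP y; rewrite !fp actA.
exists (@Rmod k A (subvs_of (limg p0)) (fun x a => f a x) lin1 lin2 un as_).
by exists p; split=> //; split=> // x a; rewrite -[RHS]/(f a (p x)) fp.
Qed.

End Submodule.

End Homs.
(** * Direct sums and powers *)

Section Sums.
Variables (k : fieldType) (A : falgType k).
Implicit Types (M N X Y P Q T : rmod A) (a b : A).

Lemma hom_fst M N : exists f : 'Hom(dsum M N, M), is_hom f /\ forall u, f u = u.1.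
Proof. exact: (@hom_exists _ _ (dsum M N) M fst). Qed.

Lemma hom_snd M N : exists f : 'Hom(dsum M N, N), is_hom f /\ forall u, f u = u.2.
Proof. exact: (@hom_exists _ _ (dsum M N) N snd). Qed.

Lemma hom_inl M N : exists f : 'Hom(M, dsum M N), is_hom f /\ forall x, f x = (x, 0).
Proof.
apply: (@hom_exists _ _ M (dsum M N) (fun x => (x, 0))) => [c x y|x a]; congr pair => /=.
  by rewrite scaler0 addr0.
by rewrite act0l.
Qed.

Lemma hom_inr M N : exists f : 'Hom(N, dsum M N), is_hom f /\ forall y, f y = (0, y).
Proof.
apply: (@hom_exists _ _ N (dsum M N) (fun y => (0, y))) => [c x y|x a]; congr pair => /=.
  by rewrite scaler0 addr0.
by rewrite act0l.
Qed.

Lemma dsum_split M N (u : dsum M N) : u = ((u.1, 0) : dsum M N) + ((0, u.2) : dsum M N).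
Proof. by case: u => x y; congr pair; rewrite /= ?addr0 ?add0r. Qed.

Lemma hom_pair P M N (f : 'Hom(P, M)) (g : 'Hom(P, N)) : is_hom f -> is_hom g ->
  exists h : 'Hom(P, dsum M N), is_hom h /\ forall x, h x = (f x, g x).
Proof.
move=> f_hom g_hom; apply: (@hom_exists _ _ P (dsum M N) (fun x => (f x, g x))) => [c x y|x a].
  by rewrite !linearP.
by rewrite f_hom g_hom.
Qed.

Lemma hom_copair P M N (f : 'Hom(M, P)) (g : 'Hom(N, P)) : is_hom f -> is_hom g ->
  exists h : 'Hom(dsum M N, P), is_hom h /\ forall u, h u = f u.1 + g u.2.
Proof.
move=> f_hom g_hom.
apply: (@hom_exists _ _ (dsum M N) P (fun u => f u.1 + g u.2)) => [c u v|u a] /=.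
  by rewrite !linearP addrACA scalerDr.
by rewrite f_hom g_hom actDl.
Qed.

Lemma homs_sum M N Q : exists x : 'Hom(homs (dsum M N) Q, (homs M Q * homs N Q)%type),
  bijective x /\ forall h, (forall m, val (x h).1 m = val h (m, 0)) /\
                           (forall n, val (x h).2 n = val h (0, n)).
Proof.
have [i [i_hom iE]] := hom_inl M N; have [j [j_hom jE]] := hom_inr M N.
have [p [p_hom pE]] := hom_fst M N; have [q [q_hom qE]] := hom_snd M N.
have [F FE] := homv_precomp Q i_hom; have [G GE] := homv_precomp Q j_hom.
have [F' F'E] := homv_precomp Q p_hom; have [G' G'E] := homv_precomp Q q_hom.
have [x xE] : exists x : 'Hom(homs (dsum M N) Q, (homs M Q * homs N Q)%type),
    forall h, x h = (F h, G h) by apply: lfun_exists => c h h'; rewrite !linearP.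
exists x; split=> [|h]; last by rewrite xE; split=> z; rewrite /= ?FE ?GE ?iE ?jE.
exists (fun u => F' u.1 + G' u.2) => [h|[h h']].
  apply: homs_eq => u; rewrite linearD /= add_lfunE F'E G'E xE /= FE GE.
  by rewrite -linearD iE jE pE qE -dsum_split.
rewrite xE; congr pair; apply: homs_eq => z.
  by rewrite FE linearD /= add_lfunE F'E G'E pE qE iE linear0 addr0.
by rewrite GE linearD /= add_lfunE F'E G'E pE qE jE linear0 add0r.
Qed.

Lemma isom_dsum_img X Y M (i : 'Hom(X, M)) (j : 'Hom(Y, M)) : injhom i -> injhom j ->
    (forall x y, i x = j y -> i x = 0) -> (forall z, exists x y, z = i x + j y) ->
  isom M (dsum X Y).
Proof.
move=> [i_hom /lker0_inj i_inj] [j_hom /lker0_inj j_inj] cap full; apply: isom_sym.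
have [s [s_hom sE]] := hom_copair i_hom j_hom; exists s; split=> //.
apply/bij_lfunP; split; last first.
  by apply: onto_limg => z; have [x [y ->]] := full z; exists (x, y); rewrite sE.
apply/lker0_inj/lker_eq0 => -[x y]; rewrite sE /= => ij0.
have ix0 : i x = 0 by apply: (cap x (- y)); rewrite linearN /= -[RHS]add0r -ij0 addrK.
move: ij0; rewrite ix0 add0r => jy0.
by congr pair; [apply: i_inj | apply: j_inj]; rewrite ?ix0 ?jy0 linear0.
Qed.

Lemma split_mono_summand X M (i : 'Hom(X, M)) (r : 'Hom(M, X)) :
  is_hom i -> is_hom r -> (forall x, r (i x) = x) -> exists Y, isom M (dsum X Y).
Proof.
move=> i_hom r_hom rK.
have [Y [j [j_injh rj]]] := submodule_ex (lker_submod r_hom).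
exists Y; apply: (@isom_dsum_img _ _ _ i j) => // [|x y ij|z].
- by split=> //; apply/lker0_inj/(can_inj rK).
- by rewrite -[x]rK ij (exact_comp rj) linear0.
have [|y yE] := exact_lift rj (y := z - i (r z)); first by rewrite linearB /= rK subrr.
by exists (r z), y; rewrite -yE addrC subrK.
Qed.

Lemma isom_dsum M M' N N' : isom M M' -> isom N N' -> isom (dsum M N) (dsum M' N').
Proof.
case=> f [f_hom [f' fK f'K]] [g [g_hom [g' gK g'K]]].
apply: (@isom_can _ _ (dsum M N) (dsum M' N')
  (fun u => (f u.1, g u.2)) (fun u => (f' u.1, g' u.2))).
- by move=> c u v; rewrite /= !linearP.
- by move=> u a; rewrite /= f_hom g_hom.
- by case=> x y; rewrite /= fK gK.
by case=> x y; rewrite /= f'K g'K.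
Qed.

Lemma dsumA_isom X Y P : isom (dsum (dsum X Y) P) (dsum X (dsum Y P)).
Proof.
by apply: (@isom_can _ _ (dsum (dsum X Y) P) (dsum X (dsum Y P)) (fun u => (u.1.1, (u.1.2, u.2)))
                             (fun u => ((u.1, u.2.1), u.2.2))) => //;
  [case=> [[]] | case=> [? []]].
Qed.

Lemma dsumC_isom X Y : isom (dsum X Y) (dsum Y X).
Proof.
by apply: (@isom_can _ _ (dsum X Y) (dsum Y X)
  (fun u => (u.2, u.1)) (fun u => (u.2, u.1))) => // -[].
Qed.

Lemma dsum_zero_isom X Y : is_zero Y -> isom X (dsum X Y).
Proof.
move=> Y0; apply: (@isom_can _ _ X (dsum X Y) (fun x => (x, 0)) (fun u => u.1)) => //.
- by move=> c x y; congr pair; rewrite (Y0 (_ + _)).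
- by move=> x a; congr pair; rewrite (Y0 (act _ _)).
by case=> x y; rewrite (Y0 y).
Qed.

Lemma zero_isom X Y : is_zero X -> is_zero Y -> isom X Y.
Proof.
move=> X0 Y0; apply: (@isom_can _ _ X Y (fun=> 0) (fun=> 0)) => [c x y|x a|x|y].
- by rewrite (Y0 (_ + _)).
- by rewrite act0l.
- by rewrite (X0 x).
by rewrite (Y0 y).
Qed.

Lemma isom_retract X Y Z : isom Y (dsum X Z) ->
  exists (i : 'Hom(X, Y)) (r : 'Hom(Y, X)), [/\ is_hom i, is_hom r & forall x, r (i x) = x].
Proof.
move=> /isomP[f [g [f_hom g_hom _ gK]]].
have [u [u_hom uE]] := hom_inl X Z; have [p [p_hom pE]] := hom_fst X Z.
exists (g \o u)%VF, (p \o f)%VF; split; try exact: hom_comp.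
by move=> z; rewrite !comp_lfunE gK pE uE.
Qed.

Lemma zero_mod_zero : is_zero (zero_mod A).
Proof. by move=> x; apply: thinmx0. Qed.

Lemma dsums_recl n (S : 'I_n.+1 -> rmod A) :
  dsums S = dsum (S ord0) (dsums (fun i => S (lift ord0 i))).
Proof. exact: big_ord_recl. Qed.

Lemma dsums0 (S : 'I_0 -> rmod A) : dsums S = zero_mod A.
Proof. exact: big_ord0. Qed.

Lemma eq_dsums n (S S' : 'I_n -> rmod A) : S =1 S' -> dsums S = dsums S'.
Proof. by move=> eqS; apply: eq_bigr. Qed.

Lemma dsums_ind (C : rmod A -> Prop) n (S : 'I_n -> rmod A) :
    C (zero_mod A) -> (forall M N, C M -> C N -> C (dsum M N)) ->
  (forall i, C (S i)) -> C (dsums S).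
Proof.
move=> C0 CD; elim: n => [|n IH] in S * => CS; first by rewrite dsums0.
by rewrite dsums_recl; apply: CD => //; apply: IH.
Qed.

Lemma dsums_summand n (S : 'I_n -> rmod A) i : exists Y, isom (dsums S) (dsum (S i) Y).
Proof.
elim: n S i => [|n IH] S i; first by case: i.
rewrite dsums_recl; have [->|[j ->]] : i = ord0 \/ exists j, i = lift ord0 j.
- by case: (unliftP ord0 i) => [j|] ->; [right; exists j | left].
- by eexists; apply: isom_refl.
have [Y SY] := IH (fun i => S (lift ord0 i)) j.
exists (dsum (S ord0) Y); apply: isom_trans (isom_dsum (isom_refl _) SY) _.
apply: isom_trans (isom_sym (dsumA_isom _ _ _)) _.
exact: isom_trans (isom_dsum (dsumC_isom _ _) (isom_refl _)) (dsumA_isom _ _ _).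
Qed.

Lemma dsums_sep n (S : 'I_n -> rmod A) (x : dsums S) : x <> 0 ->
  exists i (f : 'Hom(dsums S, S i)), is_hom f /\ f x <> 0.
Proof.
elim: n S x => [|n IH] S; first by rewrite dsums0 => x; case; apply: thinmx0.
rewrite dsums_recl => -[y z] yz0; case: (classic (y = 0)) => [y0|y0].
  have z0 : z <> 0 by move=> z0; apply: yz0; rewrite y0 z0.
  have [i [f [f_hom fz]]] := IH _ z z0.
  have [p [p_hom pE]] := hom_snd (S ord0) (dsums (fun i => S (lift ord0 i))).
  exists (lift ord0 i), (f \o p)%VF; split; first exact: hom_comp.
  by rewrite comp_lfunE pE.
have [p [p_hom pE]] := hom_fst (S ord0) (dsums (fun i => S (lift ord0 i))).
by exists ord0, p; rewrite pE.
Qed.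

Section Dimension.

Lemma isom_dim M N : isom M N -> \dim {:M} = \dim {:N}.
Proof.
case=> f [_ /bij_lfunP[/lker0_inj f_inj <-]].
by rewrite limg_dim_eq // f_inj capv0.
Qed.

Lemma dim_dsum M N : (\dim {: dsum M N} = \dim {:M} + \dim {:N})%N.
Proof. by rewrite !dimvf. Qed.

Lemma dim_gt0P M : reflect (is_zero M) (\dim {:M} == 0%N).
Proof.
rewrite dimv_eq0; apply: (iffP eqP) => [M0 x | M0].
  by have := memvf x; rewrite M0 memv0 => /eqP.
by apply: vspace_eq0 => x _.
Qed.

Lemma indec_cases M : [\/ is_zero M, indecomposable M |
  exists X Y, [/\ isom M (dsum X Y), ~ is_zero X, ~ is_zero Y,
    (\dim {:X} < \dim {:M})%N & (\dim {:Y} < \dim {:M})%N]].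
Proof.
case: (classic (is_zero M)) => [M0|nzM]; first by constructor 1.
case: (classic (indecomposable M)) => [M_ind|decM]; first by constructor 2.
constructor 3; apply: NNPP => noXY; apply: decM; split=> // X Y MXY.
apply: NNPP => /not_or_and[nzX nzY]; apply: noXY; exists X, Y; split=> //.
  by rewrite (isom_dim MXY) dim_dsum -[X in (X < _)%N]addn0 ltn_add2l lt0n; apply/dim_gt0P.
by rewrite (isom_dim MXY) dim_dsum -[X in (X < _)%N]add0n ltn_add2r lt0n; apply/dim_gt0P.
Qed.

Lemma indec_submod M (U V : {vspace M}) : indecomposable M -> submod U -> submod V ->
  (U :&: V = 0)%VS -> (U + V = fullv)%VS -> U = 0%VS \/ V = 0%VS.
Proof.
move=> [_ dec] U_sub V_sub UV0 UVT.
have [X [i [i_injh img_i]]] := submodule_ex U_sub.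
have [Y [j [j_injh img_j]]] := submodule_ex V_sub.
have img0 (Z : rmod A) (f : 'Hom(Z, M)) : is_zero Z -> limg f = 0%VS.
  by move=> Z0; apply: vspace_eq0 => _ /memv_imgP[z _ ->]; rewrite (Z0 z) linear0.
have MXY : isom M (dsum X Y).
  apply: isom_dsum_img i_injh j_injh _ _ => [x y ij|z].
    apply/eqP; rewrite -memv0 -UV0 memv_cap -img_i memv_img ?memvf //= ij -img_j.
    by rewrite memv_img ?memvf.
  have := memvf z; rewrite -UVT => /memv_addP[u].
  rewrite -img_i => /memv_imgP[x _ ->] [v]; rewrite -img_j => /memv_imgP[y _ ->] ->.
  by exists x, y.
by case: (dec _ _ MXY) => Z0; [left; rewrite -img_i | right; rewrite -img_j]; apply: img0.
Qed.

Lemma indec_summand M : ~ is_zero M ->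
  exists X Y, indecomposable X /\ isom M (dsum X Y).
Proof.
have [n] := ubnP (\dim {:M}); elim: n M => // n IH M; rewrite ltnS => leMn nzM.
case: (indec_cases M) => [//|M_ind|[X [Y [MXY nzX nzY ltXM _]]]].
  by exists M, (zero_mod A); split=> //; apply: dsum_zero_isom zero_mod_zero.
have [X1 [X2 [X1_ind XX]]] := IH X (leq_trans ltXM leMn) nzX.
exists X1, (dsum X2 Y); split=> //; apply: isom_trans MXY _.
exact: isom_trans (isom_dsum XX (isom_refl _)) (dsumA_isom _ _ _).
Qed.

Lemma dsums_indec M : exists n (S : 'I_n -> rmod A),
  (forall i, indecomposable (S i)) /\ isom M (dsums S).
Proof.
have [m] := ubnP (\dim {:M}); elim: m M => // m IH M ltMm.
case: (classic (is_zero M)) => [M0 | nzM].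
  exists 0, (fun=> zero_mod A); split; first by case.
  by rewrite dsums0; apply: zero_isom => //; apply: zero_mod_zero.
have [X [Y [X_ind MXY]]] := indec_summand nzM.
have [|n [S [S_ind YS]]] := IH Y.
  move: ltMm; rewrite (isom_dim MXY) dim_dsum ltnS; apply: leq_trans.
  by rewrite -[X in (X < _)%N]add0n ltn_add2r lt0n; apply/dim_gt0P; case: X_ind.
exists n.+1, (fun i => if unlift ord0 i is Some j then S j else X); split.
  by move=> i; case: unliftP => [j|] _.
rewrite dsums_recl unlift_none; apply: isom_trans MXY (isom_dsum (isom_refl _) _).
apply: isom_trans YS _; rewrite (eq_dsums (S' := S)); first exact: isom_refl.
by move=> i; rewrite liftK.
Qed.

End Dimension.

Section Power.
Variables (Q : rmod A) (n : nat).

Fact pow_act_linearl a : linear (fun x : {ffun 'I_n -> Q} => [ffun i => act (x i) a]).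
Proof. by move=> c x y; apply/ffunP => i; rewrite !ffunE act_linearl. Qed.
Fact pow_act_linearr (x : {ffun 'I_n -> Q}) : linear (fun a : A => [ffun i => act (x i) a]).
Proof. by move=> c a b; apply/ffunP => i; rewrite !ffunE act_linearr. Qed.
Fact pow_act1 (x : {ffun 'I_n -> Q}) : [ffun i => act (x i) 1] = x.
Proof. by apply/ffunP => i; rewrite !ffunE act1. Qed.
Fact pow_actA (x : {ffun 'I_n -> Q}) a b :
  [ffun i => act (x i) (a * b)] = [ffun i => act ([ffun i => act (x i) a] i) b].
Proof. by apply/ffunP => i; rewrite !ffunE actA. Qed.

Definition pow : rmod A := @Rmod _ A {ffun 'I_n -> Q}
  (fun x a => [ffun i => act (x i) a]) pow_act_linearl pow_act_linearr pow_act1 pow_actA.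

Lemma pow_actE (x : pow) a i : (act x a : {ffun 'I_n -> Q}) i = act (x i) a.
Proof. by rewrite ffunE. Qed.

Lemma pow_proj (i : 'I_n) : exists f : 'Hom(pow, Q), is_hom f /\ forall x : pow, f x = x i.
Proof.
apply: (@hom_exists _ _ pow Q (fun x => (x : {ffun 'I_n -> Q}) i)) => [c x y|x a].
  by rewrite !ffunE.
exact: pow_actE.
Qed.

Lemma pow_map M (h : 'I_n -> 'Hom(M, Q)) : (forall i, is_hom (h i)) ->
  exists f : 'Hom(M, pow), is_hom f /\ forall x i, (f x : {ffun 'I_n -> Q}) i = h i x.
Proof.
move=> h_hom; have [f fE] : exists f : 'Hom(M, pow), forall x, f x = [ffun i => h i x].
  by apply: lfun_exists => c x y; apply/ffunP => i; rewrite !ffunE linearP.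
exists f; split=> [x a | x i]; last by rewrite fE ffunE.
by rewrite !fE; apply/ffunP => i; rewrite pow_actE !ffunE h_hom.
Qed.

Lemma pow_comap M (h : 'I_n -> 'Hom(Q, M)) : (forall i, is_hom (h i)) ->
  exists f : 'Hom(pow, M), is_hom f /\ forall x : pow, f x = \sum_i h i (x i).
Proof.
move=> h_hom; apply: (@hom_exists _ _ pow M (fun x : pow => \sum_i h i (x i))) => [c x y|x a].
  by rewrite scaler_sumr -big_split; apply: eq_bigr => i _; rewrite !ffunE linearP.
by rewrite act_suml; apply: eq_bigr => i _; rewrite pow_actE h_hom.
Qed.

Lemma pow_inj (i : 'I_n) : exists f : 'Hom(Q, pow), is_hom f /\
  forall x j, (f x : {ffun 'I_n -> Q}) j = if j == i then x else 0.
Proof.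
have [|f [f_hom fE]] := @pow_map Q (fun j => if j == i then \1%VF else 0).
  by move=> j; case: ifP => _; [apply: hom_id | apply: hom_zero].
by exists f; split=> // x j; rewrite fE; case: ifP => _; rewrite ?id_lfunE ?zero_lfunE.
Qed.

Lemma hom_pow_sum M (f : 'Hom(pow, M)) : is_hom f ->
  exists h : 'I_n -> 'Hom(Q, M), (forall i, is_hom (h i)) /\
    forall x : pow, f x = \sum_i h i (x i).
Proof.
move=> f_hom; have [e eP] := choice_fun pow_inj.
exists (fun i => f \o e i)%VF; split=> [i|x].
  by apply: hom_comp => //; case: (eP i).
have {1}-> : x = \sum_i e i (x i).
  apply/ffunP => j; rewrite sum_ffunE (bigD1 j) //= (eP j).2 eqxx big1 ?addr0 //.
  by move=> i ij; rewrite (eP i).2 eq_sym (negPf ij).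
by rewrite linear_sum; apply: eq_bigr => i _; rewrite comp_lfunE.
Qed.

End Power.

Lemma pow_dsums Q n : isom (pow Q n) (dsums (fun _ : 'I_n => Q)).
Proof.
elim: n => [|n IH].
  rewrite dsums0; apply: zero_isom; last exact: zero_mod_zero.
  by move=> x; apply/ffunP => -[].
rewrite dsums_recl; apply: isom_trans (isom_dsum (isom_refl Q) IH).
apply: (@isom_can _ _ (pow Q n.+1) (dsum Q (pow Q n))
   (fun x => ((x : {ffun _ -> Q}) ord0, [ffun i => (x : {ffun _ -> Q}) (lift ord0 i)]))
   (fun u => [ffun i => if unlift ord0 i is Some j then (u.2 : {ffun _ -> Q}) j else u.1])).
- by move=> c x y; congr pair; rewrite ?ffunE //; apply/ffunP => i; rewrite !ffunE.
- by move=> x a; congr pair; rewrite ?ffunE //; apply/ffunP => i; rewrite !ffunE.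
- by move=> x; apply/ffunP => i; rewrite ffunE; case: unliftP => [j|] -> //=; rewrite ffunE.
case=> x y; congr pair; rewrite /= ?ffunE ?unlift_none //.
by apply/ffunP => i; rewrite !ffunE liftK.
Qed.

Lemma in_add_pow Q n X (i : 'Hom(X, pow Q n)) (r : 'Hom(pow Q n, X)) :
  is_hom i -> is_hom r -> (forall x, r (i x) = x) -> in_add Q X.
Proof.
move=> i_hom r_hom rK; have [Y XY] := split_mono_summand i_hom r_hom rK.
by exists n, Y; apply: isom_trans (isom_sym XY) (pow_dsums _ _).
Qed.

Lemma in_addP Q X : in_add Q X -> exists n (i : 'Hom(X, pow Q n)) (r : 'Hom(pow Q n, X)),
  [/\ is_hom i, is_hom r & forall x, r (i x) = x].
Proof.
case=> n [Y XY]; exists n; apply: isom_retract.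
exact: isom_trans (pow_dsums Q n) (isom_sym XY).
Qed.

End Sums.
(** * Projective modules and dual bases *)

Section Projective.
Variables (k : fieldType) (A : falgType k).
Implicit Types (M N K J X Y P Q T V : rmod A) (a b : A).

Definition dual_basis Q n (x : 'I_n -> Q) (xi : 'I_n -> 'Hom(Q, regular A)) : Prop :=
  (forall i, is_hom (xi i)) /\ forall q, q = \sum_i act (x i) (xi i q : A).

Definition has_dual_basis Q : Prop := exists n x xi, @dual_basis Q n x xi.

Lemma hom_regular M (x : M) : exists f : 'Hom(regular A, M),
  is_hom f /\ forall a : A, f a = act x a.
Proof.
have [f fE] := act_lfun x; exists f; split=> // y a.
by rewrite (fE (_ * _)) actA -(fE y).
Qed.

Lemma free_cover M : exists n (p : 'Hom(pow (regular A) n, M)), surjhom p.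
Proof.
have [h hP] := choice_fun (@hom_regular M).
pose x := vbasis {:M}.
have [p [p_hom pE]] := @pow_comap _ _ (regular A) (\dim {:M}) M
  (fun i => h x`_i) (fun i => (hP x`_i).1).
exists (\dim {:M}), p; split=> //; apply: onto_limg => y.
exists [ffun i => coord x i y *: (1 : A)]; rewrite pE [LHS](coord_vbasis (memvf y)).
by apply: eq_bigr => i _; rewrite ffunE linearZ /= (hP _).2 act1.
Qed.

Lemma projective_dual_basis P : projective P -> has_dual_basis P.
Proof.
move=> P_proj; have [n [p p_surj]] := free_cover P.
have [s [s_hom sE]] := P_proj _ _ p \1%VF p_surj (@hom_id _ _ P).
have [h [h_hom hE]] := hom_pow_sum p_surj.1.
have [pr prP] := choice_fun (@pow_proj _ _ (regular A) n).
exists n, (fun i => h i 1), (fun i => pr i \o s)%VF; split=> [i|q].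
  by apply: hom_comp => //; case: (prP i).
rewrite -{1}[q](@id_lfunE _ P) sE comp_lfunE hE; apply: eq_bigr => i _.
by rewrite comp_lfunE (prP i).2 -(h_hom i) /= mul1r.
Qed.

Lemma dual_basis_projective P : has_dual_basis P -> projective P.
Proof.
case=> n [x [xi [xi_hom xE]]] M N g f [g_hom g_onto] f_hom.
have [y yE] := choice_fun (fun i => limg_full (f (x i)) g_onto).
have [m mP] := choice_fun (fun i => hom_regular (y i)).
have [h [h_hom hE]] := pow_comap (fun i => (mP i).1).
have [u [u_hom uE]] := pow_map xi_hom.
exists (h \o u)%VF; split; first exact: hom_comp.
apply/lfunP => q; rewrite !comp_lfunE hE linear_sum {1}(xE q) linear_sum.
by apply: eq_bigr => i _; rewrite /= uE f_hom yE (mP i).2 g_hom.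
Qed.

Lemma free_dual_basis n : has_dual_basis (pow (regular A) n).
Proof.
have [pr prP] := choice_fun (@pow_proj _ _ (regular A) n).
have [e eP] := choice_fun (@pow_inj _ _ (regular A) n).
exists n, (fun i => e i 1), pr; split=> [i|q]; first by case: (prP i).
apply/ffunP => j; rewrite sum_ffunE (bigD1 j) //= big1 => [|i ij].
  by rewrite ffunE (eP j).2 eqxx (prP j).2 addr0 mul1r.
by rewrite ffunE (eP i).2 eq_sym (negPf ij) mul0r.
Qed.

Lemma free_projective n : projective (pow (regular A) n).
Proof. exact: dual_basis_projective (free_dual_basis n). Qed.

Lemma retract_projective X P (i : 'Hom(X, P)) (r : 'Hom(P, X)) :
  is_hom i -> is_hom r -> (forall x, r (i x) = x) -> projective P -> projective X.
Proof.
move=> i_hom r_hom rK P_proj M N g f g_surj f_hom.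
have [h [h_hom hE]] := P_proj _ _ g _ g_surj (hom_comp f_hom r_hom).
exists (h \o i)%VF; split; first exact: hom_comp.
by apply/lfunP => x; rewrite comp_lfunA -hE !comp_lfunE rK.
Qed.

Lemma projective_isom P Q : isom P Q -> projective P -> projective Q.
Proof.
move=> /isomP[f [g [f_hom g_hom _ gK]]]; exact: retract_projective g_hom f_hom gK.
Qed.

Lemma projective_retract P : projective P ->
  exists n (s : 'Hom(P, pow (regular A) n)) (r : 'Hom(pow (regular A) n, P)),
  [/\ is_hom s, is_hom r & forall x, r (s x) = x].
Proof.
move=> P_proj; have [n [p p_surj]] := free_cover P.
have [s [s_hom sE]] := P_proj _ _ p \1%VF p_surj (@hom_id _ _ P).
exists n, s, p; split=> //; first by case: p_surj.
by move=> x; rewrite -comp_lfunE -sE id_lfunE.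
Qed.

End Projective.

(** * First extension groups by cocycles *)

Section Cocycles.
Variables (k : fieldType) (A : falgType k).
Implicit Types (M N K J X Y P Q T V : rmod A) (a b : A).

(** An extension of Y by T that is split over k is Y + T with (y, t) a equal to
    (y a, t a + d y a) for a cocycle d; its module splittings are the ways of
    writing d as a coboundary. *)
Definition cocycle Y T (d : Y -> A -> T) : Prop :=
  [/\ forall a, linear (d^~ a), forall y, linear (d y) &
      forall y a b, d y (a * b) = act (d y a) b + d (act y a) b].

Definition coboundary Y T (d : Y -> A -> T) : Prop :=
  exists r : 'Hom(Y, T), forall y a, d y a = r (act y a) - act (r y) a.

Definition ext_vanish Y T : Prop := forall d : Y -> A -> T, cocycle d -> coboundary d.

Lemma cocycle0l Y T (d : Y -> A -> T) a : cocycle d -> d 0 a = 0.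
Proof.
by case=> d_lin _ _; have := d_lin a (-1) 0 0; rewrite scaleN1r oppr0 addr0 scaleN1r addNr.
Qed.

Lemma cocycle_comp Y Y' T T' (g : 'Hom(Y', Y)) (h : 'Hom(T, T')) (d : Y -> A -> T) :
  is_hom g -> is_hom h -> cocycle d -> cocycle (fun y a => h (d (g y) a)).
Proof.
move=> g_hom h_hom [d_linl d_linr d_M]; split=> [a c x y|x c a b|x a b].
- by rewrite linearP d_linl linearP.
- by rewrite d_linr linearP.
by rewrite d_M linearD /= h_hom g_hom.
Qed.

Lemma cocycle_compl Y Y' T (g : 'Hom(Y', Y)) (d : Y -> A -> T) :
  is_hom g -> cocycle d -> cocycle (fun y a => d (g y) a).
Proof.
move=> g_hom [d_linl d_linr d_M]; split=> [a c x y|x c a b|x a b].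
- by rewrite linearP d_linl.
- by rewrite d_linr.
by rewrite d_M g_hom.
Qed.

Lemma ext1_vanish Y T : ext1_eq0 Y T -> ext_vanish Y T.
Proof.
move=> ext0 d d_coc; have d0 := cocycle0l _ d_coc; case: d_coc => d_linl d_linr d_M.
pose f (u : (T * Y)%type) a : (T * Y)%type := (act u.1 a + d u.2 a, act u.2 a).
have lin1 a : linear (f^~ a).
  move=> c u v; rewrite /f /= !act_linearl d_linl.
  by congr pair; rewrite /= scalerDr addrACA.
have lin2 u : linear (f u).
  move=> c a b; rewrite /f /= !act_linearr d_linr.
  by congr pair; rewrite /= scalerDr addrACA.
have d1 y : d y 1 = 0.
  by have := d_M y 1 1; rewrite mulr1 !act1 -[X in X = _]addr0 => /addrI <-.
have un u : f u 1 = u by case: u => t y; rewrite /f /= !act1 d1 addr0.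
have as_ u a b : f u (a * b) = f (f u a) b.
  by rewrite /f /= !actA d_M actDl addrA.
pose E := @Rmod k A (T * Y)%type f lin1 lin2 un as_.
have [i iE] : exists i : 'Hom(T, E), forall t, i t = (t, 0).
  by apply: lfun_exists => c x y; congr pair; rewrite /= scaler0 addr0.
have [p pE] : exists p : 'Hom(E, Y), forall u, p u = u.2 by apply: lfun_exists.
have [|e [e_hom _ ei ep]] := ext0 E i p.
  split; [split | split | ].
  - by move=> t a; rewrite !iE; congr pair; rewrite /= ?d0 ?addr0 ?act0l.
  - by apply/lker0_inj => x y; rewrite !iE => -[].
  - by move=> u a; rewrite !pE.
  - by apply: onto_limg => y; exists (0, y); rewrite pE.
  apply/vspaceP => -[t y]; rewrite memv_ker pE /=.
  apply/memv_imgP/eqP => [[x _]|->]; first by rewrite iE => -[].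
  by exists t; rewrite ?memvf ?iE.
have [r rE] : exists r : 'Hom(Y, T), forall y, r y = - (e (0, y)).1.
  apply: lfun_exists => c x y.
  have -> : (0, c *: x + y) = c *: (0, x) + (0, y) :> E.
    by congr pair; rewrite /= scaler0 addr0.
  by rewrite linearP /= opprD scalerN.
exists r => y a; rewrite !rE actNl opprK.
have := e_hom ((0, y) : E) a.
have -> : act ((0, y) : E) a = i (d y a) + ((0, act y a) : E).
  by rewrite iE; congr pair; rewrite /= ?act0l ?add0r ?addr0.
rewrite linearD /= ei => /(congr1 fst) /= <-.
by rewrite addrCA addNr addr0.
Qed.

Lemma retract_vanish X Y T (i : 'Hom(X, Y)) (r : 'Hom(Y, X)) :
  is_hom i -> is_hom r -> (forall x, r (i x) = x) -> ext_vanish Y T -> ext_vanish X T.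
Proof.
move=> i_hom r_hom rK Y0 d d_coc.
have [s sE] := Y0 _ (cocycle_compl r_hom d_coc).
by exists (s \o i)%VF => x a; rewrite !comp_lfunE i_hom -sE rK.
Qed.

Lemma retract_vanish_target Y X T (i : 'Hom(X, T)) (r : 'Hom(T, X)) :
  is_hom i -> is_hom r -> (forall x, r (i x) = x) -> ext_vanish Y T -> ext_vanish Y X.
Proof.
move=> i_hom r_hom rK Y0 d d_coc.
have [s sE] := Y0 _ (cocycle_comp (@hom_id _ _ Y) i_hom d_coc).
exists (r \o s)%VF => x a; have := congr1 r (sE x a).
by rewrite !comp_lfunE id_lfunE rK linearB /= r_hom.
Qed.

Lemma isom_vanish X Y T : isom X Y -> ext_vanish X T -> ext_vanish Y T.
Proof.
by move=> /isomP[f [g [f_hom g_hom _ gK]]]; apply: (retract_vanish g_hom f_hom gK).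
Qed.

Lemma dsum_vanish X Y T : ext_vanish X T -> ext_vanish Y T -> ext_vanish (dsum X Y) T.
Proof.
move=> X0 Y0 d d_coc.
have [i [i_hom iE]] := hom_inl X Y; have [j [j_hom jE]] := hom_inr X Y.
have [r rE] := X0 _ (cocycle_compl i_hom d_coc).
have [s sE] := Y0 _ (cocycle_compl j_hom d_coc).
have [t tE] : exists t : 'Hom(dsum X Y, T), forall u, t u = r u.1 + s u.2.
  by apply: lfun_exists => c u v; rewrite /= !linearP addrACA scalerDr.
exists t => u a; rewrite {1}(dsum_split u) -iE -jE -[i u.1]scale1r.
case: d_coc => d_lin _ _; rewrite d_lin scale1r rE sE !tE /=.
by rewrite actDl opprD addrACA.
Qed.

Lemma zero_vanish X T : is_zero X -> ext_vanish X T.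
Proof.
move=> X0 d d_coc; exists 0 => x a.
by rewrite (X0 x) (cocycle0l _ d_coc) !zero_lfunE act0l subr0.
Qed.

Lemma dsums_vanish n (S : 'I_n -> rmod A) T :
  (forall i, ext_vanish (S i) T) -> ext_vanish (dsums S) T.
Proof.
move=> S0; apply: (dsums_ind (C := fun X => ext_vanish X T)) => // [|M N].
  exact: zero_vanish (@zero_mod_zero _ _).
exact: dsum_vanish.
Qed.

Lemma pow_vanish Q n T : ext_vanish Q T -> ext_vanish (pow Q n) T.
Proof.
by move=> Q0; apply: isom_vanish (isom_sym (pow_dsums Q n)) _; apply: dsums_vanish.
Qed.

Lemma pow_vanish_target Y T n : ext_vanish Y T -> ext_vanish Y (pow T n).
Proof.
move=> Y0 d d_coc; have [pr prP] := choice_fun (@pow_proj _ _ T n).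
have ex_r i : exists r : 'Hom(Y, T), forall y a,
    (d y a : {ffun 'I_n -> T}) i = r (act y a) - act (r y) a.
  have [r rE] := Y0 _ (cocycle_comp (@hom_id _ _ Y) (prP i).1 d_coc).
  by exists r => y a; rewrite -rE id_lfunE (prP i).2.
have [r rE] := choice_fun ex_r.
have [s sE] : exists s : 'Hom(Y, pow T n), forall y, s y = [ffun i => r i y].
  by apply: lfun_exists => c x y; apply/ffunP => i; rewrite !ffunE linearP.
by exists s => y a; apply/ffunP => i; rewrite rE !sE !ffunE.
Qed.

(** With a dual basis x, xi of P, the sum of the d (x i) (xi i y) trivialises
    the cocycle d. *)
Lemma projective_vanish P T : projective P -> ext_vanish P T.
Proof.
move=> /projective_dual_basis[n [x [xi [xi_hom xE]]]] d [d_linl d_linr d_M].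
have [r rE] : exists r : 'Hom(P, T), forall y, r y = \sum_i d (x i) (xi i y).
  apply: lfun_exists => c y z; rewrite scaler_sumr -big_split.
  by apply: eq_bigr => i _; rewrite linearP d_linr.
exists r => y a; rewrite !rE act_suml -sumrB.
have [da daE] : exists da : 'Hom(P, T), forall z, da z = d z a by apply: lfun_exists.
rewrite {1}(xE y) -daE linear_sum; apply: eq_bigr => i _.
by rewrite /= daE xi_hom /= d_M addrAC subrr add0r.
Qed.

Section ShortExact.
Variables (K V J T : rmod A) (j : 'Hom(K, V)) (p : 'Hom(V, J)).
Hypothesis jp_exact : short_exact j p.

(** Pushing the extension V of J by K forward along g gives an extension of J by T,
    and a splitting of the latter extends g to V. *)
Lemma vanish_extend (g : 'Hom(K, T)) : ext_vanish J T -> is_hom g ->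
  exists h : 'Hom(V, T), is_hom h /\ forall x, h (j x) = g x.
Proof.
case: jp_exact => -[j_hom /lker0_inj j_inj] [p_hom p_onto] jp J0 g_hom.
have jK y : y \in lker p -> j ((j^-1)%VF y) = y by rewrite -jp => /limg_lfunVK.
have j'K x : (j^-1)%VF (j x) = x by apply: j_inj; rewrite jK // -jp memv_img ?memvf.
have pK x : p ((p^-1)%VF x) = x by rewrite limg_lfunVK // p_onto memvf.
pose s := (p^-1)%VF; pose g' := (g \o j^-1)%VF.
have g'_hom y a : y \in lker p -> g' (act y a) = act (g' y) a.
  move=> /[dup] yp /jK yE.
  by rewrite !comp_lfunE -{1}yE -j_hom j'K g_hom.
have s_ker x a : s (act x a) - act (s x) a \in lker p.
  by rewrite memv_ker linearB /= p_hom !pK subrr.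
have [|r rE] := J0 (fun x a => g' (s (act x a) - act (s x) a)).
  split=> [a c x y|x c a b|x a b].
  - rewrite -linearP; congr (g' _).
    by rewrite act_linearl !linearP /= act_linearl scalerBr opprD addrACA.
  - rewrite -linearP; congr (g' _).
    by rewrite !act_linearr linearP /= scalerBr opprD addrACA.
  rewrite -(g'_hom _ _ (s_ker x a)) -linearD; congr (g' _).
  by rewrite actBl !actA [RHS]addrC addrA subrK.
exists ((g' \o (\1 - (s \o p))) + (r \o p))%VF; split=> [v a|x]; last first.
  rewrite add_lfunE !comp_lfunE sub_lfunE comp_lfunE (exact_comp jp) !linear0 !addr0.
  by rewrite id_lfunE j'K.
have hE u : ((g' \o (\1 - (s \o p))) + (r \o p))%VF u = g' (u - s (p u)) + r (p u).
  by rewrite add_lfunE !comp_lfunE sub_lfunE comp_lfunE id_lfunE.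
have v_ker : v - s (p v) \in lker p by rewrite memv_ker linearB /= pK subrr.
rewrite !hE actDl -g'_hom // p_hom -[r (act _ _)](subrK (act (r (p v)) a)) -rE addrA.
by rewrite -linearD actBl addrA subrK.
Qed.

(** In Hom (V, T) -> Hom (K, T) -> Ext^1 (J, T) -> Ext^1 (V, T) the first map is onto
    and the last term is zero. *)
Lemma vanish_quotient : ext_vanish V T ->
    (forall g : 'Hom(K, T), is_hom g ->
       exists h : 'Hom(V, T), is_hom h /\ forall x, h (j x) = g x) ->
  ext_vanish J T.
Proof.
case: jp_exact => -[j_hom _] [p_hom p_onto] jp V0 ext d d_coc.
have [r rE] := V0 _ (cocycle_compl p_hom d_coc).
have [|h [h_hom hE]] := ext (r \o j)%VF.
  move=> x a; apply/eqP; rewrite -subr_eq0 !comp_lfunE j_hom -rE (exact_comp jp).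
  by rewrite (cocycle0l _ d_coc).
have ker_pr v : p v = 0 -> (r - h) v = 0.
  by move=> /(exact_lift jp)[x ->]; rewrite sub_lfunE hE comp_lfunE subrr.
exists ((r - h) \o p^-1)%VF => x a; have [v ->] := limg_full x p_onto.
rewrite -p_hom !comp_lfunE !(comp_inv_lfun ker_pr) rE !add_lfunE !opp_lfunE h_hom.
by rewrite actBl opprB addrA subrK.
Qed.

End ShortExact.

(** M' is the pullback of a free cover of V along M -> V, hence a submodule of the
    cover; the two have the same kernel K over M and over V. *)
Lemma free_pullback M V (i : 'Hom(M, V)) : injhom i ->
  exists n (p : 'Hom(pow (regular A) n, V)) (K M' : rmod A) (j : 'Hom(M', pow (regular A) n))
         (q : 'Hom(M', M)) (kappa : 'Hom(K, pow (regular A) n)) (kappa' : 'Hom(K, M')),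
  [/\ injhom j, short_exact kappa p, short_exact kappa' q,
      (forall x, i (q x) = p (j x)) /\ (forall x, j (kappa' x) = kappa x) &
      forall z x, p z = i x -> exists y, z = j y].
Proof.
move=> [i_hom /lker0_inj i_inj]; have [n [p p_surj]] := free_cover V.
have [p_hom p_onto] := p_surj.
have pre_sub : submod (p @^-1: limg i)%VS.
  by move=> x a; rewrite -!memv_preim p_hom; apply: limg_submod.
have [M' [j [j_injh img_j]]] := submodule_ex pre_sub.
have [j_hom /lker0_inj j_inj] := j_injh.
have [K [kappa [kappa_injh img_kappa]]] := submodule_ex (lker_submod p_hom).
have liftj z x : p z = i x -> exists y, z = j y.
  move=> pz; have: z \in limg j by rewrite img_j -memv_preim pz memv_img ?memvf.
  by case/memv_imgP=> y _ ->; exists y.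
have [|||q [q_hom qE]] := @hom_corestrict _ _ M' M V i (p \o j)%VF.
- by split=> //; apply/lker0_inj.
- exact: hom_comp.
- move=> x; have: j x \in limg j by rewrite memv_img ?memvf.
  by rewrite img_j -memv_preim comp_lfunE => /memv_imgP[y _ ->]; exists y.
have [|kappa' [kappa'_hom kappa'E]] := hom_corestrict j_injh kappa_injh.1.
  by move=> x; apply: (liftj _ 0); rewrite linear0 (exact_comp img_kappa).
have iq x : i (q x) = p (j x) by rewrite qE comp_lfunE.
exists n, p, K, M', j, q, kappa, kappa'; split=> //.
have kappa_inj : injective kappa by apply/lker0_inj; case: kappa_injh.
split; [split=> // | split=> // | ].
- by apply/lker0_inj => x y e; apply: kappa_inj; rewrite -!kappa'E e.
- apply: onto_limg => x; have [v vE] := limg_full (i x) p_onto.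
  have [y yE] := liftj v x (esym vE); exists y; apply: i_inj.
  by rewrite iq -yE.
apply/vspaceP => y; rewrite memv_ker; apply/memv_imgP/eqP => [[x _ ->]|y0].
  by apply: i_inj; rewrite iq kappa'E linear0 (exact_comp img_kappa).
have [|x xE] := exact_lift img_kappa (y := j y); first by rewrite -iq y0 linear0.
by exists x; rewrite ?memvf //; apply: j_inj; rewrite kappa'E.
Qed.

(** Over a hereditary algebra Ext^1 is right exact, since the pullback of a free
    cover of V to M is again projective. *)
Lemma hereditary_vanish M V T (i : 'Hom(M, V)) :
  hereditary A -> injhom i -> ext_vanish V T -> ext_vanish M T.
Proof.
move=> hA i_injh V0.
have [n [p [K [M' [j [q [kappa [kappa' [j_injh kp kq [_ jk] _]]]]]]]]] := free_pullback i_injh.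
apply: (vanish_quotient kq).
  exact: projective_vanish (hA _ _ j (@free_projective _ _ n) j_injh).
move=> g g_hom; have [h [h_hom hE]] := vanish_extend kp V0 g_hom.
exists (h \o j)%VF; split; first exact: hom_comp h_hom j_injh.1.
by move=> x; rewrite comp_lfunE jk hE.
Qed.

End Cocycles.
(** * Modules cogenerated by a tilting module *)

Section Cogenerated.
Variables (k : fieldType) (A : falgType k).
Implicit Types (M N K J X Y P Q T V C : rmod A) (a b : A).

Lemma image_ex M N (f : 'Hom(M, N)) : is_hom f ->
  exists (J : rmod A) (p : 'Hom(M, J)) (i : 'Hom(J, N)),
    [/\ surjhom p, injhom i & forall x, i (p x) = f x].
Proof.
move=> f_hom; have [J [i [i_injh img_i]]] := submodule_ex (limg_submod f_hom).
have [x|p [p_hom pE]] := hom_corestrict i_injh f_hom.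
  by apply/limgP; rewrite img_i; apply/limgP; exists x.
exists J, p, i; split=> //; split=> //; apply: onto_limg => y.
have /limgP[x xE] : i y \in limg f by rewrite -img_i; apply/limgP; exists y.
by exists x; case: i_injh => _ /lker0_inj; apply; rewrite pE.
Qed.

Definition cogenerated Y Q : Prop :=
  forall y : Y, y <> 0 -> exists g : 'Hom(Y, Q), is_hom g /\ g y <> 0.

Lemma cogenerated_eq Y Q (y y' : Y) : cogenerated Y Q ->
  (forall g : homs Y Q, val g y = val g y') -> y = y'.
Proof.
move=> cog e; apply/eqP; rewrite -subr_eq0; apply/eqP; apply: NNPP => /cog[g [g_hom]].
by have [g' <-] := mem_homv g_hom; rewrite linearB /= e subrr.
Qed.

(** With a k-basis of Hom (Y, Q) for its components, this is an approximation of Y by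
    powers of Q: all maps from Y to Q factor through it. *)
Lemma universal_map Y Q : exists e : 'Hom(Y, pow Q (\dim (homv Y Q))),
  is_hom e /\ forall y j, (e y : {ffun _ -> Q}) j = (vbasis (homv Y Q))`_j y.
Proof.
apply: pow_map => j; apply/homvP/vbasis_mem.
by rewrite mem_nth // size_tuple.
Qed.

Lemma hom_basisE Y Q (g : 'Hom(Y, Q)) y : is_hom g ->
  g y = \sum_(j < \dim (homv Y Q)) coord (vbasis (homv Y Q)) j g *: (vbasis (homv Y Q))`_j y.
Proof.
move/homvP => gH; rewrite {1}(coord_vbasis gH) sum_lfunE.
by apply: eq_bigr => j _; rewrite scale_lfunE.
Qed.

Lemma hom_scale M (c : k) : is_hom (c *: \1%VF : 'End(M)).
Proof. by move=> x a; rewrite !scale_lfunE !id_lfunE actZl. Qed.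

Lemma universal_map_extend Y Q (e : 'Hom(Y, pow Q (\dim (homv Y Q)))) :
    (forall y j, (e y : {ffun _ -> Q}) j = (vbasis (homv Y Q))`_j y) ->
    forall g : 'Hom(Y, Q), is_hom g ->
  exists h : 'Hom(pow Q (\dim (homv Y Q)), Q), is_hom h /\ forall y, h (e y) = g y.
Proof.
move=> eE g g_hom.
have [h [h_hom hE]] := pow_comap (fun j : 'I_(\dim (homv Y Q)) =>
  @hom_scale Q (coord (vbasis (homv Y Q)) j g)).
exists h; split=> // y; rewrite hE (hom_basisE _ g_hom); apply: eq_bigr => j _.
by rewrite scale_lfunE id_lfunE eE.
Qed.

Lemma universal_map_inj Y Q (e : 'Hom(Y, pow Q (\dim (homv Y Q)))) :
    (forall y j, (e y : {ffun _ -> Q}) j = (vbasis (homv Y Q))`_j y) ->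
  cogenerated Y Q -> lker e = 0%VS.
Proof.
move=> eE cog; apply: lker_eq0 => y ey; apply: NNPP => /cog[g [g_hom]]; case.
rewrite (hom_basisE _ g_hom) big1 // => j _.
by rewrite -eE ey ffunE scaler0.
Qed.

(** Let R be the kernel of the universal map of Y to a power of T. As Y / R embeds in
    this power, Ext^1 (Y / R, T) = 0. So every map R -> T extends to Y, and then it is
    zero by the choice of R. Also Ext^1 (R, T) = 0. The coresolution of A by T now gives
    Hom (R, A) = 0 and Ext^1 (R, A) = 0; the latter makes R a summand of a free module,
    and the former then makes it zero. *)
Lemma tilting_cogenerates Y T :
  hereditary A -> tilting T -> ext_vanish Y T -> cogenerated Y T.
Proof.
move=> hA [_ /ext1_vanish TT [T0 [T1 [i [p [addT0 addT1 ip_exact]]]]]] YT.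
have [e [e_hom eE]] := universal_map Y T.
have [R [j [[j_hom j_inj] img_j]]] := submodule_ex (lker_submod e_hom).
have [J [q [u [q_surj [u_hom u_inj] uq]]]] := image_ex e_hom.
have ker_q : lker q = lker e.
  apply/vspaceP => y; rewrite !memv_ker -uq -[in LHS](inj_eq (f := u)) ?linear0 //.
  exact/lker0_inj.
have jq : short_exact j q by split=> //; rewrite img_j ker_q.
have JT : ext_vanish J T by apply: (hereditary_vanish hA (conj u_hom u_inj)); apply: pow_vanish.
have RT : ext_vanish R T := hereditary_vanish hA (conj j_hom j_inj) YT.
have homRT (g : 'Hom(R, T)) : is_hom g -> forall x, g x = 0.
  move=> g_hom x; have [h [h_hom <-]] := vanish_extend jq JT g_hom.
  have [h' [_ <-]] := universal_map_extend eE h_hom.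
  by rewrite (exact_comp img_j) linear0.
have homR_add N (g : 'Hom(R, N)) : in_add T N -> is_hom g -> forall x, g x = 0.
  move=> /in_addP[n [s [r [s_hom r_hom rK]]]] g_hom x.
  rewrite -(rK (g x)); suff -> : s (g x) = 0 by rewrite linear0.
  apply/ffunP => l; have [pr [pr_hom prE]] := pow_proj T l.
  rewrite -prE -!comp_lfunE homRT ?ffunE //.
  by do 2!apply: hom_comp => //.
have RT0 : ext_vanish R T0.
  have [n [s [r [s_hom r_hom rK]]]] := in_addP addT0.
  exact: retract_vanish_target s_hom r_hom rK (pow_vanish_target RT).
have [[i_hom i_ker] [p_hom _] ip] := ip_exact.
have i_inj : injective i by apply/lker0_inj.
have homRA (g : 'Hom(R, regular A)) : is_hom g -> forall x, g x = 0.
  move=> g_hom x; apply: i_inj; rewrite linear0 -comp_lfunE.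
  by apply: homR_add => //; apply: hom_comp.
have RA : ext_vanish R (regular A).
  move=> d d_coc; have [r rE] := RT0 _ (cocycle_comp (@hom_id _ _ R) i_hom d_coc).
  have pr_hom : is_hom (p \o r)%VF.
    move=> x a; apply/eqP; rewrite -subr_eq0 !comp_lfunE -p_hom -linearB /= -rE.
    by rewrite (exact_comp ip).
  have ir x : i ((i^-1)%VF (r x)) = r x.
    by rewrite limg_lfunVK // ip memv_ker -comp_lfunE (homR_add _ _ _ pr_hom).
  exists (i^-1 \o r)%VF => x a; apply: i_inj.
  by rewrite linearB /= i_hom !comp_lfunE !ir -rE id_lfunE.
have [n [v v_surj]] := free_cover R; have [v_hom v_onto] := v_surj.
have [K [w [w_injh img_w]]] := submodule_ex (lker_submod v_hom).
have K_proj : projective K := hA _ _ w (@free_projective _ _ n) w_injh.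
have RK : ext_vanish R K.
  have [m [s [r [s_hom r_hom rK]]]] := projective_retract K_proj.
  exact: retract_vanish_target s_hom r_hom rK (pow_vanish_target RA).
have wv : short_exact w v by [].
have [h [h_hom hw]] := vanish_extend wv RK (@hom_id _ _ K).
pose f := (\1 - (w \o h))%VF : 'End(pow (regular A) n).
have f_hom : is_hom f by apply: hom_sub (@hom_id _ _ _) (hom_comp w_injh.1 h_hom).
have fE z : f z = z - w (h z) by rewrite sub_lfunE comp_lfunE id_lfunE.
have [_ /(exact_lift img_w)[x ->]|s [s_hom sE]] := hom_factor v_surj f_hom.
  by rewrite fE hw id_lfunE subrr.
have s0 x : s x = 0.
  apply/ffunP => l; have [pr [pr_hom prE]] := pow_proj (regular A) l.
  by rewrite -prE -comp_lfunE homRA ?ffunE //; apply: hom_comp.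
have R0 (x : R) : x = 0.
  have [z ->] := limg_full x v_onto; have := s0 (v z); rewrite sE fE => /eqP.
  by rewrite subr_eq0 => /eqP ->; rewrite (exact_comp img_w).
move=> y y0; apply: NNPP => no_g; apply: y0.
have /(exact_lift img_j)[x ->] : e y = 0; last by rewrite (R0 x) linear0.
apply/ffunP => l; rewrite ffunE eE.
apply: NNPP => gy; apply: no_g; exists (vbasis (homv Y T))`_l; split=> //.
by apply/homvP/vbasis_mem; rewrite mem_nth // size_tuple.
Qed.

(** * Reflexive modules *)

(** This is surjectivity of the evaluation Y -> Hom_E (Hom (Y, Q), Q), where
    E = End (Q). *)
Definition reflexive_wrt Q Y : Prop :=
  forall phi : 'Hom(homs Y Q, Q),
    (forall (c : 'End(Q)) (b b' : homs Y Q), is_hom c ->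
       (forall y, val b' y = c (val b y)) -> phi b' = c (phi b)) ->
  exists y, forall b : homs Y Q, phi b = val b y.

(** The values of phi on a basis of Hom (Y, Q) form a point of a power of Q that
    satisfies all the linear relations over End (Q) between the basis elements,
    hence lies in the image of Y when Q cogenerates the cokernel of the universal
    map. *)
Lemma cogenerated_reflexive Q Y : cogenerated Y Q ->
    (forall n (e : 'Hom(Y, pow Q n)) C (p : 'Hom(pow Q n, C)), short_exact e p ->
       (forall g : 'Hom(Y, Q), is_hom g ->
          exists h : 'Hom(pow Q n, Q), is_hom h /\ forall y, h (e y) = g y) ->
       cogenerated C Q) ->
  reflexive_wrt Q Y.
Proof.
move=> cogY cogC phi phi_lin.
have [e [e_hom eE]] := universal_map Y Q.
have [C [p [p_surj ker_p]]] := quotient_ex (limg_submod e_hom).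
have ep : short_exact e p by split=> //; split=> //; apply: universal_map_inj cogY.
have {}cogC := cogC _ _ _ _ ep (universal_map_extend eE).
have [b bE] : exists b : 'I_(\dim (homv Y Q)) -> homs Y Q,
    forall j, val (b j) = (vbasis (homv Y Q))`_j.
  apply: (@choice_fun _ _ (fun j c => val c = _)) => j; apply: mem_homv.
  by apply/homvP/vbasis_mem; rewrite mem_nth // size_tuple.
pose v : pow Q (\dim (homv Y Q)) := [ffun j => phi (b j)].
have /(exact_lift (esym ker_p))[y vE] : p v = 0.
  apply: NNPP => /cogC[g [g_hom]]; case.
  have [q [q_hom qE]] := hom_pow_sum (hom_comp g_hom p_surj.1).
  have ex_qb j : exists d : homs Y Q, val d = (q j \o val (b j))%VF.
    by apply: mem_homv; apply: hom_comp (q_hom j) (subvs_hom _).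
  have [d dE] := choice_fun ex_qb.
  have d_sum : \sum_j d j = 0.
    apply: homs_eq => y; rewrite zero_lfunE linear_sum /= sum_lfunE.
    transitivity ((g \o p)%VF (e y)); last first.
      by rewrite comp_lfunE (exact_comp (esym ker_p)) linear0.
    by rewrite qE; apply: eq_bigr => j _; rewrite dE comp_lfunE bE eE.
  rewrite -comp_lfunE qE -[RHS](linear0 phi) -d_sum linear_sum.
  apply: eq_bigr => j _; rewrite ffunE /=; symmetry; apply: phi_lin => // y.
  by rewrite dE comp_lfunE.
exists y => c.
have cE : c = \sum_j coord (vbasis (homv Y Q)) j (val c) *: b j.
  apply: val_inj; rewrite {1}[val c](coord_vbasis (subvsP c)) linear_sum.
  by apply: eq_bigr => j _ /=; congr (_ *: _); symmetry; apply: bE.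
rewrite {1}cE linear_sum (hom_basisE y (subvs_hom c)); apply: eq_bigr => j _.
by rewrite /= linearZ /= -eE -vE ffunE.
Qed.

Lemma tilting_reflexive Y T :
  hereditary A -> tilting T -> ext_vanish Y T -> reflexive_wrt T Y.
Proof.
move=> hA hT YT; apply: cogenerated_reflexive; first exact: tilting_cogenerates.
move=> n e C p ep ext; apply: tilting_cogenerates => //.
apply: vanish_quotient ep _ ext; apply: pow_vanish.
by case: hT => _ /ext1_vanish.
Qed.

Lemma cogenerator_reflexive Q Y :
  (forall M, cogenerated M Q) -> reflexive_wrt Q Y.
Proof. by move=> cog; apply: cogenerated_reflexive. Qed.

End Cogenerated.
(** * Left modules over an endomorphism algebra *)

(** A subspace of largest dimension among those on which P holds contains every point
    where P holds. *)
Lemma vspace_ex (k : fieldType) (V : vectType k) (P : V -> Prop) :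
    P 0 -> (forall c x y, P x -> P y -> P (c *: x + y)) ->
  exists U : {vspace V}, forall x, x \in U <-> P x.
Proof.
move=> P0 P_lin; pose inP (U : {vspace V}) := forall x, x \in U -> P x.
suff ext n (U : {vspace V}) : inP U -> (\dim {:V} - \dim U <= n)%N ->
    exists W : {vspace V}, forall x, x \in W <-> P x.
  apply: (ext _ 0%VS) (leqnn _) => x.
  by rewrite memv0 => /eqP ->.
elim: n U => [|n IH] U UP leUn.
  exists U => x; split=> [/UP //|_].
  suff -> : U = fullv by rewrite memvf.
  by apply/eqP; rewrite eqEdim subvf -subn_eq0 -leqn0.
case: (classic (exists x, P x /\ x \notin U)) => [[x [Px xU]]|noX]; last first.
  exists U => x; split=> [/UP //|Px].
  by apply: contraT => xU; case: noX; exists x.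
apply: (IH (<[x]> + U)%VS) => [_ /memv_addP[_ /vlineP[c ->] [v /UP Pv ->]]|].
  exact: P_lin.
have lt : (\dim U < \dim (<[x]> + U))%N.
  rewrite ltnNge; apply: contra xU => le.
  have /eqP -> : U == (<[x]> + U)%VS by rewrite eqEdim addvSr.
  exact: (subvP (addvSl _ _)) (memv_line x).
by rewrite leq_subLR (leq_trans _ (leq_add lt (leqnn n))) // addSnnS -leq_subLR.
Qed.

Section LeftModule.
Variables (k : fieldType) (A : falgType k).

(** W is a left module over E = End (Q), through op, and the pairing ev identifies Y
    with Hom_E (W, Q). *)
Record left_pairing (Q Y : rmod A) (W : vectType k)
    (op : 'Hom(homs Q Q, 'End(W))) (ev : 'Hom(Y, 'Hom(W, Q))) : Prop :=
  LeftPairing {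
    op_one : forall e w, val e = \1%VF -> op e w = w;
    op_mul : forall e e' e'' w, val e'' = (val e \o val e')%VF ->
      op e'' w = op e (op e' w);
    ev_op : forall y e w, ev y (op e w) = val e (ev y w);
    ev_act : forall y a w, ev (act y a) w = act (ev y w) a;
    ev_inj : forall y, (forall w, ev y w = 0) -> y = 0;
    ev_surj : forall h : 'Hom(W, Q), (forall e w, h (op e w) = val e (h w)) ->
      exists y, forall w, ev y w = h w
  }.

(** A free presentation E^b -> E^a -> W -> 0, written through E^n = Hom (Q^n, Q);
    mu is the map onto W and phi induces the map E^b -> E^a, so that Y is the
    kernel of phi. *)
Record left_presentation (Q Y : rmod A) (W : vectType k)
    (op : 'Hom(homs Q Q, 'End(W))) (ev : 'Hom(Y, 'Hom(W, Q)))
    a b (phi : 'Hom(pow Q a, pow Q b)) (eps : 'Hom(Y, pow Q a))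
    (mu : 'Hom(homs (pow Q a) Q, W)) : Prop :=
  LeftPresentation {
    phi_hom : is_hom phi;
    eps_inj : injhom eps;
    eps_phi : limg eps = lker phi;
    mu_onto : forall w, exists g, w = mu g;
    mu_ev : forall y g, ev y (mu g) = val g (eps y);
    mu_op : forall (e : homs Q Q) (g g' : homs (pow Q a) Q),
      (forall x, val g' x = val e (val g x)) -> mu g' = op e (mu g);
    mu_eq0 : forall g, mu g = 0 <->
      exists u : 'Hom(pow Q b, Q), is_hom u /\ forall x, val g x = u (phi x)
  }.

(** Generators over k are generators over E: a is the dimension of W, and b that of the
    kernel of E^a -> W. *)
Lemma left_presentation_ex (Q Y : rmod A) W op ev : @left_pairing Q Y W op ev ->
  exists a b phi eps mu, @left_presentation Q Y W op ev a b phi eps mu.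
Proof.
case=> op1 opM evE evA evI evS.
pose a := \dim {:W}; pose w := vbasis {:W}.
have [io ioP] := choice_fun (@pow_inj _ _ Q a).
have [pr prP] := choice_fun (@pow_proj _ _ Q a).
pose G := homs (pow Q a) Q.
have [comp compE] : exists comp : 'I_a -> 'Hom(G, homs Q Q),
    forall j g x, val (comp j g) x = val g (io j x).
  apply: (@choice_fun _ _ (fun j (c : 'Hom(G, homs Q Q)) =>
                             forall g x, val (c g) x = val g (io j x))) => j.
  by have [c cE] := homv_precomp Q (ioP j).1; exists c.
have [mu muE] : exists mu : 'Hom(G, W), forall g, mu g = \sum_j op (comp j g) w`_j.
  apply: lfun_exists => l g g'; rewrite scaler_sumr -big_split.
  by apply: eq_bigr => j _; rewrite !linearP /= lfunDZ.
have [x xE] := choice_fun (fun j => mem_homv (prP j).1).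
have mux j : mu (x j) = w`_j.
  rewrite muE (bigD1 j) //= big1 => [|i ij].
    rewrite addr0 op1 //; apply/lfunP => q.
    by rewrite compE xE (prP j).2 (ioP j).2 eqxx id_lfunE.
  have -> : comp i (x j) = 0.
    apply: homs_eq => q.
    by rewrite compE xE (prP j).2 (ioP i).2 eq_sym (negPf ij) zero_lfunE.
  by rewrite linear0 zero_lfunE.
have mu_w m : exists g, m = mu g.
  exists (\sum_j coord w j m *: x j); rewrite [LHS](coord_vbasis (memvf m)) linear_sum.
  by apply: eq_bigr => j _; rewrite linearZ /= mux.
have mu_op' (e : homs Q Q) (g g' : G) :
    (forall z, val g' z = val e (val g z)) -> mu g' = op e (mu g).
  move=> g'E; rewrite !muE linear_sum; apply: eq_bigr => j _ /=.
  by apply: opM; apply/lfunP => q; rewrite comp_lfunE !compE g'E.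
have [eps [eps_h epsE]] : exists f : 'Hom(Y, pow Q a), is_hom f /\
    forall y j, (f y : {ffun _ -> Q}) j = ev y w`_j.
  have ex j : exists f : 'Hom(Y, Q), is_hom f /\ forall y, f y = ev y w`_j.
    apply: (@hom_exists _ _ Y Q (fun y => ev y w`_j)) => [c y y'|y b]; last exact: evA.
    by rewrite linearP /= lfunDZ.
  have [f fP] := choice_fun ex.
  have [h [h_hom hE]] := pow_map (fun j : 'I_a => (fP j).1).
  by exists h; split=> // y j; rewrite hE (fP j).2.
have mu_ev' y g : ev y (mu g) = val g (eps y).
  have [gj [_ gjE]] := hom_pow_sum (subvs_hom g).
  have -> : val g (eps y) = \sum_j val (comp j g) (ev y w`_j).
    have {1}-> : eps y = \sum_j io j (ev y w`_j).
      apply/ffunP => i; rewrite sum_ffunE (bigD1 i) //= (ioP i).2 eqxx epsE big1 ?addr0 //.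
      by move=> l li; rewrite (ioP l).2 eq_sym (negPf li).
    by rewrite linear_sum; apply: eq_bigr => j _; rewrite compE.
  by rewrite muE linear_sum; apply: eq_bigr => j _; rewrite /= evE.
pose b := \dim (lker mu); pose l := vbasis (lker mu).
have [phi [phi_h phiE]] : exists f : 'Hom(pow Q a, pow Q b), is_hom f /\
    forall z j, (f z : {ffun _ -> Q}) j = val l`_j z.
  by apply: pow_map => j; apply: subvs_hom.
have mul j : (j < b)%N -> mu l`_j = 0.
  by move=> jb; apply/eqP; rewrite -memv_ker vbasis_mem // mem_nth // size_tuple.
exists a, b, phi, eps, mu; split=> //.
- split=> //; apply: lker_eq0 => y y0; apply: evI => m.
  by have [g ->] := mu_w m; rewrite mu_ev' y0 linear0.
- apply/vspaceP => z; rewrite memv_ker; apply/memv_imgP/eqP => [[y _ ->]|phiz].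
    by apply/ffunP => j; rewrite phiE -mu_ev' mul // linear0 ffunE.
  have [hz hzE] : exists hz : 'Hom(G, Q), forall g, hz g = val g z.
    by apply: lfun_exists => c g g'; rewrite linearP /= lfunDZ.
  have ker_hz g : mu g = 0 -> hz g = 0.
    move=> /eqP; rewrite -memv_ker => gker; rewrite hzE (coord_vbasis gker) linear_sum sum_lfunE.
    rewrite big1 // => j _; rewrite linearZ /= scale_lfunE.
    have := congr1 (fun u : {ffun 'I_b -> Q} => u j) phiz.
    by rewrite phiE ffunE => ->; rewrite scaler0.
  have hmu g : (hz \o mu^-1)%VF (mu g) = val g z by rewrite comp_lfunE comp_inv_lfun.
  have [|y yE] := evS (hz \o mu^-1)%VF.
    move=> e m; have [g ->] := mu_w m.
    have [g' g'E] := mem_homv (hom_comp (subvs_hom e) (subvs_hom g)).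
    rewrite -(mu_op' e g g') => [|q]; last by rewrite g'E comp_lfunE.
    by rewrite !hmu g'E comp_lfunE.
  exists y; rewrite ?memvf //; apply/ffunP => j.
  by rewrite epsE yE -mux hmu xE (prP j).2.
move=> g; split=> [g0|[u [u_hom gE]]].
  have gker : g \in lker mu by rewrite memv_ker g0.
  have [u [u_hom uE]] := pow_comap (fun j : 'I_b => @hom_scale _ _ Q (coord l j g)).
  exists u; split=> // z; rewrite uE {1}(coord_vbasis gker) linear_sum sum_lfunE.
  by apply: eq_bigr => j _; rewrite phiE linearZ /= !scale_lfunE id_lfunE.
have [uj [uj_hom ujE]] := hom_pow_sum u_hom.
have [e eE] := choice_fun (fun j => mem_homv (uj_hom j)).
have [c cE] := choice_fun (fun j : 'I_b => mem_homv (hom_comp (uj_hom j) (subvs_hom l`_j))).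
have -> : g = \sum_j c j.
  apply: homs_eq => z; rewrite gE ujE linear_sum sum_lfunE.
  by apply: eq_bigr => j _; have /= -> := cE j; rewrite comp_lfunE phiE.
rewrite linear_sum big1 // => j _ /=.
rewrite (mu_op' (e j) l`_j) => [|z]; first by rewrite mul // linear0.
by rewrite cE eE comp_lfunE.
Qed.

End LeftModule.
Section Presentation.
Variables (k : fieldType) (A : falgType k).
Variables (Q Y : rmod A) (W : vectType k).
Variables (op : 'Hom(homs Q Q, 'End(W))) (ev : 'Hom(Y, 'Hom(W, Q))).
Variables (a b : nat) (phi : 'Hom(pow Q a, pow Q b)) (eps : 'Hom(Y, pow Q a)).
Variable mu : 'Hom(homs (pow Q a) Q, W).
Hypothesis pres : left_presentation op ev phi eps mu.
Hypothesis hA : hereditary A.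
Hypothesis QQ : ext_vanish Q Q.

Lemma presented_vanish : ext_vanish Y Q.
Proof. exact: hereditary_vanish hA (eps_inj pres) (pow_vanish QQ). Qed.

(** Since the image of phi is a submodule of a power of Q, it is left orthogonal to Q,
    and every map from Y = ker phi to Q extends to Q^a. *)
Lemma presented_hom_ev (g : 'Hom(Y, Q)) : is_hom g -> exists w, forall y, g y = ev y w.
Proof.
move=> g_hom; have [J [p [i [p_surj i_inj pi]]]] := image_ex (phi_hom pres).
have ker_p : lker p = lker phi.
  apply/vspaceP => z; rewrite !memv_ker -pi -[in LHS](inj_eq (f := i)) ?linear0 //.
  by apply/lker0_inj; case: i_inj.
have ex : short_exact eps p by split=> //; [apply: eps_inj pres | rewrite ker_p (eps_phi pres)].
have JQ : ext_vanish J Q := hereditary_vanish hA i_inj (pow_vanish QQ).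
have [h [h_hom hE]] := vanish_extend ex JQ g_hom.
have [h' h'E] := mem_homv h_hom.
by exists (mu h') => y; rewrite (mu_ev pres) h'E hE.
Qed.

Lemma presented_faithful w : injective_mod Q -> (forall y, ev y w = 0) -> w = 0.
Proof.
move=> Q_inj; have [g -> {w}] := mu_onto pres w => g0.
have [J [p [i [p_surj i_inj pi]]]] := image_ex (phi_hom pres).
have [z pz|u [u_hom uE]] := hom_factor p_surj (subvs_hom g).
  have [|y ->] := exact_lift (eps_phi pres) (y := z); first by rewrite -pi pz linear0.
  by rewrite -(mu_ev pres) g0.
have [h [h_hom hE]] := Q_inj _ _ i u i_inj u_hom.
apply/(mu_eq0 pres); exists h; split=> // z.
by rewrite -uE hE comp_lfunE pi.
Qed.

(** Let J' be the pullback of a free cover P of Q^b to the image J of phi, with a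
    lift lam of J' to Q^a. The classes of the g : Q^a -> Q for which
    g lam extends to P form a complement to the common kernel of Hom_E (W, Q):
    g is determined modulo the maps factoring through phi by its restriction to
    Y = ker phi, and any g0 can be corrected, without changing that restriction,
    into such a g, because Ext^1 (Q^b, Q) = 0. *)
Lemma presented_splitting : exists S : {vspace W},
  [/\ forall e w, w \in S -> op e w \in S,
      forall w, w \in S -> (forall y, ev y w = 0) -> w = 0 &
      forall w, exists2 s, s \in S & forall y, ev y w = ev y s].
Proof.
have [J [q [i [q_surj i_injh qi]]]] := image_ex (phi_hom pres).
have [i_hom /lker0_inj i_inj] := i_injh.
have [n [p [R [J' [j [pi [rho [rho' [j_injh ex ex' [ipi jrho] liftj]]]]]]]]] :=
  free_pullback i_injh.
have [_ [p_hom p_onto] _] := ex; have [[rho'_hom _] pi_surj rho_pi] := ex'.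
have [lam [lam_hom lamE]] := hA (@free_projective _ _ n) j_injh q_surj pi_surj.1.
have qlam x : q (lam x) = pi x by rewrite lamE comp_lfunE.
have philam x : phi (lam x) = p (j x) by rewrite -qi qlam ipi.
pose good (g : homs (pow Q a) Q) :=
  exists h : 'Hom(pow (regular A) n, Q), is_hom h /\ forall x, val g (lam x) = h (j x).
have [S SP] : exists S : {vspace W}, forall w, w \in S <-> exists g, w = mu g /\ good g.
  apply: vspace_ex.
    exists 0; split; first by rewrite linear0.
    by exists 0; split=> [|x]; [apply: hom_zero | rewrite /= !zero_lfunE].
  move=> c _ _ [g [-> [h [h_hom hE]]]] [g' [-> [h' [h'_hom h'E]]]].
  exists (c *: g + g'); split; first by rewrite linearP.
  exists (c *: h + h'); split=> [|x]; last first.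
    by rewrite linearP /= !add_lfunE !scale_lfunE hE h'E.
  by apply: hom_add => // x r; rewrite !scale_lfunE h_hom actZl.
exists S; split.
- move=> e w /SP[g [-> [h [h_hom hE]]]]; apply/SP.
  have [g' g'E] := mem_homv (hom_comp (subvs_hom e) (subvs_hom g)).
  have g'val x : val g' x = val e (val g x) by rewrite g'E comp_lfunE.
  exists g'; split; first by rewrite (mu_op pres g'val).
  exists (val e \o h)%VF; split; first exact: hom_comp (subvs_hom e) h_hom.
  by move=> x; rewrite comp_lfunE -hE.
- move=> _ /SP[g [-> [h [h_hom hE]]]] g0; apply/(mu_eq0 pres).
  have g_ker z : phi z = 0 -> val g z = 0.
    by move=> /(exact_lift (eps_phi pres))[y ->]; rewrite -(mu_ev pres) g0.
  have [x px|u [u_hom uE]] := @hom_factor _ _ _ _ _ p h (conj p_hom p_onto) h_hom.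
    have [|x' xE] := liftj x 0; first by rewrite px linear0.
    by rewrite xE -hE g_ker // philam -xE.
  exists u; split=> // z; have [x xE] := limg_full (phi z) p_onto.
  have [|x' jx] := liftj x (q z); first by rewrite qi xE.
  rewrite xE uE jx -hE.
  apply/eqP; rewrite -subr_eq0 -linearB; apply/eqP/g_ker.
  by rewrite linearB /= philam -jx xE subrr.
move=> w; have [g0 ->] := mu_onto pres w.
have [|h [h_hom hE]] := vanish_extend (g := (val g0 \o lam \o rho')%VF) ex (pow_vanish QQ).
  by apply: hom_comp rho'_hom; apply: hom_comp lam_hom; apply: subvs_hom.
have d_hom : is_hom ((val g0 \o lam)%VF - (h \o j)%VF).
  by apply: hom_sub (hom_comp (subvs_hom g0) lam_hom) (hom_comp h_hom j_injh.1).
have [_ /(exact_lift rho_pi)[r ->]|f [f_hom fE]] := hom_factor pi_surj d_hom.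
  by rewrite sub_lfunE !comp_lfunE jrho hE !comp_lfunE subrr.
have [g gE] := mem_homv (hom_sub (subvs_hom g0) (hom_comp f_hom q_surj.1)).
have gval z : val g z = val g0 z - f (q z).
  by rewrite gE sub_lfunE comp_lfunE.
exists (mu g).
  apply/SP; exists g; split=> //; exists h; split=> // x.
  by rewrite gval qlam fE sub_lfunE !comp_lfunE opprB addrCA subrr addr0.
move=> y; rewrite !(mu_ev pres) gval.
have -> : q (eps y) = 0.
  by apply: i_inj; rewrite qi linear0 (exact_comp (eps_phi pres)).
by rewrite linear0 subr0.
Qed.

End Presentation.
(** * The two contravariant functors *)

Section Triples.
Variables (k : fieldType) (A : falgType k).
Implicit Types s t u : triple A.

Lemma tisomP s t : tisom s t -> exists x y x' y', [/\ @tmorph _ _ s t x y, @tmorph _ _ t s x' y',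
  cancel x x' /\ cancel x' x & cancel y y' /\ cancel y' y].
Proof.
case=> x [y [[x_hom y_hom xy] x_bij y_bij]].
have [x'_hom xK x'K] := hom_inv x_hom x_bij; have [y'_hom yK y'K] := hom_inv y_hom y_bij.
exists x, y, (x^-1)%VF, (y^-1)%VF; split=> //; split=> //; apply/lfunP => z.
have xyE v : y (tmap s v) = tmap t (x v) by rewrite -!comp_lfunE xy.
by rewrite -(x'K z) !comp_lfunE -xyE xK yK.
Qed.

Lemma tisom_sym s t : tisom s t -> tisom t s.
Proof.
case/tisomP => x [y [x' [y' [_ xy' [xK x'K] [yK y'K]]]]].
by exists x', y'; split=> //; [exists x | exists y].
Qed.

Lemma tisom_trans s t u : tisom s t -> tisom t u -> tisom s u.
Proof.
case=> x [y [[x_hom y_hom xy] x_bij y_bij]] [x' [y' [[x'_hom y'_hom x'y'] x'_bij y'_bij]]].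
exists (x' \o x)%VF, (y' \o y)%VF; split.
- split; [exact: hom_comp | exact: hom_comp |].
  by rewrite -comp_lfunA xy comp_lfunA x'y' comp_lfunA.
- by apply: (eq_bij (bij_comp x'_bij x_bij)) => z; rewrite comp_lfunE.
by apply: (eq_bij (bij_comp y'_bij y_bij)) => z; rewrite comp_lfunE.
Qed.

Lemma tisom_zero s t : tisom s t -> tzero s -> tzero t.
Proof.
case=> x [y [_ [x' _ x'K] [y' _ y'K]]] [s1 s2]; split=> z.
  by rewrite -(x'K z) (s1 (x' z)) linear0.
by rewrite -(y'K z) (s2 (y' z)) linear0.
Qed.

Lemma tisom_tgt s t : tisom s t -> isom (ttgt s) (ttgt t).
Proof. by case=> x [y [[_ y_hom _] _ y_bij]]; exists y. Qed.

End Triples.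

Lemma linear_funD (k : fieldType) (V W : lmodType k) (f : V -> W) x y :
  linear f -> f (x + y) = f x + f y.
Proof. by move=> f_lin; have := f_lin 1 x y; rewrite !scale1r. Qed.

Lemma linear_fun0 (k : fieldType) (V W : lmodType k) (f : V -> W) : linear f -> f 0 = 0.
Proof. by move=> f_lin; have := f_lin (-1) 0 0; rewrite scaler0 addr0 scaleN1r addNr. Qed.

Section LeftAction.
Variables (k : fieldType) (B : falgType k) (M : rmod B^c).

(** A left B-module is a right module over the opposite algebra. *)
Definition lact (b : B) (x : M) : M := act x (b : B^c).

Lemma lactM (b b' : B) (x : M) : lact (b * b') x = lact b (lact b' x).
Proof. exact: (@actA _ _ M x (b' : B^c) (b : B^c)). Qed.

Lemma lact1 (x : M) : lact 1 x = x.
Proof. exact: act1. Qed.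

Lemma lactDr (b : B) (x y : M) : lact b (x + y) = lact b x + lact b y.
Proof. exact: actDl. Qed.

Lemma lactDl (b b' : B) (x : M) : lact (b + b') x = lact b x + lact b' x.
Proof. exact: (@actDr _ _ M x (b : B^c) (b' : B^c)). Qed.

Lemma lactDZ c (b b' : B) (x : M) : lact (c *: b + b') x = c *: lact b x + lact b' x.
Proof. exact: (@act_linearr _ _ M x c (b : B^c) (b' : B^c)). Qed.

Lemma lactB (b : B) (x y : M) : lact b (x - y) = lact b x - lact b y.
Proof. exact: actBl. Qed.

Lemma lact0 (b : B) : lact b (0 : M) = 0.
Proof. exact: act0l. Qed.

Lemma lact0l (x : M) : lact (0 : B) x = 0.
Proof. exact: (@act0r _ _ M x). Qed.

Lemma lactZ (c : k) (b : B) (x : M) : lact b (c *: x) = c *: lact b x.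
Proof. exact: actZl. Qed.

End LeftAction.

Section Functors.
Variables (k : fieldType) (A B : falgType k).
Implicit Types (M N : rmod B^c) (b : B) (a : A).

Record bimod := Bimod {
  bmod :> rmod B^c;
  ract_bim : bmod -> A -> bmod;
  ract_linearl : forall a, linear (ract_bim^~ a);
  ract_linearr : forall x, linear (ract_bim x);
  ract_one : forall x, ract_bim x 1 = x;
  ract_mul : forall x a a', ract_bim x (a * a') = ract_bim (ract_bim x a) a';
  ract_lact : forall x b a, ract_bim (lact b x) a = lact b (ract_bim x a)
}.

Section HomModule.
Variables (M : rmod B^c) (L : bimod).

Definition rmulL a : 'End(L) := linfun (HB.pack (@ract_bim L ^~ a)
  (GRing.isLinear.Build k L L *:%R (@ract_bim L ^~ a) (@ract_linearl L a)) : {linear L -> L}).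

Lemma rmulLE a x : rmulL a x = ract_bim x a.
Proof. by rewrite lfunE. Qed.

Fact homA_subproof (h : homs M L) a : (rmulL a \o val h)%VF \in homv M L.
Proof.
apply/homvP => m b; rewrite !comp_lfunE !rmulLE (subvs_hom h).
exact: ract_lact.
Qed.

Definition homA_act (h : homs M L) a : homs M L :=
  Subvs (homA_subproof h a).

Lemma homA_actE h a m : val (homA_act h a) m = ract_bim (val h m) a.
Proof. by rewrite comp_lfunE rmulLE. Qed.

Fact homA_linearl a : linear (homA_act^~ a).
Proof.
move=> c h h'; apply: homs_eq => m.
rewrite homA_actE linearP /= !add_lfunE !scale_lfunE ract_linearl.
by rewrite -!homA_actE.
Qed.
Fact homA_linearr h : linear (homA_act h).
Proof.
move=> c a a'; apply: homs_eq => m.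
rewrite homA_actE ract_linearr linearP /= !add_lfunE !scale_lfunE.
by rewrite -!homA_actE.
Qed.
Fact homA_act1 h : homA_act h 1 = h.
Proof. by apply: homs_eq => m; rewrite homA_actE ract_one. Qed.
Fact homA_actA h a a' : homA_act h (a * a') = homA_act (homA_act h a) a'.
Proof. by apply: homs_eq => m; rewrite !homA_actE ract_mul. Qed.

Definition homA : rmod A := Rmod homA_linearl homA_linearr homA_act1 homA_actA.

Lemma homAE (h : homA) a m : val (act h a) m = ract_bim (val h m) a.
Proof. exact: homA_actE. Qed.

End HomModule.

Lemma homA_precomp M N (L : bimod) (f : 'Hom(M, N)) : is_hom f ->
  exists F : 'Hom(homA N L, homA M L), is_hom F /\ forall h m, val (F h) m = val h (f m).
Proof.
move=> f_hom; have [F0 F0E] := homv_precomp L f_hom.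
pose F : 'Hom(homA N L, homA M L) := F0.
have FE (h : homA N L) m : val (F h) m = val h (f m) by apply: F0E.
exists F; split=> // h a; apply: homs_eq => m.
by rewrite FE !homAE FE.
Qed.

Lemma homA_sum M N (L : bimod) :
  exists x : 'Hom(homA (dsum M N) L, dsum (homA M L) (homA N L)),
  [/\ is_hom x, bijective x &
      forall h, (forall m, val (x h).1 m = val h (m, 0)) /\
                (forall n, val (x h).2 n = val h (0, n))].
Proof.
have [x0 [x0_bij x0E]] := homs_sum M N L.
pose x : 'Hom(homA (dsum M N) L, dsum (homA M L) (homA N L)) := x0.
exists x; split=> // h a; rewrite [RHS]surjective_pairing [LHS]surjective_pairing.
congr pair; apply: homs_eq => z.
  by rewrite (x0E _).1 !homAE (x0E _).1.
by rewrite (x0E _).2 !homAE (x0E _).2.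
Qed.

Variables T I : rmod A.

(** An identification of B with the algebra of the endomorphisms of T + I that preserve
    I, by way of their matrix entries. *)
Record endo_pair := EndoPair {
  cc : B -> 'End(T);
  gg : B -> 'Hom(T, I);
  hh : B -> 'End(I);
  cc_linear : linear cc;
  gg_linear : linear gg;
  hh_linear : linear hh;
  cc_hom : forall b, is_hom (cc b);
  gg_hom : forall b, is_hom (gg b);
  hh_hom : forall b, is_hom (hh b);
  cc_one : cc 1 = \1%VF;
  gg_one : gg 1 = 0;
  hh_one : hh 1 = \1%VF;
  ccM : forall b b', cc (b * b') = (cc b \o cc b')%VF;
  ggM : forall b b', gg (b * b') = (gg b \o cc b')%VF + (hh b \o gg b')%VF;
  hhM : forall b b', hh (b * b') = (hh b \o hh b')%VF;
  entries_inj : forall b b', cc b = cc b' -> gg b = gg b' -> hh b = hh b' -> b = b';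
  entries_onto : forall c g h, is_hom c -> is_hom g -> is_hom h ->
    exists b, [/\ cc b = c, gg b = g & hh b = h]
}.

Variable P : endo_pair.

Section BimodT.
Fact T_linearl (b : B^c) : linear (fun t : T => cc P b t).
Proof. by move=> c x y; rewrite linearP. Qed.
Fact T_linearr (t : T) : linear (fun b : B^c => cc P b t).
Proof. by move=> c b b'; rewrite (cc_linear P) lfunDZ. Qed.
Fact T_one (t : T) : cc P (1 : B^c) t = t.
Proof. by rewrite (cc_one P) id_lfunE. Qed.
Fact T_mul (t : T) (b b' : B^c) : cc P (b * b' : B^c) t = cc P b' (cc P b t).
Proof. by rewrite (ccM P b' b) comp_lfunE. Qed.

Definition leftT : rmod B^c := @Rmod _ B^c T _ T_linearl T_linearr T_one T_mul.

Fact T_lact (x : leftT) b a : act (lact b x : T) a = lact b (act (x : T) a : leftT).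
Proof. by symmetry; apply: (cc_hom P b x a). Qed.

Definition bimodT : bimod := @Bimod leftT (@act _ _ T) (@act_linearl _ _ T)
  (@act_linearr _ _ T) (@act1 _ _ T) (@actA _ _ T) T_lact.
End BimodT.

Section BimodU.
Let U : rmod A := dsum T I.
Definition U_act (u : U) (b : B^c) : U := (cc P b u.1, gg P b u.1 + hh P b u.2).
Fact U_linearl b : linear (U_act^~ b).
Proof.
move=> c u v; rewrite /U_act /= !linearP.
by congr pair; rewrite /= scalerDr addrACA.
Qed.
Fact U_linearr u : linear (U_act u).
Proof.
move=> c b b'; rewrite /U_act /= (cc_linear P) (gg_linear P) (hh_linear P).
rewrite !add_lfunE !scale_lfunE.
by congr pair; rewrite /= scalerDr addrACA.
Qed.
Fact U_one u : U_act u 1 = u.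
Proof.
case: u => t x; rewrite /U_act /= (cc_one P) (gg_one P) (hh_one P).
by rewrite !id_lfunE zero_lfunE add0r.
Qed.
Fact U_mul u (b b' : B^c) : U_act u (b * b') = U_act (U_act u b) b'.
Proof.
rewrite /U_act /= (ccM P b' b) (ggM P b' b) (hhM P b' b) !add_lfunE !comp_lfunE.
by rewrite linearD /= addrA.
Qed.

Definition leftU : rmod B^c := @Rmod _ B^c U U_act U_linearl U_linearr U_one U_mul.

Fact U_lact (x : leftU) b a : act (lact b x : U) a = lact b (act (x : U) a : leftU).
Proof.
case: x => t x; congr pair; rewrite /= ?(cc_hom P) //.
by rewrite actDl (gg_hom P) (hh_hom P).
Qed.

Definition bimodU : bimod := @Bimod leftU (@act _ _ U) (@act_linearl _ _ U)
  (@act_linearr _ _ U) (@act1 _ _ U) (@actA _ _ U) U_lact.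
End BimodU.

(** The triple Hom_B (M, T + I) -> Hom_B (M, T) of a left B-module M. *)
Section ToTriple.
Variable M : rmod B^c.

Fact phi_map_ex : exists F : 'Hom(homA M bimodU, homA M bimodT),
  is_hom F /\ forall h m, val (F h) m = (val h m).1.
Proof.
have [//|//|f [f_hom fE]] := @hom_exists _ _ leftU leftT fst.
have [F0 F0E] := homv_postcomp M f_hom.
pose F : 'Hom(homA M bimodU, homA M bimodT) := F0.
have FE (h : homA M bimodU) m : val (F h) m = (val h m).1.
  by rewrite -fE; apply: F0E.
exists F; split=> // h a; apply: homs_eq => m.
by rewrite FE !homAE FE.
Qed.

Definition phi_map := proj1_sig (constructive_indefinite_description _ phi_map_ex).

Lemma phi_map_hom : is_hom phi_map.
Proof. by rewrite /phi_map; case: constructive_indefinite_description => F []. Qed.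

Lemma phi_mapE h m : val (phi_map h) m = (val h m).1.
Proof. by rewrite /phi_map; case: constructive_indefinite_description => F []. Qed.

Definition to_triple : triple A := Triple phi_map_hom.
End ToTriple.

Lemma to_triple_isom M N : isom M N -> tisom (to_triple M) (to_triple N).
Proof.
case/isomP => f [f' [f_hom f'_hom fK f'K]].
have [x [x_hom xE]] := homA_precomp bimodU f'_hom.
have [x' [_ x'E]] := homA_precomp bimodU f_hom.
have [y [y_hom yE]] := homA_precomp bimodT f'_hom.
have [y' [_ y'E]] := homA_precomp bimodT f_hom.
exists x, y; split; first split=> //.
- apply/lfunP => h; apply: homs_eq => m.
  by rewrite !comp_lfunE yE !phi_mapE xE.
- exists x' => h; apply: homs_eq => m.
    by rewrite x'E xE fK.
  by rewrite xE x'E f'K.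
exists y' => h; apply: homs_eq => m.
  by rewrite y'E yE fK.
by rewrite yE y'E f'K.
Qed.

Lemma to_triple_sum M N :
  tisom (to_triple (dsum M N)) (tsum (to_triple M) (to_triple N)).
Proof.
have [x [x_hom x_bij xE]] := homA_sum M N bimodU.
have [y [y_hom y_bij yE]] := homA_sum M N bimodT.
exists x, y; split=> //; split=> //; apply/lfunP => h; rewrite !comp_lfunE lfunE.
rewrite [LHS]surjective_pairing; congr pair; apply: homs_eq => m.
  by rewrite (yE _).1 !phi_mapE (xE _).1.
by rewrite (yE _).2 !phi_mapE (xE _).2.
Qed.

(** The left B-module Hom_A (Y, T) + Hom_A (X, I) of a triple (X, Y, f). The part
    Hom (T, I) of B acts by v |-> g v f from Hom_A (Y, T) to Hom_A (X, I). *)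
Section ToModule.
Variable t : triple A.
Let H1 := homv (ttgt t) T.
Let H2 := homv (tsrc t) I.
Let V := (subvs_of H1 * subvs_of H2)%type.

Fact psi_subproof1 (u : V) b : (cc P b \o val u.1)%VF \in H1.
Proof. by apply/homvP; apply: hom_comp (subvs_hom _); apply: cc_hom. Qed.
Fact psi_subproof2 (u : V) b :
  ((gg P b \o val u.1 \o tmap t)%VF + (hh P b \o val u.2)%VF) \in H2.
Proof.
apply/homvP; apply: hom_add.
  by apply: hom_comp (@tmap_hom _ _ t); apply: hom_comp (subvs_hom _); apply: gg_hom.
by apply: hom_comp (subvs_hom _); apply: hh_hom.
Qed.

Definition psi_act (u : V) (b : B^c) : V :=
  (Subvs (psi_subproof1 u b), Subvs (psi_subproof2 u b)).

Lemma psi_act1E u b y : val (psi_act u b).1 y = cc P b (val u.1 y).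
Proof. by rewrite comp_lfunE. Qed.
Lemma psi_act2E u b x :
  val (psi_act u b).2 x = gg P b (val u.1 (tmap t x)) + hh P b (val u.2 x).
Proof. by rewrite add_lfunE !comp_lfunE. Qed.

Lemma psi_eq (u v : V) : (forall y, val u.1 y = val v.1 y) ->
  (forall x, val u.2 x = val v.2 x) -> u = v.
Proof.
case: u v => [u1 u2] [v1 v2] /= e1 e2.
by congr pair; apply: val_inj; apply/lfunP.
Qed.

Fact psi_linearl b : linear (psi_act^~ b).
Proof.
move=> c u v; apply: psi_eq => [y|x].
  by rewrite !(psi_act1E, linearP, add_lfunE, scale_lfunE) /= -!psi_act1E.
rewrite psi_act2E !(linearP, add_lfunE, scale_lfunE) /= !comp_lfunE.
by rewrite scalerDr addrACA.
Qed.
Fact psi_linearr u : linear (psi_act u).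
Proof.
move=> c b b'; apply: psi_eq => [y|x].
  by rewrite psi_act1E (cc_linear P) !(linearP, add_lfunE, scale_lfunE) /= !comp_lfunE.
rewrite psi_act2E (gg_linear P) (hh_linear P) !(linearP, add_lfunE, scale_lfunE) /=.
by rewrite !comp_lfunE scalerDr addrACA.
Qed.
Fact psi_one u : psi_act u 1 = u.
Proof.
apply: psi_eq => [y|x]; first by rewrite psi_act1E (cc_one P) id_lfunE.
by rewrite psi_act2E (gg_one P) (hh_one P) id_lfunE zero_lfunE add0r.
Qed.
Fact psi_mul u (b b' : B^c) : psi_act u (b * b') = psi_act (psi_act u b) b'.
Proof.
apply: psi_eq => [y|x]; first by rewrite !psi_act1E (ccM P b' b) comp_lfunE.
rewrite !psi_act2E psi_act1E (ggM P b' b) (hhM P b' b) add_lfunE !comp_lfunE.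
by rewrite linearD /= addrA.
Qed.

Definition to_module : rmod B^c := @Rmod _ B^c V psi_act psi_linearl psi_linearr psi_one psi_mul.
End ToModule.

Lemma to_module_isom s t : tisom s t -> isom (to_module s) (to_module t).
Proof.
case/tisomP => x [y [x' [y' [[x_hom y_hom xy] [x'_hom y'_hom xy'] [xK x'K] [yK y'K]]]]].
have [F1 F1E] := homv_precomp T y'_hom; have [F2 F2E] := homv_precomp I x'_hom.
have [G1 G1E] := homv_precomp T y_hom; have [G2 G2E] := homv_precomp I x_hom.
apply: (@isom_can _ _ (to_module s) (to_module t) (fun u => (F1 u.1, F2 u.2))
                                                  (fun u => (G1 u.1, G2 u.2))).
- by move=> c u v; rewrite /= !linearP.
- move=> u b; apply: psi_eq => z.
    by rewrite [LHS]F1E (psi_act1E (F1 u.1, F2 u.2)) (psi_act1E u) /= F1E.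
  rewrite [LHS]F2E (psi_act2E (F1 u.1, F2 u.2)) (psi_act2E u) /= F1E F2E.
  by rewrite -(comp_lfunE (tmap s)) -xy' comp_lfunE.
- by move=> u; apply: psi_eq => z; rewrite /= ?G1E ?G2E ?F1E ?F2E ?xK ?yK.
by move=> u; apply: psi_eq => z; rewrite /= ?F1E ?F2E ?G1E ?G2E ?x'K ?y'K.
Qed.

Lemma to_module_sum s t : isom (to_module (tsum s t)) (dsum (to_module s) (to_module t)).
Proof.
have [y [[y' yK y'K] yE]] := homs_sum (ttgt s) (ttgt t) T.
have [x [[x' xK x'K] xE]] := homs_sum (tsrc s) (tsrc t) I.
have mapl z : tmap (tsum s t) (z, 0) = (tmap s z, 0) by rewrite lfunE /= /tsum_fun /= linear0.
have mapr z : tmap (tsum s t) (0, z) = (0, tmap t z) by rewrite lfunE /= /tsum_fun /= linear0.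
have [c u v|u b|F [F_hom FE]] := @hom_exists _ _ (to_module (tsum s t))
  (dsum (to_module s) (to_module t)) (fun u => (((y u.1).1, (x u.2).1), ((y u.1).2, (x u.2).2))).
- by rewrite /= !linearP.
- congr pair; apply: psi_eq => z.
  + by rewrite [LHS](yE _).1 (psi_act1E u) psi_act1E (yE _).1.
  + by rewrite [LHS](xE _).1 (psi_act2E u) psi_act2E (yE _).1 (xE _).1 mapl.
  + by rewrite [LHS](yE _).2 (psi_act1E u) psi_act1E (yE _).2.
  by rewrite [LHS](xE _).2 (psi_act2E u) psi_act2E (yE _).2 (xE _).2 mapr.
exists F; split=> //.
exists (fun v => (y' (v.1.1, v.2.1), x' (v.1.2, v.2.2))) => [u|[[u1 u2] [v1 v2]]]; rewrite FE /=.
  by rewrite -!surjective_pairing yK xK; case: u.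
by rewrite y'K x'K.
Qed.

End Functors.
(** * The two functors are mutually inverse up to exceptional modules *)

Section Entries.
Variables (k : fieldType) (A B : falgType k) (T I : rmod A) (P : endo_pair B T I).
Implicit Types (M : rmod B^c) (b : B).

Let ET := homs T T.
Let EI := homs I I.
Let ETI := homs T I.

Fact mk_subproof (c : ET) (g : ETI) (h : EI) :
  exists b, [/\ cc P b = val c, gg P b = val g & hh P b = val h].
Proof. exact: entries_onto (subvs_hom c) (subvs_hom g) (subvs_hom h). Qed.

Definition mk c g h := proj1_sig (constructive_indefinite_description _ (mk_subproof c g h)).

Lemma mkP c g h : [/\ cc P (mk c g h) = val c, gg P (mk c g h) = val g & hh P (mk c g h) = val h].
Proof. by rewrite /mk; case: constructive_indefinite_description. Qed.

Lemma cc_mk c g h : cc P (mk c g h) = val c. Proof. by case: (mkP c g h). Qed.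
Lemma gg_mk c g h : gg P (mk c g h) = val g. Proof. by case: (mkP c g h). Qed.
Lemma hh_mk c g h : hh P (mk c g h) = val h. Proof. by case: (mkP c g h). Qed.

Fact endo1_subproof (Q : rmod A) : (\1%VF : 'End(Q)) \in homv Q Q.
Proof. by apply/homvP; apply: hom_id. Qed.
Definition endo1 (Q : rmod A) : homs Q Q := Subvs (endo1_subproof Q).

(** The corners End (T) and End (I) of the triangular algebra B, its part Hom (T, I),
    and the two diagonal idempotents. *)
Definition inT (c : ET) : B := mk c 0 0.
Definition inI (h : EI) : B := mk 0 0 h.
Definition inTI (g : ETI) : B := mk 0 g 0.
Definition eT : B := inT (endo1 T).
Definition eI : B := inI (endo1 I).

Lemma ccD b b' : cc P (b + b') = cc P b + cc P b'. Proof. exact: linear_funD (cc_linear P). Qed.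
Lemma ggD b b' : gg P (b + b') = gg P b + gg P b'. Proof. exact: linear_funD (gg_linear P). Qed.
Lemma hhD b b' : hh P (b + b') = hh P b + hh P b'. Proof. exact: linear_funD (hh_linear P). Qed.
Lemma cc0 : cc P 0 = 0. Proof. exact: linear_fun0 (cc_linear P). Qed.
Lemma gg0 : gg P 0 = 0. Proof. exact: linear_fun0 (gg_linear P). Qed.
Lemma hh0 : hh P 0 = 0. Proof. exact: linear_fun0 (hh_linear P). Qed.
Lemma val_endo1 (Q : rmod A) : val (endo1 Q) = \1%VF. Proof. by []. Qed.
Lemma val_hom0 (Q R : rmod A) : val (0 : homs Q R) = 0. Proof. by []. Qed.

Definition entE := (cc_mk, gg_mk, hh_mk, val_endo1, val_hom0).
Definition entM := (cc_linear P, gg_linear P, hh_linear P, ccM P, ggM P, hhM P, ccD, ggD, hhD,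
  cc0, gg0, hh0, cc_one P, gg_one P, hh_one P, cc_mk, gg_mk, hh_mk, val_endo1, val_hom0).
Definition comp01 := (@comp_lfun0l, @comp_lfun0r, @comp_lfun1l, @comp_lfun1r,
  @scaler0, @addr0, @add0r).

Ltac entrywise := apply: (entries_inj (e := P)); rewrite /eT /eI /inT /inI /inTI !entM ?comp01.

Lemma inT_linear : linear inT. Proof. by move=> c e e'; entrywise. Qed.
Lemma inI_linear : linear inI. Proof. by move=> c e e'; entrywise. Qed.
Lemma inTI_linear : linear inTI. Proof. by move=> c e e'; entrywise. Qed.

Lemma inT_mul (e e' e'' : ET) : val e'' = (val e \o val e')%VF -> inT e'' = inT e * inT e'.
Proof. by move=> e''E; entrywise. Qed.

Lemma inI_mul (e e' e'' : EI) : val e'' = (val e \o val e')%VF -> inI e'' = inI e * inI e'.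
Proof. by move=> e''E; entrywise. Qed.

Lemma inI_inTI (h : EI) (g g' : ETI) : val g' = (val h \o val g)%VF -> inTI g' = inI h * inTI g.
Proof. by move=> g'E; entrywise. Qed.

Lemma inTI_mul (g g' : ETI) b : val g' = (val g \o cc P b)%VF -> inTI g' = inTI g * b.
Proof. by move=> g'E; entrywise. Qed.

Lemma eTI_one : eT + eI = 1. Proof. by entrywise. Qed.
Lemma eT_eI : eT * eI = 0. Proof. by entrywise. Qed.
Lemma eI_inTI g : eI * inTI g = inTI g. Proof. by entrywise. Qed.

Lemma eT_mul (c : ET) b : val c = cc P b -> eT * b = inT c * eT.
Proof. by move=> cE; entrywise; rewrite ?cE. Qed.

Lemma eI_mul (g : ETI) (h : EI) b : val g = gg P b -> val h = hh P b ->
  eI * b = inTI g + inI h * eI.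
Proof. by move=> gE hE; entrywise; rewrite ?gE ?hE. Qed.

Lemma eTI_split M (m : M) : m = lact eT m + lact eI m.
Proof. by rewrite -lactDl eTI_one lact1. Qed.

Lemma eTK M (m : M) : lact eT (lact eT m) = lact eT m.
Proof. by rewrite -lactM -(@inT_mul (endo1 T) (endo1 T) (endo1 T)) // comp_lfun1l. Qed.

Lemma eIK M (m : M) : lact eI (lact eI m) = lact eI m.
Proof. by rewrite -lactM -(@inI_mul (endo1 I) (endo1 I) (endo1 I)) // comp_lfun1l. Qed.

Lemma leftT_actE (x : leftT P) b : lact b x = cc P b x. Proof. by []. Qed.
Lemma leftU_actE (u : leftU P) b : lact b u = (cc P b u.1, gg P b u.1 + hh P b u.2).
Proof. by []. Qed.

Lemma homA_lact M (L : bimod A B) (h : homA M L) b m : val h (lact b m) = lact b (val h m).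
Proof. exact: subvs_hom h m b. Qed.

(** A homomorphism from M to T does not see the corner of I in M, and the component in
    I of a homomorphism to T + I does not see the corner of T. *)
Lemma homT_eT M (h : homA M (bimodT P)) m : val h (lact eT m) = val h m.
Proof. by rewrite homA_lact leftT_actE entE id_lfunE. Qed.

Lemma homT_eI M (h : homA M (bimodT P)) m : val h (lact eI m) = 0.
Proof. by rewrite homA_lact leftT_actE entE zero_lfunE. Qed.

Lemma homT_inT M (h : homA M (bimodT P)) c m : val h (lact (inT c) m) = val c (val h m).
Proof. by rewrite homA_lact leftT_actE entE. Qed.

Lemma homU_eT M (h : homA M (bimodU P)) m : (val h (lact eT m)).2 = 0.
Proof. by rewrite homA_lact leftU_actE /= !entE !zero_lfunE addr0. Qed.

Lemma homU_eI M (h : homA M (bimodU P)) m : (val h (lact eI m)).2 = (val h m).2.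
Proof. by rewrite homA_lact leftU_actE /= !entE zero_lfunE id_lfunE add0r. Qed.

Lemma homU_inI M (h : homA M (bimodU P)) e m : (val h (lact (inI e) m)).2 = val e (val h m).2.
Proof. by rewrite homA_lact leftU_actE /= !entE zero_lfunE add0r. Qed.

Lemma homU_inTI M (h : homA M (bimodU P)) g m : (val h (lact (inTI g) m)).2 = val g (val h m).1.
Proof. by rewrite homA_lact leftU_actE /= !entE zero_lfunE addr0. Qed.

End Entries.

Section Corner.
Variables (k : fieldType) (A B : falgType k) (Q : rmod A) (s : homs Q Q -> B).
Hypothesis s_lin : linear s.
Hypothesis s_mul : forall e e' e'' : homs Q Q,
  val e'' = (val e \o val e')%VF -> s e'' = s e * s e'.

(** For an embedding s of End (Q) as a corner of B, the subspace s (1) M is a left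
    End (Q)-module. *)
Lemma corner_ex (M : rmod B^c) :
  exists (W : {vspace M}) (op : 'Hom(homs Q Q, 'End(subvs_of W))),
  [/\ forall m, m \in W <-> lact (s (endo1 Q)) m = m,
      forall e w, val (op e w) = lact (s e) (val w),
      forall e w, val e = \1%VF -> op e w = w &
      forall (e e' e'' : homs Q Q) w,
        val e'' = (val e \o val e')%VF -> op e'' w = op e (op e' w)].
Proof.
have [W WP] : exists W : {vspace M}, forall m, m \in W <-> lact (s (endo1 Q)) m = m.
  apply: vspace_ex => [|c x y xE yE]; first exact: lact0.
  by rewrite lactDr lactZ xE yE.
have opW e (w : subvs_of W) : lact (s e) (val w) \in W.
  by apply/WP; rewrite -lactM -(@s_mul (endo1 Q) e e) // comp_lfun1l.
have [op opE] : exists op : 'Hom(homs Q Q, 'End(subvs_of W)),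
    forall e w, op e w = Subvs (opW e w).
  apply: bilinear_lfun => [w c e e'|e c w w']; apply: val_inj => /=.
    by rewrite s_lin lactDZ.
  by rewrite lactDr lactZ.
exists W, op; split=> // [e w|e w e1|e e' e'' w /s_mul e''E]; rewrite ?opE //.
  have -> : e = endo1 Q by apply: val_inj; rewrite e1.
  by apply: val_inj => /=; apply/WP/subvsP.
by apply: val_inj; rewrite /= e''E lactM.
Qed.

End Corner.

Section Pairings.
Variables (k : fieldType) (A B : falgType k) (T I : rmod A) (P : endo_pair B T I).
Hypothesis cogI : forall M : rmod A, cogenerated M I.
Variable M : rmod B^c.
Local Notation eT := (eT P).
Local Notation eI := (eI P).

(** A homomorphism from M to T is zero on the corner of I, so that it is the same thing
    as a homomorphism of End (T)-modules from the corner of T. *)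
Lemma pairing_T : exists (W : {vspace M}) (op : 'Hom(homs T T, 'End(subvs_of W)))
    (ev : 'Hom(homA M (bimodT P), 'Hom(subvs_of W, T))),
  [/\ forall m, m \in W <-> lact eT m = m, forall e w, val (op e w) = lact (inT P e) (val w),
      left_pairing op ev & forall h w, ev h w = val h (val w)].
Proof.
have [W [op [WP opE op1 opM]]] := corner_ex (inT_linear P) (@inT_mul _ _ _ _ _ P) M.
have [ev evE] : exists ev : 'Hom(homA M (bimodT P), 'Hom(subvs_of W, T)),
    forall h w, ev h w = val h (val w).
  apply: bilinear_lfun => [w c h h'|h c w w']; rewrite linearP //=.
  by rewrite lfunDZ.
exists W, op, ev; split=> //.
have eTW m : lact eT m \in W by apply/WP; apply: eTK.
split=> //.
- by move=> h e w; rewrite !evE opE homT_inT.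
- by move=> h a w; rewrite !evE homAE.
- move=> h h0; apply: homs_eq => m; rewrite -homT_eT.
  by have := h0 (Subvs (eTW m)); rewrite evE /= zero_lfunE.
move=> h0 h0E.
have [|m b|h [h_hom hE]] := @hom_exists _ _ M (leftT P) (fun m => h0 (Subvs (eTW m))).
- move=> c m m'; rewrite -linearP; congr (h0 _); apply: val_inj => /=.
  by rewrite lactDr lactZ.
- have [e eE] := mem_homv (cc_hom P b).
  rewrite -[RHS]/(cc P b _) -eE -h0E; congr (h0 _); apply: val_inj; rewrite opE /=.
  by rewrite -!lactM; congr (lact _ m); apply: eT_mul.
have [h' h'E] := mem_homv h_hom; exists h' => w; rewrite evE h'E hE.
by congr (h0 _); apply: val_inj => /=; apply/WP/subvsP.
Qed.

(** A homomorphism M -> T + I is determined by its component on the corner of I: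
    the value x in T at m is subject to g x = h0 (g m) for all g : T -> I, and it
    exists because T is I-reflexive. *)
Lemma pairing_I : exists (W : {vspace M}) (op : 'Hom(homs I I, 'End(subvs_of W)))
    (ev : 'Hom(homA M (bimodU P), 'Hom(subvs_of W, I))),
  [/\ forall m, m \in W <-> lact eI m = m, left_pairing op ev &
      forall h w, ev h w = (val h (val w)).2].
Proof.
have [W [op [WP opE op1 opM]]] := corner_ex (inI_linear P) (@inI_mul _ _ _ _ _ P) M.
have [ev evE] : exists ev : 'Hom(homA M (bimodU P), 'Hom(subvs_of W, I)),
    forall h w, ev h w = (val h (val w)).2.
  apply: bilinear_lfun => [w c h h'|h c w w']; rewrite linearP //=.
  by rewrite lfunDZ.
exists W, op, ev; split=> //.
have eIW m : lact eI m \in W by apply/WP; apply: eIK.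
split=> //.
- by move=> h e w; rewrite !evE opE homU_inI.
- by move=> h a w; rewrite !evE homAE.
- move=> h h0.
  have h20 m : (val h m).2 = 0 by have := h0 (Subvs (eIW m)); rewrite evE /= homU_eI.
  apply: homs_eq => m; rewrite zero_lfunE [LHS]surjective_pairing h20.
  congr pair; apply: (cogenerated_eq (@cogI T)) => g.
  by rewrite -homU_inTI h20 linear0.
move=> h0 h0E.
have [h1 h1E] : exists h1 : 'Hom(M, I), forall m, h1 m = h0 (Subvs (eIW m)).
  apply: lfun_exists => c m m'; rewrite -linearP; congr (h0 _); apply: val_inj => /=.
  by rewrite lactDr lactZ.
have h1W w : h0 w = h1 (val w).
  by rewrite h1E; congr (h0 _); apply: val_inj => /=; symmetry; apply/WP/subvsP.
have gW (g : homs T I) m : lact (inTI P g) m \in W.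
  by apply/WP; rewrite -lactM eI_inTI.
have ex m : exists x : T, forall g : homs T I, val g x = h1 (lact (inTI P g) m).
  have [phi phiE] : exists phi : 'Hom(homs T I, I),
      forall g, phi g = h1 (lact (inTI P g) m).
    by apply: lfun_exists => c g g'; rewrite -linearP inTI_linear lactDZ.
  have [c g g' c_hom g'E|x xE] := cogenerator_reflexive cogI (phi := phi).
    have [e eE] := mem_homv c_hom; rewrite !phiE -eE.
    rewrite -(h1W (Subvs (gW g m))) -(h1W (Subvs (gW g' m))) -h0E.
    congr (h0 _); apply: val_inj; rewrite opE /= -lactM; congr (lact _ m).
    by apply: inI_inTI; apply/lfunP => z; rewrite comp_lfunE eE g'E.
  by exists x => g; rewrite -xE phiE.
have [x xE] := choice_fun ex.
have xuniq (z z' : T) := cogenerated_eq (@cogI T) (y := z) (y' := z').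
have [|m b|h [h_hom hE]] := @hom_exists _ _ M (leftU P) (fun m => (x m, h1 m)).
- move=> c m m'; rewrite [RHS]surjective_pairing linearP; congr pair.
  by apply: xuniq => g; rewrite xE /= linearP /= !xE -linearP lactDr lactZ.
- rewrite -[act m b]/(lact (b : B) m) [RHS]surjective_pairing.
  congr pair.
    apply: xuniq => g; rewrite xE /=.
    have [g' g'E] := mem_homv (hom_comp (subvs_hom g) (cc_hom P b)).
    rewrite -(comp_lfunE (val g)) -g'E xE -lactM; congr (h1 (lact _ m)).
    by symmetry; apply: inTI_mul.
  have [g gE] := mem_homv (gg_hom P b); have [e eE] := mem_homv (hh_hom P b).
  rewrite /= -gE xE -eE (h1E m) -h0E !h1E -linearD; congr (h0 _); apply: val_inj => /=.
  rewrite opE /= -!lactM -lactDl eI_inTI; congr (lact _ m).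
  exact: eI_mul.
have [h' h'E] := mem_homv h_hom; exists h' => w.
by rewrite evE h'E hE /= h1W.
Qed.

End Pairings.

Section Reflexivity.
Variables (k : fieldType) (A B : falgType k) (T I : rmod A) (P : endo_pair B T I).
Hypotheses (hA : hereditary A) (hT : tilting T).
Hypothesis cogI : forall M : rmod A, cogenerated M I.

(** The evaluation maps from Y and X to the components of the double dual are injective
    because T cogenerates Y and I cogenerates X, and onto because Y is T-reflexive and X
    is I-reflexive. For X this also uses that a homomorphism to T + I is determined by
    its component in I, as I cogenerates T. *)
Lemma to_triple_to_module (t : triple A) : ext_vanish (ttgt t) T ->
  tisom t (to_triple P (to_module P t)).
Proof.
move=> YT; pose M := to_module P t; have cogY := tilting_cogenerates hA hT YT.
have lact1 (u : M) b y : val (lact b u : M).1 y = cc P b (val u.1 y) by apply: psi_act1E.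
have lact2 (u : M) b x :
    val (lact b u : M).2 x = gg P b (val u.1 (tmap t x)) + hh P b (val u.2 x).
  exact: psi_act2E.
have [y [y_hom yE]] : exists y : 'Hom(ttgt t, homA M (bimodT P)), is_hom y /\
    forall z (u : M), val (y z) u = val u.1 z.
  have ex z : exists h : homA M (bimodT P), forall u : M, val h u = val u.1 z.
    have [c u v|u b|f [f_hom fE]] := @hom_exists _ _ M (leftT P) (fun u => val u.1 z).
    - by rewrite /= lfunDZ.
    - exact: (lact1 u b).
    by have [h hE] := mem_homv f_hom; exists h => u; rewrite hE fE.
  have [f fE] := choice_fun ex.
  have [c z z'|z a|g [g_hom gE]] := @hom_exists _ _ (ttgt t) (homA M (bimodT P)) f.
  - by apply: homs_eq => u; rewrite linearP /= lfunDZ !fE linearP.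
  - by apply: homs_eq => u; rewrite homAE !fE (subvs_hom u.1).
  by exists g; split=> // z u; rewrite gE fE.
have [x [x_hom xE]] : exists x : 'Hom(tsrc t, homA M (bimodU P)), is_hom x /\
    forall z (u : M), val (x z) u = (val u.1 (tmap t z), val u.2 z).
  have ex z : exists h : homA M (bimodU P), forall u : M,
      val h u = (val u.1 (tmap t z), val u.2 z).
    have [c u v|u b|f [f_hom fE]] :=
      @hom_exists _ _ M (leftU P) (fun u => (val u.1 (tmap t z), val u.2 z)).
    - by rewrite /= !add_lfunE !scale_lfunE.
    - by rewrite [RHS]surjective_pairing; congr pair; [apply: (lact1 u b) | apply: (lact2 u b)].
    by have [h hE] := mem_homv f_hom; exists h => u; rewrite hE fE.
  have [f fE] := choice_fun ex.
  have [c z z'|z a|g [g_hom gE]] := @hom_exists _ _ (tsrc t) (homA M (bimodU P)) f.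
  - by apply: homs_eq => u; rewrite linearP /= lfunDZ !fE !linearP.
  - apply: homs_eq => u.
    by rewrite homAE !fE (tmap_hom (t := t)) (subvs_hom u.1) (subvs_hom u.2).
  by exists g; split=> // z u; rewrite gE fE.
have y_inj : injective y.
  move=> z z' e; apply: (cogenerated_eq cogY) => d.
  have := congr1 (fun h : homA M (bimodT P) => val h ((d, 0) : M)) e.
  by rewrite !yE.
have x_inj : injective x.
  move=> z z' e; apply: (cogenerated_eq (@cogI _)) => d.
  have := congr1 (fun h : homA M (bimodU P) => val h ((0, d) : M)) e.
  by rewrite !xE => -[].
have usplit (u : M) : u = ((u.1, 0) : M) + ((0, u.2) : M).
  by case: u => u1 u2; congr pair; rewrite /= ?addr0 ?add0r.
have eTu (d : homs (ttgt t) T) : lact (eT P) ((d, 0) : M) = (d, 0).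
  apply: psi_eq => z; first by rewrite lact1 entE id_lfunE.
  by rewrite lact2 !entE !zero_lfunE addr0.
have eIu (d : homs (tsrc t) I) : lact (eI P) ((0, d) : M) = (0, d).
  apply: psi_eq => z; first by rewrite lact1 entE /= !zero_lfunE.
  by rewrite lact2 !entE /= !zero_lfunE add0r id_lfunE.
have y_onto (h : homA M (bimodT P)) : exists z, h = y z.
  have [phi phiE] : exists phi : 'Hom(homs (ttgt t) T, T),
      forall d, phi d = val h ((d, 0) : M).
    apply: lfun_exists => c d d'; rewrite -linearP; congr (val h _).
    by congr pair; rewrite /= scaler0 addr0.
  have [c d d' c_hom d'E|z zE] := tilting_reflexive hA hT YT (phi := phi).
    rewrite !phiE; have [e eE] := mem_homv c_hom.
    have -> : ((d', 0) : M) = lact (inT P e) ((d, 0) : M).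
      apply: psi_eq => z; first by rewrite lact1 entE eE -d'E.
      by rewrite lact2 !entE !zero_lfunE addr0.
    by rewrite homT_inT eE.
  exists z; apply: homs_eq => u; rewrite yE -zE phiE.
  have h0 d : val h ((0, d) : M) = 0 by rewrite -eIu homT_eI.
  by rewrite {1}(usplit u) linearD /= h0 addr0.
have x_onto (h : homA M (bimodU P)) : exists z, h = x z.
  have [y0 y0E] := y_onto (phi_map P M h).
  have h1 u : (val h u).1 = val u.1 y0 by rewrite -phi_mapE y0E yE.
  have [phi phiE] : exists phi : 'Hom(homs (tsrc t) I, I),
      forall d, phi d = (val h ((0, d) : M)).2.
    apply: lfun_exists => c d d'.
    have -> : ((0, c *: d + d') : M) = c *: ((0, d) : M) + ((0, d') : M).
      by congr pair; rewrite /= scaler0 addr0.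
    by rewrite linearP.
  have [c d d' c_hom d'E|z zE] := cogenerator_reflexive cogI (phi := phi).
    rewrite !phiE; have [e eE] := mem_homv c_hom.
    have -> : ((0, d') : M) = lact (inI P e) ((0, d) : M).
      apply: psi_eq => z; first by rewrite lact1 !entE !zero_lfunE.
      by rewrite lact2 !entE eE /= !zero_lfunE add0r -d'E.
    by rewrite homU_inI eE.
  have h2 u : (val h u).2 = val u.2 z.
    have h0 d : (val h ((d, 0) : M)).2 = 0 by rewrite -eTu homU_eT.
    by rewrite -zE phiE {1}(usplit u) linearD /= h0 add0r.
  exists z; apply: homs_eq => u; rewrite xE [LHS]surjective_pairing h1 h2.
  suff -> : y0 = tmap t z by [].
  apply: y_inj; apply: homs_eq => v; rewrite !yE.
  apply: (cogenerated_eq (@cogI T)) => g.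
  by have := h2 (lact (inTI P g) v); rewrite homU_inTI lact2 !entE h1 zero_lfunE addr0.
have x_bij : bijective x by apply/bij_lfunP; split; [exact: x_inj | exact: onto_limg].
have y_bij : bijective y by apply/bij_lfunP; split; [exact: y_inj | exact: onto_limg].
exists x, y; split=> //; split=> //; apply/lfunP => z; apply: homs_eq => u.
by rewrite !comp_lfunE phi_mapE yE xE.
Qed.

End Reflexivity.
Section Splitting.
Variables (k : fieldType) (A B : falgType k) (T I : rmod A) (P : endo_pair B T I).
Hypotheses (hA : hereditary A) (hT : tilting T).
Hypotheses (hI : injective_mod I) (cogI : forall M : rmod A, cogenerated M I).
Implicit Types (M N : rmod B^c) (b : B) (a : A) (t : triple A).

Let TT : ext_vanish T T. Proof. by case: hT => _ /ext1_vanish. Qed.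

Lemma injective_vanish : ext_vanish I I.
Proof.
move=> d d_coc; case: (d_coc) => d_linl d_linr d_M.
have [n [p p_surj]] := free_cover I.
have [K [j [j_injh img_j]]] := submodule_ex (lker_submod p_surj.1).
have ex : short_exact j p by [].
apply: (vanish_quotient ex) d_coc; first exact: projective_vanish (@free_projective _ _ n).
move=> g g_hom; have [h [h_hom hE]] := hI j_injh g_hom.
by exists h; split=> // x; rewrite hE comp_lfunE.
Qed.

(** The first condition says that the action of B factors through its quotient
    End (T). *)
Definition exceptional M : Prop :=
  (forall b m, cc P b = 0 -> lact b (m : M) = 0) /\ is_zero (homA M (bimodT P)).

(** Hom_B (M, T) is the kernel of a map between powers of T, hence a submodule of such a
    power. *)
Lemma to_triple_vanish M : ext_vanish (ttgt (to_triple P M)) T.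
Proof.
have [W [op [ev [_ _ pair _]]]] := pairing_T P M.
have [a [b [phi [eps [mu pres]]]]] := left_presentation_ex pair.
exact: presented_vanish pres hA TT.
Qed.

(** The canonical map eta from M to to_module (to_triple M) is onto, and its kernel has
    a complement: the elements whose component in the corner of T lies in the subspace
    given by presented_splitting. For an indecomposable M either the kernel is zero and
    eta an isomorphism, or the complement is zero; the latter contains the corner of I,
    which is how the action of B then factors through End (T). *)
Lemma to_module_to_triple M : indecomposable M ->
  isom M (to_module P (to_triple P M)) \/ exceptional M.
Proof.
move=> M_ind.
have [W [op [ev [WP opE pair evE]]]] := pairing_T P M.
have [a [b [phi [eps [mu pres]]]]] := left_presentation_ex pair.
have [W' [op' [ev' [W'P pair' ev'E]]]] := pairing_I P cogI M.
have [a' [b' [phi' [eps' [mu' pres']]]]] := left_presentation_ex pair'.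
have II := injective_vanish.
pose t := to_triple P M; pose Y := homA M (bimodT P); pose X := homA M (bimodU P).
have eTW m : lact (eT P) m \in W by apply/WP; apply: eTK.
have eIW m : lact (eI P) m \in W' by apply/W'P; apply: eIK.
(* eta m is the evaluation at m *)
have [eta etaE] : exists eta : 'Hom(M, to_module P t), forall m,
    (forall h : Y, val (eta m).1 h = val h m) /\ (forall h : X, val (eta m).2 h = (val h m).2).
  have ex m : exists u : to_module P t,
      (forall h : Y, val u.1 h = val h m) /\ (forall h : X, val u.2 h = (val h m).2).
    have [c h h'|h c|f [f_hom fE]] := @hom_exists _ _ Y T (fun h => val h m).
    - by rewrite linearP /= lfunDZ.
    - by rewrite homAE.
    have [c h h'|h c|f' [f'_hom f'E]] := @hom_exists _ _ X I (fun h => (val h m).2).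
    - by rewrite linearP /= lfunDZ.
    - by rewrite homAE.
    have [u1 u1E] := @mem_homv _ _ (ttgt t) T f f_hom.
    have [u2 u2E] := @mem_homv _ _ (tsrc t) I f' f'_hom.
    by exists (u1, u2); split=> h; rewrite /= ?u1E ?u2E ?fE ?f'E.
  have [f fE] := choice_fun ex.
  have [g gE] : exists g : 'Hom(M, to_module P t), forall m, g m = f m.
    apply: lfun_exists => c m m'; apply: psi_eq => h.
      by rewrite (fE _).1 linearP /= lfunDZ !(fE _).1.
    by rewrite (fE _).2 linearP /= lfunDZ !(fE _).2.
  by exists g => m; rewrite gE.
have eta1 m (h : Y) : val (eta m).1 h = val h m := (etaE m).1 h.
have eta2 m (h : X) : val (eta m).2 h = (val h m).2 := (etaE m).2 h.
have eta_hom : is_hom eta.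
  move=> m c; apply: psi_eq => h.
    by rewrite eta1 (psi_act1E P (eta m)) eta1; apply: (homA_lact h (c : B) m).
  rewrite eta2 (psi_act2E P (eta m)) eta1 eta2 (homA_lact h (c : B) m) leftU_actE /=.
  by rewrite phi_mapE.
have eta_onto : limg eta = fullv.
  apply: onto_limg => u.
  have [w wE] := presented_hom_ev pres hA TT (subvs_hom u.1).
  have [w' w'E] := presented_hom_ev pres' hA II (subvs_hom u.2).
  have wK : lact (eT P) (val w) = val w by apply/WP/subvsP.
  have w'K : lact (eI P) (val w') = val w' by apply/W'P/subvsP.
  exists (val w + val w'); apply: psi_eq => h.
    by rewrite eta1 linearD /= -w'K homT_eI addr0 -evE -wE.
  by rewrite eta2 linearD /= -wK homU_eT add0r -ev'E -w'E.
have [S [S_op S0 S_full]] := presented_splitting pres hA TT.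
have [U UP] : exists U : {vspace M}, forall m, m \in U <->
    exists2 s, s \in S & lact (eT P) m = val s.
  apply: vspace_ex; first by exists 0; rewrite ?mem0v // lact0.
  move=> c x y [s sS xE] [s' s'S yE]; exists (c *: s + s'); first by rewrite memvD ?memvZ.
  by rewrite lactDr lactZ xE yE.
have U_sub : submod U.
  move=> m c /UP[s sS mE]; apply/UP.
  have [e eE] := mem_homv (cc_hom P (c : B)).
  exists (op e s); first exact: S_op.
  by rewrite opE -mE -[act m c]/(lact (c : B) m) -!lactM (eT_mul eE).
have UN0 : (U :&: lker eta = 0)%VS.
  apply: vspace_eq0 => m /memv_capP[/UP[s sS mE]]; rewrite memv_ker => /eqP m0.
  have h0 (h : Y) : val h m = 0 by rewrite -eta1 m0 /= zero_lfunE.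
  have h20 (h : X) : (val h m).2 = 0 by rewrite -eta2 m0 /= zero_lfunE.
  have s0 : s = 0 by apply: (S0 _ sS) => h; rewrite evE -mE homT_eT h0.
  have e0 : Subvs (eIW m) = 0.
    by apply: (presented_faithful pres' hI) => h; rewrite ev'E /= homU_eI h20.
  have eI0 : lact (eI P) m = 0 := congr1 (@vsval _ _ _) e0.
  by rewrite (eTI_split P m) mE s0 eI0 addr0.
have UNT : (U + lker eta)%VS = fullv.
  apply: vspace_full => m.
  have [s sS sE] := S_full (Subvs (eTW m)).
  have sK : lact (eT P) (val s) = val s by apply/WP/subvsP.
  apply/memv_addP; exists (m - (lact (eT P) m - val s)).
    apply/UP; exists s => //; rewrite !lactB eTK sK.
    by rewrite opprB addrCA subrr addr0.
  exists (lact (eT P) m - val s); last by rewrite subrK.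
  rewrite memv_ker; apply/eqP.
  apply: (@psi_eq _ _ _ _ t (eta _) 0) => h.
    rewrite eta1 linearB /= zero_lfunE -!evE; apply/eqP; rewrite subr_eq0 -sE evE.
    by rewrite /=.
  by rewrite eta2 linearB /= -sK !homU_eT subrr zero_lfunE.
case: (indec_submod M_ind U_sub (lker_submod eta_hom) UN0 UNT) => [U0|ker0]; last first.
  by left; exists eta; split=> //; apply/bij_lfunP; split=> //; apply/lker0_inj.
right.
have kerT : lker eta = fullv by rewrite -UNT U0 add0v.
have eI0 (m : M) : lact (eI P) m = 0.
  have: lact (eI P) m \in U.
    by apply/UP; exists 0; rewrite ?mem0v // -lactM eT_eI lact0l.
  by rewrite U0 memv0 => /eqP.
split=> [c m c0|h].
  rewrite (eTI_split P (lact c m)) eI0 addr0 -lactM.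
  by rewrite (eT_mul (c := 0)) ?c0 // (linear_fun0 (inT_linear P)) mul0r lact0l.
apply: homs_eq => m; rewrite -eta1.
have := memvf m; rewrite -kerT memv_ker => /eqP ->.
by rewrite /= !zero_lfunE.
Qed.

End Splitting.
(** * Exceptional modules are first extension groups *)

Section ExtModules.
Variables (k : fieldType) (A B : falgType k) (T I : rmod A) (P : endo_pair B T I).
Implicit Types (M N : rmod B^c) (C X Y : rmod A) (b : B) (a : A).

(** M is the left module Ext^1 (C, T), presented as the quotient of the space Z of
    all cocycles by the coboundaries. *)
Record ext_module C M (Z : {vspace 'Hom(C, 'Hom(A, T))}) (w : 'Hom(subvs_of Z, M)) : Prop :=
  ExtModule {
    ext_mem : forall d, d \in Z <-> cocycle (fun y a => d y a);
    ext_ker : forall z, w z = 0 <-> coboundary (fun y a => val z y a);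
    ext_lact : forall b (z z' : subvs_of Z), (forall y a, val z' y a = cc P b (val z y a)) ->
      w z' = lact b (w z);
    ext_onto : forall m, exists z, m = w z
  }.

Definition is_ext C M : Prop := exists Z w, @ext_module C M Z w.

Lemma cocycle_lfun C (d : C -> A -> T) : cocycle d ->
  exists D : 'Hom(C, 'Hom(A, T)), forall y a, D y a = d y a.
Proof.
by case=> d_linl d_linr _; apply: bilinear_lfun.
Qed.

Lemma cocycle_ext C (d d' : C -> A -> T) : (forall y a, d y a = d' y a) ->
  cocycle d -> cocycle d'.
Proof.
move=> e [d_linl d_linr d_M]; split=> [a c x y|y c a b|y a b].
- by rewrite -!e d_linl.
- by rewrite -!e d_linr.
by rewrite -!e d_M.
Qed.

Lemma cocycle_space C : exists Z : {vspace 'Hom(C, 'Hom(A, T))},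
  forall d, d \in Z <-> cocycle (fun y a => d y a).
Proof.
apply: vspace_ex => [|c d d' [_ _ dM] [_ _ d'M]]; split=> [a l x y|y l a b|y a b].
- by rewrite linearP /= lfunDZ.
- by rewrite linearP.
- by rewrite !zero_lfunE act0l addr0.
- by rewrite !linearP /= lfunDZ.
- by rewrite linearP.
rewrite !(add_lfunE, scale_lfunE) dM d'M scalerDr.
by rewrite actDl actZl addrACA.
Qed.

Lemma ext_scale C M Z (w : 'Hom(subvs_of Z, M)) : @ext_module C M Z w ->
  forall b (z : subvs_of Z), exists z' : subvs_of Z,
    forall y a, val z' y a = cc P b (val z y a).
Proof.
move=> wP b z; have cz : cocycle (fun y a => cc P b (val z y a)).
  have /(ext_mem wP) := subvsP z.
  move/(cocycle_comp (@hom_id _ _ C) (cc_hom P b)); apply: cocycle_ext => y a.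
  by rewrite id_lfunE.
have [D DE] := cocycle_lfun cz.
have DZ : D \in Z by apply/(ext_mem wP); apply: cocycle_ext cz => y a; rewrite DE.
by exists (Subvs DZ) => y a; rewrite /= DE.
Qed.

(** Pulling cocycles back along r makes Ext^1 (C', T) a direct summand of M. It is the
    image of w', so that M is Ext^1 (C', T) itself as soon as w' is onto. *)
Lemma ext_retract C C' M Z (w : 'Hom(subvs_of Z, M)) (i : 'Hom(C', C)) (r : 'Hom(C, C')) :
    @ext_module C M Z w -> is_hom i -> is_hom r -> (forall y, r (i y) = y) ->
  exists (Z' : {vspace 'Hom(C', 'Hom(A, T))}) (w' : 'Hom(subvs_of Z', M)),
  [/\ forall (z' : subvs_of Z') (z : subvs_of Z),
         (forall y a, val z y a = val z' (r y) a) -> w' z' = w z,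
      forall z : subvs_of Z, exists z' : subvs_of Z', forall y a, val z' y a = val z (i y) a,
      forall z' : subvs_of Z', exists z : subvs_of Z, forall y a, val z y a = val z' (r y) a,
      submod (limg w') & (forall m, exists z', m = w' z') -> ext_module w'].
Proof.
move=> wP i_hom r_hom rK; have [Zmem Zker Zlact _] := wP.
have [Z' Z'mem] := cocycle_space C'.
have pull (z' : subvs_of Z') : exists z : subvs_of Z, forall y a, val z y a = val z' (r y) a.
  have z'r : (val z' \o r)%VF \in Z.
    apply/Zmem; apply: (@cocycle_ext _ (fun y a => val z' (r y) a)).
      by move=> y a; rewrite comp_lfunE.
    by apply: (cocycle_compl (d := fun y a => val z' y a)) => //; apply/Z'mem/subvsP.
  by exists (Subvs z'r) => y a; rewrite /= comp_lfunE.
have restrict (z : subvs_of Z) : exists z' : subvs_of Z', forall y a, val z' y a = val z (i y) a.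
  have zi : (val z \o i)%VF \in Z'.
    apply/Z'mem; apply: (@cocycle_ext _ (fun y a => val z (i y) a)).
      by move=> y a; rewrite comp_lfunE.
    by apply: (cocycle_compl (d := fun y a => val z y a)) => //; apply/Zmem/subvsP.
  by exists (Subvs zi) => y a; rewrite /= comp_lfunE.
have [f fE] := choice_fun pull.
have [w' w'E] : exists w' : 'Hom(subvs_of Z', M), forall z', w' z' = w (f z').
  apply: lfun_exists => c z z'; rewrite -linearP; congr (w _); apply: val_inj.
  apply/lfunP => y; apply/lfunP => a.
  by rewrite linearP /= fE linearP /= !(add_lfunE, scale_lfunE) -!fE.
have w'P (z' : subvs_of Z') (z : subvs_of Z) :
    (forall y a, val z y a = val z' (r y) a) -> w' z' = w z.
  move=> zE; rewrite w'E; congr (w _); apply: homs_eq => y.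
  by apply/lfunP => a; rewrite fE zE.
exists Z', w'; split=> // [m b /memv_imgP[z' _ ->]|onto].
  have [z zE] := ext_scale wP b (f z'); rewrite w'E -[act _ _](ext_lact wP zE).
  have [z'' z''E] := restrict z.
  rewrite -(w'P z'' z) ?memv_img ?memvf // => y a.
  by rewrite z''E !zE !fE rK.
split=> // [z'|b z z' z'E]; rewrite !w'E.
  split=> [/Zker[s sE]|[s sE]].
    exists (s \o i)%VF => y a; rewrite !comp_lfunE i_hom -sE fE.
    by rewrite rK.
  apply/Zker; exists (s \o r)%VF => y a.
  by rewrite fE sE !comp_lfunE r_hom.
by apply: Zlact => y a; rewrite !fE.
Qed.

Lemma is_ext_isom C C' M : isom C C' -> is_ext C M -> is_ext C' M.
Proof.
case/isomP => f [f' [f_hom f'_hom fK f'K]] [Z [w wP]].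
have [Z' [w' [w'E Z'ex _ _ w'P]]] := ext_retract wP f'_hom f_hom f'K.
exists Z', w'; apply: w'P => m; have [z ->] := ext_onto wP m.
have [z' z'E] := Z'ex z; exists z'; symmetry; apply: w'E => y a.
by rewrite z'E fK.
Qed.

Lemma is_ext_unique C M M' : is_ext C M -> is_ext C M' -> isom M M'.
Proof.
case=> [Z [w wP]] [Z' [w' w'P]].
have eqZ : Z = Z'.
  by apply/vspaceP => d; apply/idP/idP => [/(ext_mem wP)/(ext_mem w'P)|/(ext_mem w'P)/(ext_mem wP)].
case: Z' / eqZ w' w'P => w' w'P.
pose f := (w' \o w^-1)%VF.
have fE z : f (w z) = w' z.
  by rewrite comp_lfunE comp_inv_lfun // => {}z /(ext_ker wP)/(ext_ker w'P).
exists f; split=> [m b|].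
  have [z ->] := ext_onto wP m; rewrite fE.
  have [z' zE] := ext_scale wP b z.
  have e := ext_lact wP zE; have e' := ext_lact w'P zE.
  by rewrite -[act (w z) b]e fE e'.
apply/bij_lfunP; split.
  apply/lker0_inj/lker_eq0 => m; have [z ->] := ext_onto wP m.
  by rewrite fE => /(ext_ker w'P)/(ext_ker wP).
by apply: onto_limg => m'; have [z ->] := ext_onto w'P m'; exists (w z); rewrite fE.
Qed.

(** The classes of the cocycles pulled back from X and from Y form complementary
    submodules of M. *)
Lemma is_ext_dsum X Y M : indecomposable M -> is_ext (dsum X Y) M -> is_ext X M \/ is_ext Y M.
Proof.
move=> M_ind [Z [w wP]].
have [i [i_hom iE]] := hom_inl X Y; have [j [j_hom jE]] := hom_inr X Y.
have [p [p_hom pE]] := hom_fst X Y; have [q [q_hom qE]] := hom_snd X Y.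
have pK x : p (i x) = x by rewrite pE iE.
have qK x : q (j x) = x by rewrite qE jE.
have qi x : q (i x) = 0 by rewrite qE iE.
have ijE u : u = i (p u) + j (q u) by rewrite iE jE pE qE -dsum_split.
have [Z1 [w1 [w1E Z1res Z1pull sub1 w1P]]] := ext_retract wP i_hom p_hom pK.
have [Z2 [w2 [w2E Z2res Z2pull sub2 w2P]]] := ext_retract wP j_hom q_hom qK.
have cap : (limg w1 :&: limg w2 = 0)%VS.
  apply: vspace_eq0 => m /memv_capP[/limgP[z1 ->] /limgP[z2 e]].
  have [u1 u1E] := Z1pull z1; have [u2 u2E] := Z2pull z2.
  move: e; rewrite (w1E _ _ u1E) (w2E _ _ u2E) => /eqP; rewrite -subr_eq0 -linearB /=.
  move=> /eqP/(ext_ker wP)[s sE]; apply/(ext_ker wP).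
  exists (s \o i \o p)%VF => y a; rewrite !comp_lfunE p_hom i_hom -sE.
  rewrite linearB /= !(add_lfunE, opp_lfunE) u2E qi linear0 zero_lfunE subr0 !u1E.
  by rewrite pK.
have full : (limg w1 + limg w2 = fullv)%VS.
  apply: vspace_full => m; have [z ->] := ext_onto wP m.
  have [z1 z1E] := Z1res z; have [z2 z2E] := Z2res z.
  apply/memv_addP; exists (w1 z1); rewrite ?memv_img ?memvf //.
  exists (w2 z2); rewrite ?memv_img ?memvf //.
  have [u1 u1E] := Z1pull z1; have [u2 u2E] := Z2pull z2.
  rewrite (w1E _ _ u1E) (w2E _ _ u2E) -linearD; congr (w _); apply: val_inj.
  apply/lfunP => y; apply/lfunP => a.
  rewrite linearD /= !add_lfunE u1E u2E z1E z2E -add_lfunE -linearD.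
  by rewrite -ijE.
case: (indec_submod M_ind sub1 sub2 cap full) => w0.
  by right; exists Z2, w2; apply: w2P => m; apply: limg_full; rewrite -full w0 add0v.
by left; exists Z1, w1; apply: w1P => m; apply: limg_full; rewrite -full w0 addv0.
Qed.

Lemma is_ext_indecomposable C M : indecomposable M -> is_ext C M ->
  exists C', indecomposable C' /\ is_ext C' M.
Proof.
move=> M_ind; have [n] := ubnP (\dim {:C}); elim: n C => // n IH C; rewrite ltnS => leCn CM.
case: (indec_cases C) => [C0|C_ind|[X [Y [CXY _ _ ltX ltY]]]]; last 1 first.
- by case: (is_ext_dsum M_ind (is_ext_isom CXY CM)); apply: IH; apply: leq_trans leCn.
- case: M_ind => nzM _; case: nzM => m; case: CM => Z [w wP].
  have [z ->] := ext_onto wP m; apply/(ext_ker wP); exists 0 => y a.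
  by rewrite (C0 y) linear0 !zero_lfunE act0l subr0.
by exists C.
Qed.

(** The module Ext^1 (C, T) only depends on the isomorphism class of C, and if it is
    indecomposable then C may be replaced by one of its indecomposable summands. *)
Lemma ext_finite (Q : rmod B^c -> Prop) : representation_finite A ->
    (forall M, Q M -> exists C, is_ext C M) ->
  exists n (S : 'I_n -> rmod B^c), forall M, indecomposable M -> Q M -> exists i, isom M (S i).
Proof.
move=> [n [S SP]] Q_ext.
have ex i : exists M, forall N, is_ext (S i) N -> isom N M.
  case: (classic (exists M, is_ext (S i) M)) => [[M SM]|noM].
    by exists M => N SN; apply: is_ext_unique SN SM.
  by exists (zero_mod _) => N SN; case: noM; exists N.
have [R RP] := choice_fun ex; exists n, R => M M_ind /Q_ext[C CM].
have [C' [C'_ind C'M]] := is_ext_indecomposable M_ind CM.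
have [i C'S] := SP C' C'_ind; exists i; apply: RP.
exact: is_ext_isom C'S C'M.
Qed.

End ExtModules.

(** A presentation of M over End (T) shows M as the cokernel of the map
    Hom (T^b, T) -> Hom (T^a, T) induced by some phi : T^a -> T^b. The kernel of phi is
    Hom (M, T) = 0, so that this cokernel is Ext^1 (T^b / T^a, T). *)
Lemma exceptional_ext (k : fieldType) (A B : falgType k) (T I : rmod A)
    (P : endo_pair B T I) (M : rmod B^c) :
  tilting T -> exceptional P M -> exists C, is_ext P C M.
Proof.
move=> [_ /ext1_vanish TT _] [M0 hom0].
have cc_lact b b' (m : M) : cc P b = cc P b' -> lact b m = lact b' m.
  move=> e; apply/eqP; rewrite -subr_eq0 -[lact b' m]scale1r -scaleNr addrC -lactDZ.
  by rewrite M0 // (cc_linear P) e scaleN1r addNr.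
pose ET := homs T T.
have [op opE] : exists op : 'Hom(ET, 'End(M)), forall e m, op e m = lact (inT P e) m.
  apply: bilinear_lfun => [m c e e'|e c m m']; first by rewrite inT_linear lactDZ.
  by rewrite lactDr lactZ.
pose Y := zero_mod A.
have Y0 : is_zero Y := @zero_mod_zero _ A.
have pair : left_pairing op (0 : 'Hom(Y, 'Hom(M, T))).
  split=> [e m e1|e e' e'' m e''E|y e m|y a m|y _|h hE].
  - rewrite opE -[RHS]lact1; apply: cc_lact.
    by rewrite entE e1 (cc_one P).
  - by rewrite !opE (inT_mul P e''E) lactM.
  - by rewrite !zero_lfunE linear0.
  - by rewrite !zero_lfunE act0l.
  - exact: Y0.
  exists 0 => m; rewrite !zero_lfunE.
  have h_hom : @is_hom _ _ M (leftT P) h.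
    move=> x b; have [e eE] := mem_homv (cc_hom P (b : B)).
    rewrite -[RHS]/(cc P b (h x)) -eE -hE opE; congr (h _).
    by apply: cc_lact; rewrite entE.
  have [h' h'E] := mem_homv h_hom; rewrite -h'E.
  by rewrite (hom0 h') /= zero_lfunE.
have [a [b [phi [eps [mu pres]]]]] := left_presentation_ex pair.
have phi_inj : injective phi.
  apply/lker0_inj; rewrite -(eps_phi pres).
  by apply: vspace_eq0 => _ /limgP[y ->]; rewrite (Y0 y) linear0.
have phi_h := phi_hom pres.
have [C [pi [pi_surj ker_pi]]] := quotient_ex (limg_submod phi_h).
have [pi_hom pi_onto] := pi_surj; exists C.
have piphi := exact_comp (esym ker_pi).
have [Z Zmem] := cocycle_space T C.
pose G := homs (pow T a) T.
(* pulled back to T^b, the cocycle z is the coboundary of some r; its class is that of r phi *)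
have ex_r (z : subvs_of Z) : exists r : 'Hom(pow T b, T), forall y c,
    val z (pi y) c = r (act y c) - act (r y) c.
  have /Zmem zc := subvsP z.
  by have [r rE] := pow_vanish (n := b) TT (cocycle_compl pi_hom zc); exists r.
have r_phi (z : subvs_of Z) (r : 'Hom(pow T b, T)) :
    (forall y c, val z (pi y) c = r (act y c) - act (r y) c) -> is_hom (r \o phi)%VF.
  move=> rE x c; apply/eqP; rewrite -subr_eq0 !comp_lfunE phi_h -rE piphi linear0.
  by rewrite zero_lfunE.
have ex_g (z : subvs_of Z) : exists g : G, exists r : 'Hom(pow T b, T),
    (forall y c, val z (pi y) c = r (act y c) - act (r y) c) /\
    forall x, val g x = r (phi x).
  have [r rE] := ex_r z; have [g gE] := mem_homv (r_phi _ _ rE).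
  by exists g, r; split=> // x; rewrite gE comp_lfunE.
have [g gP] := choice_fun ex_g; have [r rP] := choice_fun gP.
have mu_eq (g1 g2 : G) (u : 'Hom(pow T b, T)) : is_hom u ->
    (forall x, val g1 x = val g2 x + u (phi x)) -> mu g1 = mu g2.
  move=> u_hom e; apply/eqP; rewrite -subr_eq0 -linearB /=; apply/eqP.
  apply/(mu_eq0 pres); exists u; split=> // x.
  by rewrite linearB /= sub_lfunE e addrAC subrr add0r.
(* r is unique up to a homomorphism u, and mu kills u phi *)
have g_uniq (z : subvs_of Z) (g' : G) (r' : 'Hom(pow T b, T)) :
    (forall y c, val z (pi y) c = r' (act y c) - act (r' y) c) ->
    (forall x, val g' x = r' (phi x)) -> mu g' = mu (g z).
  move=> r'E g'E; have [rE gE] := rP z.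
  apply: (mu_eq _ _ (r' - r z)) => [y c|x].
    have e1 : r' (act y c) = val z (pi y) c + act (r' y) c by rewrite r'E subrK.
    have e2 : r z (act y c) = val z (pi y) c + act (r z y) c by rewrite rE subrK.
    by rewrite !(add_lfunE, opp_lfunE) e1 e2 actBl opprD addrACA subrr add0r.
  by rewrite !(add_lfunE, opp_lfunE) g'E gE addrCA subrr addr0.
have [w wE] : exists w : 'Hom(subvs_of Z, M), forall z, w z = mu (g z).
  apply: lfun_exists => c z z'; have [rE gE] := rP z; have [rE' gE'] := rP z'.
  rewrite -linearP; symmetry; apply: (g_uniq _ _ (c *: r z + r z')) => [y d|x].
    rewrite linearP /= !(add_lfunE, scale_lfunE) rE rE' actDl actZl scalerBr opprD.
    by rewrite addrACA.
  by rewrite linearP /= !(add_lfunE, scale_lfunE) gE gE'.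
exists Z, w; split=> // [z|b' z z' z'E|m].
- have [rE gE] := rP z; rewrite wE; split=> [/(mu_eq0 pres)[u [u_hom gu]]|[s sE]].
    have ker_ru y : pi y = 0 -> (r z - u) y = 0.
      by move=> /(exact_lift (esym ker_pi))[x ->]; rewrite sub_lfunE -gE gu subrr.
    exists ((r z - u) \o pi^-1)%VF => x c; have [y ->] := limg_full x pi_onto.
    rewrite -pi_hom !comp_lfunE !(comp_inv_lfun ker_ru) !(add_lfunE, opp_lfunE) rE.
    by rewrite u_hom actBl opprB addrA subrK.
  apply/(mu_eq0 pres); exists (r z - (s \o pi)%VF); split=> [y c|x]; last first.
    by rewrite sub_lfunE comp_lfunE piphi linear0 subr0.
  have e1 : r z (act y c) = val z (pi y) c + act (r z y) c by rewrite rE subrK.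
  rewrite !(add_lfunE, opp_lfunE, comp_lfunE) e1 sE pi_hom actBl addrAC.
  by rewrite [X in X + _]addrC addrA addNr add0r addrC.
- rewrite !wE; have [rE gE] := rP z; have [e eE] := mem_homv (cc_hom P b').
  have [g' g'E] := mem_homv (hom_comp (subvs_hom e) (subvs_hom (g z))).
  rewrite -(g_uniq z' g' (val e \o r z)%VF) => [|y c|x].
  - rewrite (mu_op pres (e := e) (g := g z)) => [|x]; last by rewrite g'E comp_lfunE.
    by rewrite opE; apply: cc_lact; rewrite entE.
  - by rewrite z'E rE -eE !comp_lfunE linearB /= (subvs_hom e).
  by rewrite g'E !comp_lfunE gE.
have [g0 ->] := mu_onto pres m.
have /eqP phi_ker : lker phi == 0%VS by apply/lker0P.
pose r0 := (val g0 \o phi^-1)%VF.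
have r0E x : r0 (phi x) = val g0 x by rewrite comp_lfunE lker0_lfunK // phi_ker.
have d_coc : cocycle (fun (y : pow T b) c => r0 (act y c) - act (r0 y) c).
  split=> [c l x y|y l c d|y c d].
  - by rewrite !act_linearl !linearP /= act_linearl scalerBr opprD addrACA.
  - by rewrite !act_linearr linearP /= scalerBr opprD addrACA.
  by rewrite actBl !actA [RHS]addrC addrA subrK.
have [D DE] := cocycle_lfun d_coc.
have ker_D y : pi y = 0 -> D y = 0.
  move=> /(exact_lift (esym ker_pi))[x ->]; apply/lfunP => c.
  rewrite DE -phi_h !r0E (subvs_hom g0) subrr zero_lfunE.
  by [].
have D'E y c : (D \o pi^-1)%VF (pi y) c = r0 (act y c) - act (r0 y) c.
  by rewrite comp_lfunE comp_inv_lfun // DE.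
have D'Z : (D \o pi^-1)%VF \in Z.
  apply/Zmem; split=> [c l x y|y l c d|y c d].
  - by rewrite linearP /= !(add_lfunE, scale_lfunE).
  - by rewrite linearP.
  have [x ->] := limg_full y pi_onto; rewrite -pi_hom !D'E.
  by rewrite actBl !actA [RHS]addrC addrA subrK.
exists (Subvs D'Z); rewrite wE; apply: (g_uniq _ _ r0) => [y c|x].
  by rewrite /= D'E.
by rewrite r0E.
Qed.
(** * Vector space duality of left and right modules *)

Section Duals.
Variables (k : fieldType) (A A' : falgType k) (s : A' -> A).
Hypotheses (s_linear : linear s) (s1 : s 1 = 1) (sM : forall a b, s (a * b) = s b * s a).

Section Dual.
Variable M : rmod A.
Definition dual_along_act (f : 'Hom(M, k^o)) (a : A') : 'Hom(M, k^o) := (f \o ract M (s a))%VF.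
Lemma dual_along_actE f a x : dual_along_act f a x = f (act x (s a)).
Proof. by rewrite comp_lfunE ractE. Qed.
Fact dual_along_linearl a : linear (dual_along_act^~ a).
Proof. by move=> c f g; rewrite /dual_along_act comp_lfunDl -comp_lfunZl. Qed.
Fact dual_along_linearr f : linear (dual_along_act f).
Proof.
move=> c a b; apply/lfunP => x.
by rewrite lfunDZ !dual_along_actE s_linear act_linearr linearP.
Qed.
Fact dual_along_act1 f : dual_along_act f 1 = f.
Proof. by apply/lfunP => x; rewrite dual_along_actE s1 act1. Qed.
Fact dual_along_actA f a b : dual_along_act f (a * b) = dual_along_act (dual_along_act f a) b.
Proof. by apply/lfunP => x; rewrite !dual_along_actE sM actA. Qed.

(** The identity map between A and its opposite algebra is an antihomomorphism in both
    directions, so that this covers the duals of right modules and of left modules. *)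
Definition dual_along : rmod A' := @Rmod _ A' 'Hom(M, k^o) dual_along_act
  dual_along_linearl dual_along_linearr dual_along_act1 dual_along_actA.
End Dual.

Lemma dual_along_isom M N : isom M N -> isom (dual_along M) (dual_along N).
Proof.
case/isomP => f [f' [f_hom f'_hom fK f'K]].
apply: (@isom_can _ _ (dual_along M) (dual_along N) (fun p => p \o f')%VF (fun q => q \o f)%VF).
- by move=> c p q; rewrite comp_lfunDl -comp_lfunZl.
- move=> p a; apply/lfunP => y.
  by rewrite comp_lfunE !dual_along_actE comp_lfunE f'_hom.
- by move=> p; apply/lfunP => x; rewrite !comp_lfunE fK.
by move=> q; apply/lfunP => y; rewrite !comp_lfunE f'K.
Qed.

Lemma dual_along_dsum X Y :
  isom (dual_along (dsum X Y)) (dsum (dual_along X) (dual_along Y)).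
Proof.
have [i [i_hom iE]] := hom_inl X Y; have [j [j_hom jE]] := hom_inr X Y.
have [p [_ pE]] := hom_fst X Y; have [q [_ qE]] := hom_snd X Y.
have ijE u : u = i (p u) + j (q u) by rewrite iE jE pE qE -dsum_split.
apply: (@isom_can _ _ (dual_along (dsum X Y)) (dsum (dual_along X) (dual_along Y))
  (fun f => (f \o i, f \o j)%VF) (fun u => (u.1 \o p)%VF + (u.2 \o q)%VF)).
- by move=> c f g; rewrite !comp_lfunDl -!comp_lfunZl.
- move=> f a; congr pair; apply/lfunP => x; rewrite comp_lfunE !dual_along_actE comp_lfunE.
    by rewrite i_hom.
  by rewrite j_hom.
- by move=> f; apply/lfunP => u; rewrite add_lfunE !comp_lfunE /= -linearD -ijE.
case=> f g; congr pair; apply/lfunP => x; rewrite comp_lfunE add_lfunE !comp_lfunE /=.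
  by rewrite pE qE iE /= linear0 addr0.
by rewrite pE qE jE /= linear0 add0r.
Qed.

Lemma dual_along_zero M : is_zero (dual_along M) -> is_zero M.
Proof.
move=> D0 x; apply: NNPP => /functional_sep0[f]; case.
by rewrite (D0 f) zero_lfunE.
Qed.

End Duals.

Lemma bidual_ev (k : fieldType) (V : vectType k) (f : 'Hom('Hom(V, k^o), k^o)) :
  exists x, forall p, f p = p x.
Proof.
pose e := vbasis {:V}.
have ex i : exists c : 'Hom(V, k^o), forall x, c x = coord e i x.
  by apply: lfun_exists => a u v; rewrite linearP.
have [c cE] := choice_fun ex.
exists (\sum_(i < \dim {:V}) (f (c i) : k) *: e`_i) => p; rewrite linear_sum.
have pE : p = \sum_(i < \dim {:V}) (p e`_i : k) *: c i.
  apply/lfunP => x; rewrite {1}(coord_vbasis (memvf x)) linear_sum sum_lfunE.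
  by apply: eq_bigr => i _; rewrite linearZ /= scale_lfunE cE [LHS]mulrC.
rewrite {1}pE linear_sum; apply: eq_bigr => i _.
by rewrite !linearZ /= [LHS]mulrC.
Qed.

Section Bidual.
Variables (k : fieldType) (A A' : falgType k) (s : A' -> A) (s' : A -> A').
Hypotheses (s_linear : linear s) (s1 : s 1 = 1) (sM : forall a b, s (a * b) = s b * s a).
Hypotheses (s'_linear : linear s') (s'1 : s' 1 = 1)
  (s'M : forall a b, s' (a * b) = s' b * s' a).
Hypothesis sK : cancel s' s.

Lemma bidual_isom (M : rmod A) :
  isom M (dual_along s'_linear s'1 s'M (dual_along s_linear s1 sM M)).
Proof.
set D := dual_along _ _ _ M; set DD := dual_along _ _ _ D.
have [f fE] : exists f : 'Hom(M, DD), forall x p, (f x : 'Hom('Hom(M, k^o), k^o)) p = p x.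
  apply: bilinear_lfun => [p c x y|x c p q]; first by rewrite linearP.
  by rewrite lfunDZ.
exists f; split=> [x a|].
  apply/lfunP => p; rewrite fE; rewrite -[RHS]/(dual_along_act _ _ _ _) dual_along_actE fE.
  by rewrite -[RHS]/(dual_along_act _ _ _ _) dual_along_actE sK.
apply/bij_lfunP; split=> [x y xy|].
  by apply: functional_eq => p; rewrite -!fE xy.
apply: onto_limg => g; have [x xE] := bidual_ev g; exists x.
by apply/lfunP => p; rewrite fE xE.
Qed.

Lemma dual_along_indecomposable (M : rmod A) :
  indecomposable M -> indecomposable (dual_along s_linear s1 sM M).
Proof.
move=> [nzM dec]; split; first by move/dual_along_zero.
move=> X Y /(dual_along_isom s'_linear s'1 s'M)/(isom_trans (bidual_isom M)) MXY.
have := isom_trans MXY (dual_along_dsum s'_linear s'1 s'M X Y).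
by move/dec => [/dual_along_zero|/dual_along_zero] ?; [left | right].
Qed.

Lemma representation_finite_anti : representation_finite A' -> representation_finite A.
Proof.
case=> n [S SP]; exists n, (fun i => dual_along s'_linear s'1 s'M (S i)) => M M_ind.
have [i MS] := SP _ (dual_along_indecomposable M_ind); exists i.
exact: isom_trans (bidual_isom M) (dual_along_isom _ _ _ MS).
Qed.

End Bidual.

Lemma representation_finite_opp (k : fieldType) (B : falgType k) :
  representation_finite B <-> representation_finite B^c.
Proof.
pose s : B^c -> B := id; pose s' : B -> B^c := id.
have s_lin : linear s by []. have s'_lin : linear s' by [].
have sM a b : s (a * b) = s b * s a by [].
have s'M a b : s' (a * b) = s' b * s' a by [].
split; first exact: (@representation_finite_anti _ _ _ s' s).
exact: (@representation_finite_anti _ _ _ s s').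
Qed.
(** * Inverse translates of torsion-free modules *)

Section Star.
Variables (k : fieldType) (A : falgType k).

Lemma star_actE (P : rmod A^c) (g : star P) (a : A) x :
  val (act g a : star P) x = @GRing.mul A (val g x) a.
Proof. by rewrite comp_lfunE rmulAE. Qed.

Lemma regc_actE (x : regular A^c) (a : A^c) : act x a = @GRing.mul A a x.
Proof. by []. Qed.

(** A homomorphism g is determined by its values at the generators x i; these are its
    coordinates with respect to the xi i. *)
Lemma star_expand (P : rmod A^c) n (x : 'I_n -> P) (xi : 'I_n -> 'Hom(P, regular A^c)) :
    dual_basis x xi -> exists h : 'I_n -> star P, (forall i, val (h i) = xi i) /\
  forall g : star P, g = \sum_i act (h i) (val g (x i) : A).
Proof.
move=> [xi_hom xE]; have [h hE] : exists h : 'I_n -> star P, forall i, val (h i) = xi i.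
  exact: choice_fun (fun i => mem_homv (xi_hom i)).
exists h; split=> // g; apply: homs_eq => p.
rewrite {1}(xE p) !linear_sum /= sum_lfunE; apply: eq_bigr => i _.
by rewrite (subvs_hom g) regc_actE -[RHS]/(val (act (h i) (val g (x i))) p) star_actE hE.
Qed.

Lemma star_projective (P : rmod A^c) : projective P -> projective (star P).
Proof.
move=> /projective_dual_basis[n [x [xi xP]]]; apply: dual_basis_projective.
have [h [hE gE]] := star_expand xP.
have ex i : exists f : 'Hom(star P, regular A), is_hom f /\ forall g : star P, f g = val g (x i).
  apply: (@hom_exists _ _ (star P) (regular A) (fun g => val g (x i))) => [c g g'|g a].
    by rewrite linearP /= lfunDZ.
  exact: star_actE.
have [f fP] := choice_fun ex.
exists n, h, f; split=> [i|g]; first by case: (fP i).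
by rewrite {1}(gE g); apply: eq_bigr => i _; rewrite (fP i).2.
Qed.

Lemma star_map (P Q : rmod A^c) (d : 'Hom(P, Q)) : is_hom d ->
  exists f : 'Hom(star Q, star P), is_hom f /\ forall h x, val (f h) x = val h (d x).
Proof.
move=> d_hom; have [f0 f0E] := homv_precomp (regular A^c) d_hom.
pose f : 'Hom(star Q, star P) := f0.
have fE (h : star Q) x : val (f h) x = val h (d x) by apply: f0E.
exists f; split=> // h a; apply: homs_eq => x.
by rewrite fE !star_actE fE.
Qed.

Variables (T F : rmod A).

Lemma star_ev (P : rmod A^c) (t : T) (p : P) : exists e : 'Hom(star P, T), is_hom e /\
  forall h, e h = act t (val h p : A).
Proof.
apply: (@hom_exists _ _ (star P) T (fun h => act t (val h p : A))) => [c h h'|h a].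
  by rewrite linearP /= lfunDZ act_linearr.
by rewrite star_actE actA.
Qed.

(** For a projective left module P the maps star P -> T are the elements of
    T (x) P. Hence the cokernel of Hom (star P1, T) -> Hom (star P0, T) is T (x) D F,
    whose dual is Hom (T, F) = 0. *)
Lemma star_extend (P1 P0 : rmod A^c) (d : 'Hom(P1, P0)) (p : 'Hom(P0, dual F))
    (dstar : 'Hom(star P0, star P1)) (r : 'Hom(star P0, T)) :
    torsion_free T F -> projective P0 -> is_hom d -> surjhom p -> limg d = lker p ->
    (forall h x, val (dstar h) x = val h (d x)) -> is_hom dstar -> is_hom r ->
  exists v : 'Hom(star P1, T), is_hom v /\ forall h, r h = v (dstar h).
Proof.
move=> TF P0_proj d_hom [p_hom p_onto] dp dstarE dstar_hom r_hom.
have [V VP] : exists V : {vspace 'Hom(star P0, T)}, forall f, f \in V <->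
    exists v : 'Hom(star P1, T), is_hom v /\ f = (v \o dstar)%VF.
  apply: vspace_ex => [|c f g [v [v_hom ->]] [u [u_hom ->]]].
    by exists 0; split; [apply: hom_zero | rewrite comp_lfun0l].
  exists (c *: v + u); split; last by rewrite comp_lfunDl comp_lfunZl.
  by apply: hom_add => // x a; rewrite !scale_lfunE v_hom actZl.
suff /VP[v [v_hom ->]] : r \in V by exists v; split=> // h; rewrite comp_lfunE.
apply: contraT => /functional_sep[chi [chiV []]].
have [e eP] := choice_fun (fun u : T * P0 => star_ev u.1 u.2).
pose chi_at t y : k^o := chi (e (t, y)).
have lin_t y : linear (chi_at^~ y).
  move=> c t t'; rewrite /chi_at -linearP; congr (chi _); apply/lfunP => h.
  by rewrite lfunDZ !(eP _).2 /= act_linearl.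
have lin_y t : linear (chi_at t).
  move=> c y y'; rewrite /chi_at -linearP; congr (chi _); apply/lfunP => h.
  by rewrite lfunDZ !(eP _).2 /= linearP act_linearr.
have ex_x t : exists x : F, forall y, (p y : 'Hom(F, k^o)) x = chi_at t y.
  have [ct ctE] : exists ct : 'Hom(P0, k^o), forall y, ct y = chi_at t y by apply: lfun_exists.
  have ker_pc z' : p z' = 0 -> ct z' = 0.
    move=> /(exact_lift dp)[z ->]; rewrite ctE; apply: chiV; apply/VP.
    have [e' [e'_hom e'E]] := star_ev t z.
    by exists e'; split=> //; apply/lfunP => h; rewrite comp_lfunE e'E (eP _).2 dstarE.
  have [x xE] := bidual_ev (ct \o p^-1 : 'Hom('Hom(F, k^o), k^o))%VF.
  by exists x => y; rewrite -xE comp_lfunE comp_inv_lfun // ctE.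
have [x xE] := choice_fun ex_x.
have x_uniq (z z' : F) : (forall y, (p y : 'Hom(F, k^o)) z = (p y : 'Hom(F, k^o)) z') -> z = z'.
  by move=> zz'; apply: functional_eq => f; have [y ->] := limg_full (f : dual F) p_onto.
have [c t t'|t a|g [g_hom gE]] := @hom_exists _ _ T F x.
- by apply: x_uniq => y; rewrite linearP /= !xE lin_t.
- apply: x_uniq => y; rewrite xE.
  transitivity ((p (act y (a : A^c)) : 'Hom(F, k^o)) (x t)); last first.
    by rewrite p_hom comp_lfunE ractE.
  rewrite xE; congr (chi _); apply/lfunP => h.
  by rewrite !(eP _).2 /= (subvs_hom h) regc_actE actA.
have g0 : g = 0.
  by move/homvP: g_hom; rewrite TF memv0 => /eqP.
have chi0 t y : chi_at t y = 0 by rewrite -xE -gE g0 zero_lfunE linear0.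
have [n [z [zi zP]]] := projective_dual_basis P0_proj.
have [h [_ hE]] := star_expand zP.
have -> : r = \sum_i e (r (h i), z i).
  apply/lfunP => g'; rewrite {1}(hE g') linear_sum sum_lfunE; apply: eq_bigr => i _.
  by rewrite /= r_hom (eP _).2.
by rewrite linear_sum big1 // => i _; apply: chi0.
Qed.

Lemma tauinv_vanish (X : rmod A) : torsion_free T F -> is_tauinv F X -> ext_vanish X T.
Proof.
move=> TF [P1 [P0 [d [p [[P1_proj P0_proj d_hom p_surj [dp _ _]] [q [q_surj qE]]]]]]].
have [dstar [dstar_hom dstarE]] := star_map d_hom.
have [K [j [j_injh img_j]]] := submodule_ex (lker_submod q_surj.1).
have ex : short_exact j q by [].
apply: (vanish_quotient ex); first exact: projective_vanish (star_projective P1_proj).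
move=> g g_hom.
have q_dstar h : q (dstar h) = 0.
  by apply/qE; exists h; apply/lfunP => z; rewrite comp_lfunE dstarE.
have [h|u [u_hom uE]] := hom_corestrict j_injh dstar_hom.
  exact: exact_lift img_j _ (q_dstar h).
have [v [v_hom vE]] := star_extend TF P0_proj d_hom p_surj dp dstarE dstar_hom
  (hom_comp g_hom u_hom).
exists v; split=> // x.
have /qE[h hE] := exact_comp img_j x.
have jx : j x = dstar h.
  apply: homs_eq => z; rewrite dstarE.
  by have /lfunP/(_ z) := hE; rewrite comp_lfunE.
rewrite jx -vE comp_lfunE; congr (g _).
by case: j_injh => _ /lker0_inj; apply; rewrite uE jx.
Qed.

End Star.

Section Costar.
Variables (k : fieldType) (A : falgType k) (Q : rmod A).

Fact opp2_mul (x : Q) (a b : A^c^c) : act x (a * b : A^c^c) = act (act x a) b.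
Proof. exact: (@actA _ _ Q x a b). Qed.

(** The algebras A and A^c^c have the same elements and products, but are different
    structures; with this change of structure, star also dualizes right A-modules. *)
Definition opp2 : rmod A^c^c := @Rmod _ A^c^c Q (@act _ _ Q) (@act_linearl _ _ Q)
  (@act_linearr _ _ Q) (@act1 _ _ Q) opp2_mul.

(** The left module Hom_A (Q, A). *)
Definition costar : rmod A^c := star opp2.

Lemma costar_actE (x : costar) (a : A^c) y :
  val (act x a : costar) y = @GRing.mul A a (val x y).
Proof. exact: star_actE. Qed.

Lemma costar_expand n (x : 'I_n -> Q) (xi : 'I_n -> 'Hom(Q, regular A)) :
    dual_basis x xi -> exists h : 'I_n -> costar, (forall i, val (h i) = xi i) /\
  forall g : costar, g = \sum_i act (h i) (val g (x i) : A^c).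
Proof. exact: (@star_expand _ _ opp2 n x xi). Qed.

Lemma costar_ev (y : Q) : exists f : 'Hom(costar, regular A^c), is_hom f /\
  forall g : costar, f g = val g y.
Proof.
apply: (@hom_exists _ _ costar (regular A^c) (fun g => val g y)) => [c g g'|g a].
  by rewrite linearP /= lfunDZ.
exact: costar_actE.
Qed.

Lemma costar_projective : projective Q -> projective costar.
Proof.
move=> /projective_dual_basis Q_basis; apply: star_projective.
exact: (@dual_basis_projective _ _ opp2 Q_basis).
Qed.

Lemma costar_reflexive : projective Q -> exists e : 'Hom(Q, star costar),
  [/\ is_hom e, bijective e & forall z h, val (e z) h = (val h z : A)].
Proof.
move=> /projective_dual_basis[n [x [xi xP]]]; have [h [hE gE]] := costar_expand xP.
have ex z : exists g : star costar, forall h : costar, val g h = (val h z : A).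
  have [f [f_hom fE]] := costar_ev z; have [g gE'] := mem_homv f_hom.
  by exists g => h'; rewrite gE' fE.
have [e0 e0E] := choice_fun ex.
have [c z z'|z a|e [e_hom eE]] := @hom_exists _ _ Q (star costar) e0.
- apply: homs_eq => h'.
  by rewrite linearP /= lfunDZ !e0E linearP.
- by apply: homs_eq => h'; rewrite star_actE !e0E (subvs_hom h').
exists e; split=> // [|z h']; last by rewrite eE e0E.
apply/bij_lfunP; split.
  apply/lker0_inj/lker_eq0 => z z0; rewrite (xP.2 z) big1 // => i _.
  by rewrite -hE -e0E -eE z0 /= zero_lfunE act0r.
apply: onto_limg => g; exists (\sum_i act (x i) (val g (h i) : A)).
apply: homs_eq => h'; rewrite eE e0E {1}(gE h') !linear_sum.
by apply: eq_bigr => i _ /=; rewrite (subvs_hom g) (subvs_hom h').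
Qed.

End Costar.

Lemma costar_map (k : fieldType) (A : falgType k) (Q1 Q0 : rmod A) (j : 'Hom(Q1, Q0)) :
  is_hom j -> exists d : 'Hom(costar Q0, costar Q1), is_hom d /\
    forall h z, val (d h) z = val h (j z).
Proof. exact: (@star_map _ _ (opp2 Q1) (opp2 Q0) j). Qed.

Section Translate.
Variables (k : fieldType) (A : falgType k).
Hypothesis hA : hereditary A.

(** The image of g is a submodule of A, hence projective and a direct summand of S. *)
Lemma nonprojective_hom0 (S : rmod A) (g : 'Hom(S, regular A)) :
  indecomposable S -> ~ projective S -> is_hom g -> g = 0.
Proof.
move=> [_ dec] nproj g_hom; have [J [p [i [p_surj i_inj pi]]]] := image_ex g_hom.
have free1 : projective (regular A).
  apply: projective_isom (@free_projective _ _ 1).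
  apply: isom_trans (pow_dsums _ _) _; rewrite dsums_recl dsums0.
  exact: isom_sym (dsum_zero_isom _ (@zero_mod_zero _ A)).
have J_proj : projective J := hA free1 i_inj.
have [s [s_hom sE]] := J_proj _ _ p \1%VF p_surj (@hom_id _ _ J).
have psK y : p (s y) = y by rewrite -comp_lfunE -sE id_lfunE.
have [Y SJY] := split_mono_summand s_hom p_surj.1 psK.
case: (dec _ _ SJY) => [J0|Y0].
  by apply/lfunP => x; rewrite -pi (J0 (p x)) linear0 zero_lfunE.
case: nproj; apply: projective_isom J_proj.
exact: isom_trans (dsum_zero_isom _ Y0) (isom_sym SJY).
Qed.

Lemma minimal_cover (S : rmod A) : exists (Q : rmod A) (p : 'Hom(Q, S)),
  [/\ projective Q, surjhom p &
     forall (Q' : rmod A) (p' : 'Hom(Q', S)), projective Q' -> surjhom p' ->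
     (\dim {:Q} <= \dim {:Q'})%N].
Proof.
have [n [p0 p0_surj]] := free_cover S.
move: p0 p0_surj (@free_projective _ A n); move: (pow (regular A) n) => Q p p_surj Q_proj.
have [m] := ubnP (\dim {:Q}); elim: m Q p p_surj Q_proj => // m IH Q p p_surj Q_proj leQm.
case: (classic (exists (Q' : rmod A) (p' : 'Hom(Q', S)),
    [/\ projective Q', surjhom p' & (\dim {:Q'} < \dim {:Q})%N])) => [[Q' [p' [? ? ltQ]]]|no].
  exact: (IH Q' p') (leq_trans ltQ leQm).
exists Q, p; split=> // Q' p' Q'_proj p'_surj; rewrite leqNgt; apply/negP => ltQ.
by apply: no; exists Q', p'.
Qed.

Section Resolution.
Variables (S Q1 Q0 : rmod A) (j : 'Hom(Q1, Q0)) (pi : 'Hom(Q0, S)).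
Hypotheses (Q1_proj : projective Q1) (Q0_proj : projective Q0) (jpi : short_exact j pi).
Variable d : 'Hom(costar Q0, costar Q1).
Hypotheses (d_hom : is_hom d) (dE : forall h (z : Q1), val (d h) z = val h (j z)).

Let j_hom : is_hom j. Proof. by case: jpi => -[]. Qed.
Let j_inj : injective j. Proof. by apply/lker0_inj; case: jpi => -[]. Qed.
Let img_j : limg j = lker pi. Proof. by case: jpi. Qed.
Let pi_surj : surjhom pi. Proof. by case: jpi. Qed.

Lemma costar_coker : exists q : 'Hom(star (costar Q0), S), surjhom q /\
  forall g, q g = 0 <-> exists h : star (costar Q1), vsval g = (vsval h \o d)%VF.
Proof.
have [e0 [e0_hom e0_bij e0E]] := costar_reflexive Q0_proj.
have [e1 [e1_hom e1_bij e1E]] := costar_reflexive Q1_proj.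
have [e0'_hom e0K e0'K] := hom_inv e0_hom e0_bij; have [_ _ e1'K] := hom_inv e1_hom e1_bij.
have e01 z h : val (e0 (j z)) h = val (e1 z) (d h) by rewrite e0E e1E dE.
exists (pi \o e0^-1)%VF; split=> [|g].
  split; first exact: hom_comp pi_surj.1 e0'_hom.
  apply: onto_limg => z; have [v ->] := limg_full z pi_surj.2.
  by exists (e0 v); rewrite comp_lfunE e0K.
rewrite comp_lfunE; split=> [/(exact_lift img_j)[z zE]|[h hE]].
  exists (e1 z); apply/lfunP => h; rewrite comp_lfunE -{1}(e0'K g) zE.
  exact: e01.
have -> : g = e0 (j (e1^-1%VF h)); last by rewrite e0K (exact_comp img_j).
apply: homs_eq => h'; rewrite e01 e1'K.
by have /lfunP/(_ h') := hE; rewrite comp_lfunE.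
Qed.

(** As Q1 is projective, T (x) Hom (Q1, A) = Hom (Q1, T). So g and p give a functional
    on Hom (Q1, T); it vanishes on the maps that extend to Q0, and all maps do so when
    Ext^1 (S, T) = 0. *)
Lemma balanced_eq0 (T : rmod A) (N : rmod A^c) (p : 'Hom(costar Q1, N))
    (g : 'Hom(T, 'Hom(N, k^o))) :
    ext_vanish S T -> is_hom p -> (forall h, p (d h) = 0) ->
    (forall t (a : A) z, g (act t a) z = g t (act z (a : A^c))) ->
  forall t h, g t (p h) = 0.
Proof.
move=> ST p_hom pd g_act t h.
have [n1 [x [xi xP]]] := projective_dual_basis Q1_proj.
have [n0 [y [eta yP]]] := projective_dual_basis Q0_proj.
have [X [_ XE]] := costar_expand xP; have [E [Eval _]] := costar_expand yP.
pose chi t (h : costar Q1) : k^o := g t (p h).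
have chi_act t' a h' : chi (act t' a) h' = chi t' (act h' (a : A^c)) by rewrite /chi g_act p_hom.
have chi_suml (m : nat) (f : 'I_m -> T) h' : chi (\sum_i f i) h' = \sum_i chi (f i) h'.
  by rewrite /chi linear_sum sum_lfunE.
have chi_sumr (m : nat) t' (f : 'I_m -> costar Q1) : chi t' (\sum_i f i) = \sum_i chi t' (f i).
  by rewrite /chi !linear_sum.
have [c z z'|z a|w [w_hom wE]] := @hom_exists _ _ Q1 T (fun z => act t (val h z : A)).
- by rewrite linearP act_linearr.
- by rewrite (subvs_hom h) actA.
have [u [u_hom uE]] := vanish_extend jpi ST w_hom.
rewrite -[LHS]/(chi t h) (XE h) chi_sumr.
transitivity (\sum_i \sum_l chi (u (y l)) (act (X i) (val (d (E l)) (x i) : A^c))).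
  apply: eq_bigr => i _; rewrite -chi_act -wE -uE [in LHS](yP.2 (j (x i))) linear_sum.
  by rewrite chi_suml; apply: eq_bigr => l _; rewrite /= u_hom chi_act dE Eval.
rewrite exchange_big big1 // => l _.
by rewrite -chi_sumr -XE /chi pd linear0.
Qed.

Lemma costar_lker0 : indecomposable S -> ~ projective S -> lker d = 0%VS.
Proof.
move=> S_ind nproj; apply: lker_eq0 => h h0.
have [_ /(exact_lift img_j)[z ->]|g [g_hom gE]] := hom_factor pi_surj
    (subvs_hom (h : homs Q0 (regular A))).
  by rewrite -dE h0 /= zero_lfunE.
apply: homs_eq => z.
by rewrite -gE (nonprojective_hom0 S_ind nproj g_hom) /= !zero_lfunE.
Qed.

(** If U supplements the image of d, then modulo maps that extend to Q0 the
    coordinates of Q1 lie in U. This gives sg : Q0 -> Q1 such that 1 - sg j maps Q1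
    to itself with coordinates in U, and 1 - j sg maps Q0 onto a cover of S, so that
    both are bijective when Q0 is minimal. *)
Lemma costar_superfluous :
    (forall (Q' : rmod A) (p' : 'Hom(Q', S)), projective Q' -> surjhom p' ->
       (\dim {:Q0} <= \dim {:Q'})%N) ->
  superfluous (limg d).
Proof.
move=> Q0_min U U_sub U_full.
have [n [x [xi xP]]] := projective_dual_basis Q1_proj.
have [X [Xval _]] := costar_expand xP.
have ex_u i : exists u : costar Q1, exists e : costar Q0, u \in U /\ X i = u + d e.
  have := memvf (X i); rewrite -U_full => /memv_addP[u uU [_ /memv_imgP[e _ ->] ->]].
  by exists u, e.
have [u uP] := choice_fun ex_u; have [e eP] := choice_fun uP.
have [c z z'|z a|sg [sg_hom sgE]] :=
  @hom_exists _ _ Q0 Q1 (fun z => \sum_i act (x i) (val (e i) z : A)).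
- rewrite scaler_sumr -big_split; apply: eq_bigr => i _.
  by rewrite linearP act_linearr.
- by rewrite act_suml; apply: eq_bigr => i _; rewrite (subvs_hom (e i)) actA.
pose e0 := (\1 - (j \o sg))%VF : 'End(Q0); pose e1 := (\1 - (sg \o j))%VF : 'End(Q1).
have e0_hom : is_hom e0 by apply: hom_sub (@hom_id _ _ _) (hom_comp _ _).
have e1_hom : is_hom e1 by apply: hom_sub (@hom_id _ _ _) (hom_comp _ _).
have e0E z : e0 z = z - j (sg z) by rewrite sub_lfunE comp_lfunE id_lfunE.
have e1E z : e1 z = z - sg (j z) by rewrite sub_lfunE comp_lfunE id_lfunE.
(* the image of e0 is a projective submodule of Q0 that still maps onto S *)
have [J [q [i [q_surj i_inj qi]]]] := image_ex e0_hom.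
have J_proj : projective J := hA Q0_proj i_inj.
have piJ : surjhom (pi \o i)%VF.
  split; first exact: hom_comp pi_surj.1 i_inj.1.
  apply: onto_limg => z; have [v ->] := limg_full z pi_surj.2; exists (q v).
  by rewrite comp_lfunE qi e0E linearB /= (exact_comp img_j) subr0.
have e0_onto : limg e0 = fullv.
  apply/eqP; rewrite eqEdim subvf /=; apply: leq_trans (Q0_min _ _ J_proj piJ) _.
  have -> : limg e0 = limg i.
    apply/vspaceP => z; apply/idP/idP => /limgP[v ->]; apply/limgP.
      by exists (q v); rewrite qi.
    by have [v' ->] := limg_full v q_surj.2; exists v'; rewrite qi.
  by rewrite limg_dim_eq // (i_inj.2) capv0.
have e0_inj : injective e0.
  apply/lker0_inj; apply/eqP; rewrite -dimv_eq0.
  by have := limg_ker_dim e0 fullv; rewrite e0_onto capfv -[RHS]add0n => /addIn ->.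
have e1_inj : injective e1.
  move=> z z' zz'; apply: j_inj; apply: e0_inj.
  have je v : e0 (j v) = j (e1 v) by rewrite e0E e1E linearB.
  by rewrite !je zz'.
have e1_bij : bijective e1.
  apply/bij_lfunP; split=> //; apply/eqP; rewrite eqEdim subvf /= limg_dim_eq //.
  by rewrite (lker0_inj e1).2 // capv0.
have [e1'_hom e1K _] := hom_inv e1_hom e1_bij.
apply: vspace_full => h.
have h_hom : is_hom (val (h : homs Q1 (regular A))) := subvs_hom (h : costar Q1).
have [h' h'E] := mem_homv (hom_comp h_hom e1'_hom).
have -> : h = \sum_l act (u l) (val h' (x l) : A^c).
  apply: homs_eq => z; rewrite linear_sum /= sum_lfunE.
  have -> : val h z = val h' (e1 z) by rewrite h'E comp_lfunE e1K.
  rewrite e1E sgE {1}(xP.2 z) linearB !linear_sum /= -big_split.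
  apply: eq_bigr => l _; rewrite /= !(subvs_hom h') comp_lfunE rmulAE /= -mulrBr.
  congr (_ * _); have xl : xi l z = val (u l) z + val (e l) (j z).
    by rewrite -Xval (eP l).2 linearD /= add_lfunE -dE.
  by rewrite xl addrK.
by apply: memv_suml => l _; apply: U_sub; case: (eP l).
Qed.

End Resolution.

Variable T : rmod A.

(** Dualizing a projective resolution Q1 -> Q0 of S with Q0 minimal gives a minimal
    presentation costar Q0 -> costar Q1 of its cokernel N. Its transpose is S, so that
    S = tau^-1 F for the dual F of N, and Hom (T, F) is the dual of Ext^1 (S, T). *)
Lemma vanish_tauinv (S : rmod A) : indecomposable S -> ~ projective S ->
  ext_vanish S T -> in_tauinv_torsion_free T S.
Proof.
move=> S_ind nproj ST.
have [Q0 [pi [Q0_proj pi_surj Q0_min]]] := minimal_cover S.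
have [Q1 [j [j_injh img_j]]] := submodule_ex (lker_submod pi_surj.1).
have jpi : short_exact j pi by [].
have Q1_proj : projective Q1 := hA Q0_proj j_injh.
have [d [d_hom dE]] := costar_map j_injh.1.
have [N [pN [pN_surj ker_pN]]] := quotient_ex (limg_submod d_hom).
pose s : A -> A^c := id; pose s' : A^c -> A := id.
have s_lin : linear s by []. have s'_lin : linear s' by [].
have s1 : s 1 = 1 by []. have s'1 : s' 1 = 1 by [].
have sM a b : s (a * b) = s b * s a by []. have s'M a b : s' (a * b) = s' b * s' a by [].
pose F := dual_along s_lin s1 sM N.
have [th [th_hom th_bij]] : exists th : 'Hom(N, dual F), is_hom th /\ bijective th.
  exact: (bidual_isom s_lin s1 sM s'_lin s'1 s'M (fun _ => erefl) N).
have [th_inj th_onto] := (bij_lfunP th).1 th_bij.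
have p_surj : surjhom (th \o pN)%VF.
  split; first exact: hom_comp th_hom pN_surj.1.
  apply: onto_limg => f; have [z ->] := limg_full f th_onto.
  by have [u ->] := limg_full z pN_surj.2; exists u; rewrite comp_lfunE.
have ker_p : lker (th \o pN)%VF = limg d.
  rewrite -ker_pN; apply/vspaceP => z; rewrite !memv_ker comp_lfunE.
  by rewrite -(inj_eq th_inj) linear0.
exists F; split.
  apply: vspace_eq0 => g /homvP g_hom; apply/lfunP => t; apply/lfunP => z.
  have [h ->] := limg_full z pN_surj.2; rewrite !zero_lfunE.
  apply: (balanced_eq0 Q1_proj Q0_proj jpi dE (g := g) ST pN_surj.1).
    exact: exact_comp (esym ker_pN).
  by move=> t' a z'; rewrite g_hom -[act (g t') a]/(dual_along_act _ _ _) dual_along_actE.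
exists (costar Q0), (costar Q1), d, (th \o pN)%VF.
split; last exact: (costar_coker Q1_proj Q0_proj jpi dE).
split=> //; try exact: costar_projective.
split=> //; rewrite ?ker_p; first exact: (costar_superfluous Q1_proj Q0_proj jpi dE Q0_min).
by rewrite (costar_lker0 jpi dE S_ind nproj) => U _; rewrite addv0.
Qed.

(** For projective Y both sides hold; for the other indecomposable modules Y this is the
    formula Ext^1 (Y, T) = D Hom (T, tau Y). *)
Lemma in_C_vanish (Y : rmod A) : in_C T Y <-> ext_vanish Y T.
Proof.
split=> [[n [S [SP YS]]]|YT].
  apply: isom_vanish (isom_sym YS) _; apply: dsums_vanish => i.
  case: (SP i) => _ [[F [TF FS]]|Sproj]; first exact: tauinv_vanish TF FS.
  have [m [s [r [s_hom r_hom rK]]]] := in_addP Sproj.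
  apply: (retract_vanish s_hom r_hom rK).
  exact: projective_vanish (@free_projective _ _ m).
have [n [S [S_ind YS]]] := dsums_indec Y.
exists n, S; split=> // i; split=> //.
have SiT : ext_vanish (S i) T.
  have [Z SZ] := dsums_summand S i.
  have [u [r [u_hom r_hom rK]]] := isom_retract (isom_trans YS SZ).
  exact: retract_vanish u_hom r_hom rK YT.
case: (classic (projective (S i))) => [Si_proj|nproj]; last by left; apply: vanish_tauinv.
right; have [m [s [r [s_hom r_hom rK]]]] := projective_retract Si_proj.
exact: in_add_pow s_hom r_hom rK.
Qed.

End Translate.
(** * Projective-injective modules over the duplicated algebra *)

Section ProjInj.
Variables (k : fieldType) (A : falgType k).
Implicit Types (M N X Y P Q : rmod A).

Lemma zero_projective M : is_zero M -> projective M.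
Proof.
move=> M0 X Y g f _ _; exists 0; split; first exact: hom_zero.
by apply/lfunP => x; rewrite (M0 x) !linear0.
Qed.

Lemma zero_injective M : is_zero M -> injective_mod M.
Proof.
move=> M0 X Y g f _ _; exists 0; split; first exact: hom_zero.
by apply/lfunP => x; rewrite (M0 (f x)) comp_lfunE zero_lfunE.
Qed.

Lemma dsum_projective P Q : projective P -> projective Q -> projective (dsum P Q).
Proof.
move=> P_proj Q_proj M N g f g_surj f_hom.
have [i [i_hom iE]] := hom_inl P Q; have [j [j_hom jE]] := hom_inr P Q.
have [u [u_hom uE]] := P_proj _ _ g _ g_surj (hom_comp f_hom i_hom).
have [v [v_hom vE]] := Q_proj _ _ g _ g_surj (hom_comp f_hom j_hom).
have [h [h_hom hE]] := hom_copair u_hom v_hom.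
exists h; split=> //; apply/lfunP => x.
rewrite comp_lfunE hE linearD /= -!comp_lfunE -uE -vE !comp_lfunE -linearD iE jE.
by rewrite -dsum_split.
Qed.

Lemma dsum_injective P Q : injective_mod P -> injective_mod Q -> injective_mod (dsum P Q).
Proof.
move=> P_inj Q_inj M N g f g_inj f_hom.
have [p [p_hom pE]] := hom_fst P Q; have [q [q_hom qE]] := hom_snd P Q.
have [u [u_hom uE]] := P_inj _ _ g _ g_inj (hom_comp p_hom f_hom).
have [v [v_hom vE]] := Q_inj _ _ g _ g_inj (hom_comp q_hom f_hom).
have [h [h_hom hE]] := hom_pair u_hom v_hom.
exists h; split=> //; apply/lfunP => x.
by rewrite comp_lfunE hE -!comp_lfunE -uE -vE !comp_lfunE pE qE -surjective_pairing.
Qed.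

Lemma injective_retract X Y (i : 'Hom(X, Y)) (r : 'Hom(Y, X)) :
  is_hom i -> is_hom r -> (forall x, r (i x) = x) -> injective_mod Y -> injective_mod X.
Proof.
move=> i_hom r_hom rK Y_inj M N g f g_inj f_hom.
have [h [h_hom hE]] := Y_inj _ _ g _ g_inj (hom_comp i_hom f_hom).
exists (r \o h)%VF; split; first exact: hom_comp.
by apply/lfunP => x; rewrite -comp_lfunA -hE !comp_lfunE rK.
Qed.

Lemma injective_isom X Y : isom X Y -> injective_mod X -> injective_mod Y.
Proof. by case/isomP => f [g [f_hom g_hom _ gK]]; apply: injective_retract g_hom f_hom gK. Qed.

End ProjInj.

(** Here r is a retraction onto S of the coinduced module Hom (B, S), in which
    (h u) v = h (u v) and S is embedded by sending x to v |-> x v. *)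
Lemma coinduced_retraction (k : fieldType) (B : falgType k) (S : rmod B) : injective_mod S ->
  exists r : 'Hom('Hom(B, S), S),
    (forall (h h' : 'Hom(B, S)) u, (forall v, h' v = h (u * v)) -> r h' = act (r h) u) /\
    (forall (h : 'Hom(B, S)) x, (forall v, h v = act x v) -> r h = x).
Proof.
move=> S_inj; pose W := 'Hom(B, S).
have ex_c (u : B) : exists c : 'End(W), forall h v, (c h : W) v = h (u * v).
  apply: bilinear_lfun => [v l h h'|h l v w]; first by rewrite lfunDZ.
  by rewrite mulrDr -scalerAr linearP.
have [c cE] := choice_fun ex_c.
have lin1 u : linear (fun h : W => c u h) by move=> l h h'; rewrite linearP.
have lin2 (h : W) : linear (fun u => c u h).
  move=> l u u'; apply/lfunP => v.
  by rewrite lfunDZ !cE mulrDl -scalerAl linearP.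
have un (h : W) : c 1 h = h by apply/lfunP => v; rewrite cE mul1r.
have as_ (h : W) u v : c (u * v) h = c v (c u h).
  by apply/lfunP => w; rewrite !cE mulrA.
pose C := @Rmod k B W (fun h u => c u h) lin1 lin2 un as_.
have [iota iotaE] : exists iota : 'Hom(S, C), forall y v, (iota y : W) v = act y v.
  by apply: bilinear_lfun => [v|y]; [apply: act_linearl | apply: act_linearr].
have iota_inj : injhom iota.
  split=> [y u|]; first by apply/lfunP => v; rewrite iotaE cE iotaE actA.
  apply/lker0_inj => y z yz.
  by have := congr1 (fun h : W => h 1) yz; rewrite /= !iotaE !act1.
have [r [r_hom rE]] := S_inj _ _ iota \1%VF iota_inj (@hom_id _ _ S).
exists r; split=> [h h' u h'E|h x hE].
  by rewrite -(r_hom h u); congr (r _); apply/lfunP => v; rewrite h'E /= cE.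
rewrite -[RHS](@id_lfunE _ S) rE comp_lfunE; congr (r _).
by apply/lfunP => v; rewrite hE iotaE.
Qed.

Section Duplicated.
Variables (k : fieldType) (A : falgType k).
Local Notation L := (dup A).
Implicit Types (M N : rmod A) (S : rmod L) (a b : A) (f : 'Hom(A, k^o)).

Definition ent1 a : L := (a, 0, 0).
Definition entD f : L := (0, f, 0).
Definition ent2 b : L := (0, 0, b).

Lemma dup_eq (u v : L) : u.1.1 = v.1.1 -> (forall a, u.1.2 a = v.1.2 a) -> u.2 = v.2 -> u = v.
Proof. by case: u v => [[a f] b] [[a' f'] b'] /= -> /lfunP -> ->. Qed.

Definition dupE := (add_lfunE, zero_lfunE, DA_mulrE, DA_mullE, mul0r, mulr0, mul1r, mulr1,
  linear0, add0r, addr0).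

Lemma ent1_mul a (u : L) : ent1 a * u = ent1 (a * u.1.1).
Proof. by apply: dup_eq => [|x|]; rewrite /= ?dupE. Qed.

Lemma mul_entD (u : L) f : u * entD f = entD (DA_mull u.2 f).
Proof. by apply: dup_eq => [|x|]; rewrite /= ?dupE. Qed.

Lemma entD_mul f (u : L) : entD f * u = entD (DA_mulr f u.1.1).
Proof. by apply: dup_eq => [|x|]; rewrite /= ?dupE. Qed.

Lemma mul_ent1 (u : L) a : u * ent1 a = ent1 (u.1.1 * a) + entD (DA_mulr u.1.2 a).
Proof. by apply: dup_eq => [|x|]; rewrite /= ?dupE. Qed.

Lemma mul_ent2 (u : L) b : u * ent2 b = ent2 (u.2 * b).
Proof. by apply: dup_eq => [|x|]; rewrite /= ?dupE. Qed.

Lemma ent_one : ent1 1 + ent2 1 = 1.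
Proof. by apply: dup_eq => [|x|]; rewrite /= ?dupE. Qed.

Lemma ent1_linear : linear ent1.
Proof. by move=> c a b; apply: dup_eq => [|x|] //=; rewrite ?scaler0 ?addr0. Qed.

Lemma entD_linear : linear entD.
Proof. by move=> c f g; apply: dup_eq => [|x|] //=; rewrite ?scaler0 ?addr0. Qed.

Lemma DA_mulr1 f : DA_mulr f 1 = f.
Proof. by apply/lfunP => x; rewrite DA_mulrE mul1r. Qed.

Lemma infl_actE M (x : infl M) (u : L) : act x u = (act (x : M) u.1.1 : M).
Proof. by []. Qed.

Lemma infl_ent2 M (x : infl M) b : act x (ent2 b) = 0.
Proof. exact: (@act0r _ _ M x). Qed.

Lemma infl_entD M (x : infl M) f : act x (entD f) = 0.
Proof. exact: (@act0r _ _ M x). Qed.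

(** In the coinduced module of S, x becomes the map u |-> x u, which only depends on
    the entry u.1.1. Expanding this entry along a basis e of A, with coordinate forms f,
    gives a sum of products of maps u |-> u.1.2 1 *: x e_i by the elements f_i of D A. *)
Lemma injective_generated S (x : S) : injective_mod S -> act x (ent1 1) = x ->
  exists n (y : 'I_n -> S) (f : 'I_n -> 'Hom(A, k^o)), x = \sum_i act (y i) (entD (f i)).
Proof.
move=> S_inj xe; have [r [r_act r_ev]] := coinduced_retraction S_inj.
pose e := vbasis {:A}.
have ex_f i : exists f : 'Hom(A, k^o), forall a, f a = coord e i a.
  by apply: lfun_exists => l a b; rewrite linearP.
have [f fE] := choice_fun ex_f.
have ex_h (i : 'I_(\dim {:A})) : exists h : 'Hom(L, S),
    forall v, h v = (v.1.2 1 : k) *: act x (ent1 e`_i).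
  by apply: lfun_exists => l v w; rewrite /= lfunDZ scalerDl scalerA.
have [h hE] := choice_fun ex_h.
have [h' h'E] : exists h' : 'I_(\dim {:A}) -> 'Hom(L, S), forall i v,
    h' i v = (f i v.1.1 : k) *: act x (ent1 e`_i).
  apply: (@choice_fun _ _ (fun i (g : 'Hom(L, S)) => forall v, g v = _)) => i.
  by apply: lfun_exists => l v w; rewrite /= linearP scalerDl scalerA.
exists (\dim {:A}), (fun i => r (h i)), f.
transitivity (r (\sum_i h' i)).
  symmetry; apply: r_ev => u; rewrite sum_lfunE -{1}xe -actA ent1_mul mul1r.
  have [g gE] : exists g : 'Hom(A, S), forall a, g a = act x (ent1 a).
    by apply: lfun_exists => l a b; rewrite ent1_linear act_linearr.
  rewrite -gE [u.1.1 in RHS](coord_vbasis (memvf _)) linear_sum; apply: eq_bigr => i _.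
  by rewrite h'E fE linearZ /= gE.
rewrite linear_sum; apply: eq_bigr => i _; apply: r_act => u.
by rewrite h'E hE entD_mul /= DA_mulrE mulr1.
Qed.

(** This holds for the regular module, where z f = 0 for all f in D A forces z.2 = 0,
    and hence for the summands of free modules. *)
Lemma projective_separated S (x : S) : projective S -> act x (ent2 1) = x ->
  (forall f, act x (entD f) = 0) -> x = 0.
Proof.
move=> S_proj xe xD; have [n [s [r [s_hom r_hom rK]]]] := projective_retract S_proj.
rewrite -(rK x); suff -> : s x = 0 by rewrite linear0.
apply/ffunP => j; rewrite ffunE; have [pr [pr_hom prE]] := pow_proj (regular L) j.
have: (pr \o s)%VF x = s x j by rewrite comp_lfunE prE.
set z : L := s x j => prz.
have hom : is_hom (pr \o s)%VF by apply: hom_comp.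
have ze : z * ent2 1 = z by have := hom x (ent2 1); rewrite xe prz.
have zD f : z * entD f = 0 by have := hom x (entD f); rewrite xD linear0 prz.
rewrite -ze mul_ent2 mulr1.
suff -> : z.2 = 0 by [].
apply: NNPP => /functional_sep0[f]; case.
have := congr1 (fun u : L => u.1.2 1) (zD f); rewrite mul_entD /= DA_mullE mul1r.
by rewrite zero_lfunE.
Qed.

(** X is the A-module S e1, for the idempotent e1 = ent1 1. *)
Definition is_corner S (X : rmod A) (i : 'Hom(X, S)) : Prop :=
  [/\ injective i, forall x a, i (act x a) = act (i x) (ent1 a) &
      forall y, act y (ent1 1) = y -> exists x, y = i x].

Lemma corner_module S : exists (X : rmod A) (i : 'Hom(X, S)), is_corner i.
Proof.
have [U UP] : exists U : {vspace S}, forall y, y \in U <-> act y (ent1 1) = y.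
  by apply: vspace_ex => [|c x y xE yE]; rewrite ?act0l // act_linearl xE yE.
have ex a : exists g : 'End(subvs_of U), forall x, val (g x) = act (val x) (ent1 a).
  have inU (x : subvs_of U) : act (val x) (ent1 a) \in U.
    by apply/UP; rewrite -actA ent1_mul mulr1.
  have [g gE] : exists g : 'End(subvs_of U), forall x, g x = Subvs (inU x).
    by apply: lfun_exists => c x y; apply: val_inj; rewrite /= act_linearl.
  by exists g => x; rewrite gE.
have [g gE] := choice_fun ex.
have lin1 a : linear (fun x => g a x) by move=> c x y; rewrite linearP.
have lin2 x : linear (fun a => g a x).
  by move=> c a b; apply: val_inj; rewrite linearP /= !gE ent1_linear act_linearr.
have un x : g 1 x = x by apply: val_inj; rewrite gE; apply/UP/subvsP.
have as_ x a b : g (a * b) x = g b (g a x).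
  by apply: val_inj; rewrite !gE -actA ent1_mul.
exists (@Rmod k A (subvs_of U) (fun x a => g a x) lin1 lin2 un as_).
have [i iE] : exists i : 'Hom(subvs_of U, S), forall x, i x = val x by apply: lfun_exists.
exists i; split=> [x y|x a|y /UP yU]; first by rewrite !iE; apply: val_inj.
  by rewrite !iE gE.
by exists (Subvs yU); rewrite iE.
Qed.

Section Corner.
Variables (S : rmod L) (X : rmod A) (i : 'Hom(X, S)).
Hypothesis iP : is_corner i.

Lemma corner_act x (u : L) : act (i x) u = i (act x u.1.1).
Proof. by case: iP => _ i_act _; rewrite -{1}[x]act1 i_act -actA ent1_mul mul1r i_act. Qed.

(** Inflation is left adjoint to taking corners; corner_lift is the converse. *)
Lemma corner_hom M (f : 'Hom(M, X)) : is_hom f -> is_hom (i \o f : 'Hom(infl M, S))%VF.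
Proof. by move=> f_hom x u; rewrite !comp_lfunE infl_actE f_hom corner_act. Qed.

Lemma corner_lift M (g : 'Hom(infl M, S)) : is_hom g ->
  exists f : 'Hom(M, X), is_hom f /\ forall x, i (f x) = g x.
Proof.
case: iP => i_inj i_act i_onto g_hom; have ex x : exists y, g x = i y.
  by apply: i_onto; rewrite -g_hom infl_actE act1.
have [f0 f0E] := choice_fun ex.
have [c x y|x a|f [f_hom fE]] := @hom_exists _ _ M X f0.
- by apply: i_inj; rewrite -f0E !linearP /= -!f0E.
- by apply: i_inj; rewrite -f0E i_act -f0E -g_hom.
by exists f; split=> // x; rewrite fE -f0E.
Qed.

Lemma corner_injective : injective_mod S -> injective_mod X.
Proof.
case: iP => i_inj _ _ S_inj M N g f [g_hom g_ker] f_hom.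
have g_injh : @injhom _ _ (infl M) (infl N) g by split=> // x u; rewrite !infl_actE g_hom.
have [h [h_hom hE]] := S_inj _ _ _ _ g_injh (corner_hom f_hom).
have [h' [h'_hom h'E]] := corner_lift h_hom.
exists h'; split=> //; apply/lfunP => x; apply: i_inj.
by rewrite comp_lfunE h'E -!comp_lfunE hE.
Qed.

End Corner.

(** The triple (A, D A, 1). It is projective as the second row of the algebra, from
    which it also inherits the module axioms. It is injective as the dual of the first
    column L e1: the homomorphisms from N to it are the functionals on N e1. *)
Section ProjectiveInjective.
Let W := ('Hom(A, k^o) * A)%type.
Definition pi_act (x : W) (u : L) : W := (DA_mulr x.1 u.1.1 + DA_mull x.2 u.1.2, x.2 * u.2).

Lemma pi_emb (x : W) (u : L) : ((0, (pi_act x u).1, (pi_act x u).2) : L) = ((0, x.1, x.2) : L) * u.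
Proof. by apply: dup_eq => [|a|]; rewrite /= ?dupE. Qed.

Lemma pi_eq (x y : W) : ((0, x.1, x.2) : L) = (0, y.1, y.2) -> x = y.
Proof. by case: x y => [f a] [f' a'] /= [-> ->]. Qed.

Let emb (x : W) : L := (0, x.1, x.2).
Fact emb_linear : linear emb.
Proof. by move=> c x y; apply: dup_eq => [|a|] //=; rewrite scaler0 addr0. Qed.

Fact pi_linearl u : linear (pi_act^~ u).
Proof.
move=> c x y; apply: pi_eq; rewrite pi_emb -!/(emb _) !emb_linear mulrDl -scalerAl.
by rewrite /emb !pi_emb.
Qed.
Fact pi_linearr x : linear (pi_act x).
Proof.
move=> c u v; apply: pi_eq; rewrite pi_emb -!/(emb _) !emb_linear mulrDr -scalerAr.
by rewrite /emb !pi_emb.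
Qed.
Fact pi_act1 x : pi_act x 1 = x.
Proof. by apply: pi_eq; rewrite pi_emb mulr1. Qed.
Fact pi_actA x u v : pi_act x (u * v) = pi_act (pi_act x u) v.
Proof. by apply: pi_eq; rewrite !pi_emb mulrA. Qed.

Definition pi_module : rmod L := @Rmod _ L W pi_act pi_linearl pi_linearr pi_act1 pi_actA.

Lemma pi_projective : projective pi_module.
Proof.
move=> M N g f [g_hom g_onto] f_hom.
have [m mE] := limg_full (f ((0, 1) : pi_module)) g_onto.
have [c x y|x u|h [h_hom hE]] := @hom_exists _ _ pi_module M (fun x => act m (emb x)).
- by rewrite emb_linear act_linearr.
- by rewrite /emb pi_emb actA.
exists h; split=> //; apply/lfunP => x; rewrite comp_lfunE hE g_hom -mE -f_hom; congr (f _).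
apply: pi_eq; rewrite pi_emb; apply: dup_eq => [|a|]; rewrite /= ?dupE //.
Qed.

Lemma pi_injective : injective_mod pi_module.
Proof.
move=> M N g f [g_hom g_ker] f_hom.
have [lam lamE] : exists lam : 'Hom(N, k^o), forall m, lam (g m) = (f m : W).1 1.
  have [l lE] : exists l : 'Hom(M, k^o), forall m, l m = (f m : W).1 1.
    by apply: lfun_exists => c m m'; rewrite linearP /= lfunDZ.
  by exists (l \o g^-1)%VF => m; rewrite comp_lfunE lker0_lfunK ?lE // g_ker.
have ex n : exists x : W, (forall a, x.1 a = lam (act n (ent1 a))) /\
    (forall p : 'Hom(A, k^o), p x.2 = lam (act n (entD p))).
  have [p pE] : exists p : 'Hom(A, k^o), forall a, p a = lam (act n (ent1 a)).
    by apply: lfun_exists => c a b; rewrite ent1_linear act_linearr linearP.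
  have [q qE] : exists q : 'Hom('Hom(A, k^o), k^o), forall p, q p = lam (act n (entD p)).
    by apply: lfun_exists => c a b; rewrite entD_linear act_linearr linearP.
  have [b bE] := bidual_ev q.
  by exists (p, b); split=> // p'; rewrite -bE.
have [h0 h0E] := choice_fun ex.
have weq (x y : W) : (forall a, x.1 a = y.1 a) -> (forall p : 'Hom(A, k^o), p x.2 = p y.2) -> x = y.
  case: x y => [p b] [p' b'] /= /lfunP -> bb'; congr pair.
  exact: functional_eq.
have [h hE] : exists h : 'Hom(N, pi_module), forall n, h n = h0 n.
  apply: lfun_exists => c n n'; apply: weq => [a|p].
    by rewrite (h0E _).1 act_linearl linearP /= lfunDZ !(h0E _).1.
  by rewrite (h0E _).2 act_linearl linearP /= linearP /= !(h0E _).2.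
exists h; split=> [n u|].
  rewrite !hE -[RHS]/(pi_act _ _); apply: weq => [a|p].
    rewrite (h0E _).1 -actA mul_ent1 actDr linearD /= add_lfunE DA_mulrE DA_mullE.
    by rewrite -(h0E n).1 -(h0E n).2 DA_mulrE.
  by rewrite (h0E _).2 -actA mul_entD -(h0E n).2 DA_mullE.
apply/lfunP => m; rewrite comp_lfunE hE; apply: weq => [a|p].
  rewrite (h0E _).1 -g_hom lamE f_hom -[act (f m) _]/(pi_act _ _) /=.
  by rewrite add_lfunE DA_mulrE DA_mullE mulr1 zero_lfunE addr0.
rewrite (h0E _).2 -g_hom lamE f_hom -[act (f m) _]/(pi_act _ _) /=.
by rewrite add_lfunE DA_mulrE DA_mullE mul1r mul0r linear0 add0r.
Qed.

(** The corner of pi_module is D A, and M is cogenerated by D A. *)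
Lemma infl_cogenerated M (x : M) : x <> 0 ->
  exists f : 'Hom(infl M, pi_module), is_hom f /\ f x <> 0.
Proof.
move=> /functional_sep0[p px].
have [q qE] : exists q : 'Hom(M, 'Hom(A, k^o)), forall m a, q m a = p (act m a).
  apply: bilinear_lfun => [a c m m'|m c a b]; first by rewrite act_linearl linearP.
  by rewrite act_linearr linearP.
have [f fE] : exists f : 'Hom(infl M, pi_module), forall m, f m = (q m, 0).
  by apply: lfun_exists => c m m'; congr pair; rewrite /= ?linearP // scaler0 addr0.
exists f; split=> [m u|].
  rewrite !fE; congr pair; last by rewrite /= mul0r.
  by apply/lfunP => a; rewrite add_lfunE DA_mulrE DA_mullE mulr0 linear0 addr0 !qE infl_actE actA.
rewrite fE => -[] /lfunP/(_ 1); rewrite qE act1 zero_lfunE.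
exact: px.
Qed.

End ProjectiveInjective.

Section SumAllProjInj.
Variable Pbar : rmod L.
Hypothesis hP : sum_all_projinj Pbar.

Lemma Pbar_projective : projective Pbar.
Proof.
have [n [S [SP _ _ PS]]] := hP; apply: projective_isom (isom_sym PS) _.
apply: dsums_ind => [|M N|i]; last by case: (SP i).
  exact: zero_projective (@zero_mod_zero _ _).
exact: dsum_projective.
Qed.

Lemma Pbar_injective : injective_mod Pbar.
Proof.
have [n [S [SP _ _ PS]]] := hP; apply: injective_isom (isom_sym PS) _.
apply: dsums_ind => [|M N|i]; last by case: (SP i).
  exact: zero_injective (@zero_mod_zero _ _).
exact: dsum_injective.
Qed.

(** The indecomposable summands of pi_module are isomorphic to summands of Pbar. *)
Lemma Pbar_cogenerates (x : pi_module) : x <> 0 ->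
  exists f : 'Hom(pi_module, Pbar), is_hom f /\ f x <> 0.
Proof.
move=> x0; have [n [S [SP _ all PS]]] := hP.
have [m [E [E_ind piE]]] := dsums_indec pi_module.
have [u [u_hom u_bij]] := piE; have [u_inj _] := (bij_lfunP u).1 u_bij.
have [|i [v [v_hom vx]]] := @dsums_sep _ _ _ E (u x).
  by move=> ux; apply: x0; apply: u_inj; rewrite ux linear0.
have [Z EZ] := dsums_summand E i; have piZ := isom_trans piE EZ.
have E_pi : projinj_indec (E i).
  have [s [r [s_hom r_hom rK]]] := isom_retract piZ.
  split=> //; first exact: retract_projective s_hom r_hom rK pi_projective.
  exact: injective_retract s_hom r_hom rK pi_injective.
have [l [w [w_hom w_bij]]] := all _ E_pi; have [w_inj _] := (bij_lfunP w).1 w_bij.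
have [Z' SZ'] := dsums_summand S l.
have [s [r [s_hom r_hom rK]]] := isom_retract (isom_trans PS SZ').
exists (s \o (w \o (v \o u)))%VF; split; first by do !apply: hom_comp => //.
rewrite !comp_lfunE => e; apply: vx; apply: w_inj.
by rewrite -(rK (w _)) e !linear0.
Qed.

Lemma corner_cogenerator (X : rmod A) (i : 'Hom(X, Pbar)) : is_corner i ->
  forall M, cogenerated M X.
Proof.
move=> iP M x /infl_cogenerated[f [f_hom /Pbar_cogenerates[g [g_hom gfx]]]].
have [h [h_hom hE]] := corner_lift iP (hom_comp g_hom f_hom).
exists h; split=> // hx; apply: gfx.
by rewrite -comp_lfunE -hE hx linear0.
Qed.

End SumAllProjInj.
End Duplicated.
(** * Endomorphism algebras *)

Section EndoAlgebra.
Variables (k : fieldType) (L : falgType k) (M : rmod L) (nzM : ~ is_zero M).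
Let E := endo_falg nzM.

Definition endo_val (f : E) : 'End(M) := vsval (f : homs M M).

Lemma endo_val_linear : linear endo_val. Proof. by []. Qed.
Lemma endo_val_mul (f g : E) : endo_val (f * g) = (endo_val f \o endo_val g)%VF.
Proof. by []. Qed.
Lemma endo_val_one : endo_val 1 = \1%VF. Proof. by []. Qed.
Lemma endo_val_inj : injective endo_val. Proof. exact: val_inj. Qed.
Lemma endo_val_hom (f : E) : is_hom (endo_val f). Proof. exact: subvs_hom. Qed.
Lemma endo_val_onto (f : 'End(M)) : is_hom f -> exists g : E, endo_val g = f.
Proof. by move/homvP => fH; exists (Subvs fH). Qed.

End EndoAlgebra.

Section Interface.
Variables (k : fieldType) (A : falgType k) (T : rmod A) (Pbar : rmod (dup A)).
Hypothesis hP : sum_all_projinj Pbar.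
Variables (I : rmod A) (i : 'Hom(I, Pbar)).
Hypothesis iP : is_corner i.
Let S : rmod (dup A) := dsum (infl T) Pbar.
Implicit Types (f : 'End(S)).

Let split1 (y : Pbar) : y = act y (ent1 1) + act y (ent2 1).
Proof. by rewrite -actDr ent_one act1. Qed.

(** The corner of Pbar is generated by the action of D A, which is zero on T. *)
Lemma hom_Pbar_infl (g : 'Hom(Pbar, infl T)) : is_hom g -> forall y, g y = 0.
Proof.
move=> g_hom y; rewrite (split1 y) linearD /= [g (act y (ent2 1))]g_hom infl_ent2 addr0.
set z := act y (ent1 1); have ze : act z (ent1 1) = z by rewrite /z -actA ent1_mul mul1r.
have [n [u [f ->]]] := injective_generated (Pbar_injective hP) ze.
rewrite linear_sum big1 // => l _.
by rewrite /= g_hom infl_entD.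
Qed.

(** The elements of Pbar e2 are separated by the action of D A, which maps them to the
    corner. *)
Lemma hom_Pbar_ext (g : 'End(Pbar)) : is_hom g -> (forall x, g (i x) = 0) -> forall y, g y = 0.
Proof.
move=> g_hom g0 y; have g1 z : act z (ent1 1) = z -> g z = 0.
  by case: iP => _ _ i_onto /i_onto[x ->].
rewrite (split1 y) linearD /= g1 ?add0r; last by rewrite -actA ent1_mul mul1r.
rewrite g_hom; apply: (projective_separated (Pbar_projective hP)) => [|f].
  by rewrite -actA mul_ent2 mulr1.
rewrite -actA mul_entD -g_hom g1 // -actA entD_mul.
by rewrite DA_mulr1.
Qed.

Lemma endo_entries f : is_hom f ->
  exists (c : 'End(T)) (g : 'Hom(T, I)) (h : 'End(I)),
  [/\ is_hom c, is_hom g, is_hom h &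
      forall t x, f (t, i x) = (c t, i (g t + h x))].
Proof.
move=> f_hom; have [u [u_hom uE]] := hom_inl (infl T) Pbar.
have [v [v_hom vE]] := hom_inr (infl T) Pbar.
have [p [p_hom pE]] := hom_fst (infl T) Pbar; have [q [q_hom qE]] := hom_snd (infl T) Pbar.
have c_hom : @is_hom _ _ T T (p \o (f \o u))%VF.
  have h : is_hom (p \o (f \o u))%VF by do !apply: hom_comp => //.
  by move=> t a; apply: (h t (ent1 a)).
have [g [g_hom gE]] := corner_lift iP (hom_comp q_hom (hom_comp f_hom u_hom)).
have iI_hom : is_hom (i : 'Hom(infl I, Pbar)).
  by move=> x w; rewrite (corner_act iP).
have [h [h_hom hE]] := corner_lift iP
  (hom_comp q_hom (hom_comp f_hom (hom_comp v_hom iI_hom))).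
have pv0 := hom_Pbar_infl (hom_comp p_hom (hom_comp f_hom v_hom)).
exists (p \o (f \o u))%VF, g, h; split=> // t x.
have -> : ((t, i x) : S) = u t + v (i x).
  by rewrite uE vE; apply: (dsum_split ((t, i x) : S)).
rewrite linearD [LHS]surjective_pairing -pE -qE !linearD /= gE hE !comp_lfunE.
by have := pv0 (i x); rewrite !comp_lfunE => ->; rewrite addr0.
Qed.

Lemma endo_entries_inj f f' : is_hom f -> is_hom f' ->
  (forall t x, f (t, i x) = f' (t, i x)) -> f = f'.
Proof.
move=> f_hom f'_hom e.
have [v [v_hom vE]] := hom_inr (infl T) Pbar.
have [p [p_hom pE]] := hom_fst (infl T) Pbar; have [q [q_hom qE]] := hom_snd (infl T) Pbar.
have d_hom := hom_comp (hom_sub f_hom f'_hom) v_hom.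
have d0 y : (f - f') (v y) = 0.
  have dq : forall y, (q \o ((f - f') \o v))%VF y = 0.
    apply: hom_Pbar_ext; first exact: hom_comp q_hom d_hom.
    move=> x; rewrite !comp_lfunE vE sub_lfunE e subrr.
    by rewrite linear0.
  rewrite [LHS]surjective_pairing -pE -qE.
  have := hom_Pbar_infl (hom_comp p_hom d_hom) y; rewrite !comp_lfunE => ->.
  by have := dq y; rewrite !comp_lfunE => ->.
apply/lfunP => -[t y]; apply/eqP; rewrite -subr_eq0 -opp_lfunE -add_lfunE.
have -> : ((t, y) : S) = (t, i 0) + v y.
  by rewrite vE linear0; apply: (dsum_split ((t, y) : S)).
by rewrite linearD /= d0 addr0 sub_lfunE e subrr.
Qed.

Lemma endo_entries_onto (c : 'End(T)) (g : 'Hom(T, I)) (h : 'End(I)) :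
  is_hom c -> is_hom g -> is_hom h ->
  exists f, is_hom f /\ forall t x, f (t, i x) = (c t, i (g t + h x)).
Proof.
move=> c_hom g_hom h_hom.
have c'_hom : @is_hom _ _ (infl T) (infl T) c by move=> t w; rewrite !infl_actE c_hom.
have iI_inj : @injhom _ _ (infl I) Pbar i.
  split; last by apply/lker0_inj; case: iP.
  by move=> x w; rewrite (corner_act iP).
have [h' [h'_hom h'E]] := Pbar_injective hP iI_inj (corner_hom iP h_hom).
have [z [z_hom zE]] := hom_copair (corner_hom iP g_hom) h'_hom.
have [p [p_hom pE]] := hom_fst (infl T) Pbar.
have [f [f_hom fE]] := hom_pair (hom_comp c'_hom p_hom) z_hom.
have h'i x : h' (i x) = i (h x) by rewrite -[LHS]comp_lfunE -h'E comp_lfunE.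
by exists f; split=> // t x; rewrite fE zE !comp_lfunE pE /= h'i -linearD.
Qed.

(** An endomorphism of T + Pbar is determined by its restriction to T + I, which preserves
    I, and every endomorphism of T + I that preserves I extends because Pbar is
    injective. *)
Lemma endo_pair_ex (nzS : ~ is_zero S) : exists P : endo_pair (endo_falg nzS) T I, True.
Proof.
have [i_inj _ _] := iP; pose B := endo_falg nzS.
have ex (b : B) : exists u : 'End(T) * 'Hom(T, I) * 'End(I),
    [/\ is_hom u.1.1, is_hom u.1.2, is_hom u.2 &
        forall t x, endo_val b (t, i x) = (u.1.1 t, i (u.1.2 t + u.2 x))].
  have [c [g [h [? ? ? ?]]]] := endo_entries (endo_val_hom b).
  by exists (c, g, h).
have [u uP] := choice_fun ex.
have c_hom b : is_hom (u b).1.1 by case: (uP b).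
have g_hom b : is_hom (u b).1.2 by case: (uP b).
have h_hom b : is_hom (u b).2 by case: (uP b).
have uE (b : B) t x : endo_val b (t, i x) = ((u b).1.1 t, i ((u b).1.2 t + (u b).2 x)).
  by case: (uP b).
have cE (b : B) t : (u b).1.1 t = (endo_val b (t, i 0)).1 by rewrite uE.
have gE (b : B) t : i ((u b).1.2 t) = (endo_val b (t, i 0)).2 by rewrite uE /= linear0 addr0.
have hE (b : B) x : i ((u b).2 x) = (endo_val b (0, i x)).2 by rewrite uE /= linear0 add0r.
have lin c (b b' : B) z : endo_val (c *: b + b') z = c *: endo_val b z + endo_val b' z.
  by rewrite (endo_val_linear (nzM := nzS)) lfunDZ.
unshelve eexists (@EndoPair k A B T I (fun b => (u b).1.1) (fun b => (u b).1.2)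
  (fun b => (u b).2) _ _ _ c_hom g_hom h_hom _ _ _ _ _ _ _ _) => //.
- by move=> c b b'; apply/lfunP => t; rewrite lfunDZ !cE lin.
- move=> c b b'; apply/lfunP => t; apply: i_inj.
  by rewrite lfunDZ linearP /= !gE lin.
- move=> c b b'; apply/lfunP => t; apply: i_inj.
  by rewrite lfunDZ linearP /= !hE lin.
- by apply/lfunP => t; rewrite cE endo_val_one !id_lfunE.
- by apply/lfunP => t; apply: i_inj; rewrite gE endo_val_one id_lfunE zero_lfunE.
- by apply/lfunP => t; apply: i_inj; rewrite hE endo_val_one !id_lfunE.
- move=> b b'; apply/lfunP => t.
  by rewrite comp_lfunE cE endo_val_mul comp_lfunE uE [in LHS]uE.
- move=> b b'; apply/lfunP => t; apply: i_inj.
  by rewrite add_lfunE !comp_lfunE gE endo_val_mul comp_lfunE uE [in LHS]uE /= linear0 addr0.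
- move=> b b'; apply/lfunP => t; apply: i_inj.
  rewrite comp_lfunE hE endo_val_mul comp_lfunE uE [in LHS]uE /= !linear0.
  by rewrite !add0r.
- move=> b b' e1 e2 e3; apply: endo_val_inj.
  apply: endo_entries_inj; try exact: endo_val_hom.
  by move=> t x; rewrite !uE e1 e2 e3.
move=> c g h c_hom' g_hom' h_hom'.
have [f [f_hom fE]] := endo_entries_onto c_hom' g_hom' h_hom'.
have [b bE] := endo_val_onto nzS f_hom; exists b; split; apply/lfunP => t.
- by rewrite cE bE fE.
- by apply: i_inj; rewrite gE bE fE /= linear0 addr0.
by apply: i_inj; rewrite hE bE fE /= linear0 add0r.
Qed.

End Interface.

(** * Comparison of the two finiteness conditions *)

Section Comparison.
Variables (k : fieldType) (A B : falgType k) (T I : rmod A) (P : endo_pair B T I).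
Hypotheses (hA : hereditary A) (hT : tilting T).
Hypotheses (hI : injective_mod I) (cogI : forall M : rmod A, cogenerated M I).
Implicit Types (M N : rmod B^c) (s t u : triple A).

Lemma tsum_zerol s u : tzero s -> tisom (tsum s u) u.
Proof.
move=> [s1 s2].
have [x [x_hom xE]] := hom_snd (tsrc s) (tsrc u).
have [y [y_hom yE]] := hom_snd (ttgt s) (ttgt u).
exists x, y; split.
- by split=> //; apply/lfunP => z; rewrite !comp_lfunE yE xE lfunE.
- exists (fun z => (0, z)) => [[z z']|z]; rewrite xE //=.
  by rewrite (s1 z).
exists (fun z => (0, z)) => [[z z']|z]; rewrite yE //=.
by rewrite (s2 z).
Qed.

Lemma tsum_zeror s u : tzero u -> tisom (tsum s u) s.
Proof.
move=> [u1 u2].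
have [x [x_hom xE]] := hom_fst (tsrc s) (tsrc u).
have [y [y_hom yE]] := hom_fst (ttgt s) (ttgt u).
exists x, y; split.
- by split=> //; apply/lfunP => z; rewrite !comp_lfunE yE xE lfunE.
- exists (fun z => (z, 0)) => [[z z']|z]; rewrite xE //=.
  by rewrite (u1 z').
exists (fun z => (z, 0)) => [[z z']|z]; rewrite yE //=.
by rewrite (u2 z').
Qed.

Lemma to_module_zero t : is_zero (to_module P t) -> ext_vanish (ttgt t) T -> tzero t.
Proof.
move=> t0 YT; apply: (tisom_zero (tisom_sym (to_triple_to_module P hA hT cogI YT))).
by split=> h; apply: homs_eq => m; rewrite (t0 m) !linear0.
Qed.

Lemma to_triple_zero M : is_zero M -> tzero (to_triple P M).
Proof. by move=> M0; split=> h; apply: homs_eq => m; rewrite (M0 m) !linear0. Qed.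

Lemma to_module_tzero t : tzero t -> is_zero (to_module P t).
Proof.
move=> [X0 Y0] u; apply: (@psi_eq _ _ _ _ t u 0) => z; first by rewrite (Y0 z) !linear0.
by rewrite (X0 z) !linear0.
Qed.

(** A decomposition of M gives one of t, so that a summand of M with zero triple can be
    dropped. *)
Lemma to_triple_indecomposable t M : tindecomposable t -> tisom t (to_triple P M) ->
  exists N, indecomposable N /\ tisom t (to_triple P N).
Proof.
move=> [nzt dec]; have [m] := ubnP (\dim {:M}); elim: m M => // m IH M; rewrite ltnS => leMm tM.
case: (indec_cases M) => [/to_triple_zero M0|M_ind|[X [Y [MXY _ _ ltX ltY]]]].
- by case: nzt; apply: tisom_zero (tisom_sym tM) M0.
- by exists M.
have tXY := tisom_trans tM (tisom_trans (to_triple_isom P MXY) (to_triple_sum P X Y)).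
case: (dec _ _ tXY) => [X0|Y0]; [apply: (IH Y) | apply: (IH X)]; try exact: leq_trans leMm.
  exact: tisom_trans tXY (tsum_zerol _ X0).
exact: tisom_trans tXY (tsum_zeror _ Y0).
Qed.

Lemma finite_triples_of_modules :
  representation_finite B^c -> finite_type (fun t => in_C T (ttgt t)).
Proof.
case=> n [S SP]; exists n, (fun i => to_triple P (S i)) => t /(in_C_vanish hA T) YT t_ind.
have [N [N_ind tN]] := to_triple_indecomposable t_ind (to_triple_to_module P hA hT cogI YT).
have [i NS] := SP N N_ind; exists i.
exact: tisom_trans tN (to_triple_isom P NS).
Qed.

(** Indecomposable A-modules X give indecomposable triples (X, 0, 0). *)
Lemma finite_modules_of_triples :
  finite_type (fun t => in_C T (ttgt t)) -> representation_finite A.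
Proof.
case=> n [S SP]; exists n, (fun i => tsrc (S i)) => M [nzM dec].
have Z0 := @zero_mod_zero _ A.
pose t := Triple (@hom_zero _ _ M (zero_mod A)).
have [||i [x [y [[x_hom _ _] x_bij _]]]] := SP t; last by exists i, x.
  by apply/(in_C_vanish hA T); apply: zero_vanish.
split=> [[M0 _]|s u tsu]; first exact: nzM.
have /isom_zero/(_ Z0) su0 := tisom_tgt tsu.
case: tsu => x [y [[x_hom _ _] x_bij _]].
case: (dec (tsrc s) (tsrc u)) => [|s0|u0]; first by exists x.
  by left; split=> // z; have /(congr1 fst) := su0 (z, 0).
by right; split=> // z; have /(congr1 snd) := su0 (0, z).
Qed.

Lemma finite_left_modules_of_triples :
  finite_type (fun t => in_C T (ttgt t)) -> representation_finite B^c.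
Proof.
move=> fin; have exc_ext M : exceptional P M -> exists C, is_ext P C M by apply: exceptional_ext.
have [n' [S' S'P]] := ext_finite (finite_modules_of_triples fin) exc_ext.
have [n [S SP]] := fin.
exists (n + n')%N, (fun i => match split i with inl j => to_module P (S j) | inr j => S' j end).
move=> M M_ind; case: (to_module_to_triple P hA hT hI cogI M_ind) => [MM|M_exc].
  have tM_ind : tindecomposable (to_triple P M).
    split=> [/to_module_tzero M0|s u Msu].
      by case: M_ind => nzM _; apply: nzM; apply: isom_zero (isom_sym MM) M0.
    have YT : ext_vanish (dsum (ttgt s) (ttgt u)) T.
      by apply: isom_vanish (tisom_tgt Msu) _; apply: to_triple_vanish.
    have summand (X Z : rmod A) : isom (dsum (ttgt s) (ttgt u)) (dsum X Z) -> ext_vanish X T.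
      move=> /isom_retract[i [r [i_hom r_hom rK]]].
      exact: retract_vanish i_hom r_hom rK YT.
    have sT := summand _ _ (isom_refl _); have uT := summand _ _ (dsumC_isom _ _).
    have := isom_trans MM (isom_trans (to_module_isom P Msu) (to_module_sum P s u)).
    by case/M_ind.2 => [s0|u0]; [left | right]; apply: to_module_zero.
  have MT : in_C T (ttgt (to_triple P M)).
    by apply/(in_C_vanish hA T); apply: to_triple_vanish.
  have [i MS] := SP _ MT tM_ind; exists (lshift n' i).
  case: (split_ordP (lshift n' i)) => j; last by move/eqP; rewrite eq_lrshift.
  by move/lshift_inj <-; apply: isom_trans MM (to_module_isom P MS).
have [i MS] := S'P M M_ind M_exc; exists (rshift n i).
case: (split_ordP (rshift n i)) => j; first by move/eqP; rewrite eq_rlshift.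
by move/rshift_inj <-.
Qed.

End Comparison.

Theorem theorem2 (k : closedFieldType) (A : falgType k) (T : rmod A)
    (Pbar : rmod (dup A)) (hA : hereditary A) (hT : tilting T) (bT : basic T)
    (hP : sum_all_projinj Pbar) :
  representation_finite (endo_falg (Tbar_nonzero (P := Pbar) hT)) <->
  finite_type (fun t : triple A => in_C T (ttgt t)).
Proof.
have [I [i iP]] := corner_module Pbar.
have [P _] := endo_pair_ex hP iP (Tbar_nonzero (P := Pbar) hT).
have hI := corner_injective iP (Pbar_injective hP).
have cogI := corner_cogenerator hP iP.
split=> [/representation_finite_opp|fin].
  exact: finite_triples_of_modules P hA hT cogI.
apply/representation_finite_opp.
exact: finite_left_modules_of_triples P hA hT hI cogI fin.
Qed.
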